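(* Let $\mathcal{G}$ be a minimal effective étale groupoid over a Cantor space $X$, and let $\mathcal{H}$ be an étale groupoid over any compact space $Y$. Let $G$ be a subgroup of $\mathsf{F}(\mathcal{G})$ that contains $\mathsf{A}(\mathcal{G})$. Let $\rho\colon G\to \mathsf{F}(\mathcal{H})$ be a group homomorphism, and let $Z\subset Y$ be the support of $\rho(\mathsf{A}(\mathcal{G}))$. Exactly one of the following possibilities holds. (i) The set $Z$ is empty (and thus $\rho$ factors through the quotient $G/\mathsf{A}(\mathcal{G})$). (ii) There exists a point $y\in Z$ such that the map $G\to \mathcal{H}_y$, $g\mapsto [\rho(g)]_y$, is injective. (iii) The set $Z$ is (non-empty and) clopen in $Y$, and there exists $r\ge 1$ such that $\rho|_{\mathsf{A}(\mathcal{G})}$ uniquely extends to a continuous morphism of pseudogroups $$\widetilde{\rho}\colon\widetilde{\mathcal{G}^{[r]}}\to \widetilde{\mathcal{H}|Z}.$$ Moreover, there exists a group homomorphism $\psi\colon G/\mathsf{A}(\mathcal{G})\to \mathsf{F}(\mathcal{H})$ whose image centralises $\widetilde{\rho}(G)$, and such that for every $g\in G$ we have $\rho(g)=\widetilde{\rho}(g)\,\psi(g\mathsf{A}(\mathcal{G}))$.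
   Context: Étale groupoids. An étale groupoid over a Hausdorff space $X$ is a topological groupoid $\mathcal{G}$ (whose topology need not be Hausdorff) with unit space $X\subset\mathcal{G}$, whose source and range maps $\mathsf{s},\mathsf{r}\colon\mathcal{G}\to X$ are open local homeomorphisms; the product $\gamma\delta$ is defined iff $\mathsf{s}(\gamma)=\mathsf{r}(\delta)$. $\mathcal{G}_x=\mathsf{s}^{-1}(x)$; the orbit of $x$ is $\mathsf{r}(\mathcal{G}_x)$; $\mathcal{G}$ is minimal if every orbit is dense. A bisection is an open $T\subset\mathcal{G}$ such that $\mathsf{s}|_T,\mathsf{r}|_T$ are homeomorphisms onto their images. The set $\widetilde{\mathcal{G}}$ of bisections (the pseudogroup of $\mathcal{G}$) is an inverse monoid under $TS=\{\gamma\delta\colon\gamma\in T,\delta\in S,\mathsf{s}(\gamma)=\mathsf{r}(\delta)\}$ and $T^{-1}=\{\gamma^{-1}\colon\gamma\in T\}$, with unit $X$, zero $\varnothing$, and idempotents the open subsets of $X$. Each $T\in\widetilde{\mathcal{G}}$ induces a homeomorphism $\tau(T)=\mathsf{r}|_T\circ(\mathsf{s}|_T)^{-1}\colon\mathsf{s}(T)\to\mathsf{r}(T)$; $\mathcal{G}$ is effective if $T\mapsto\tau(T)$ is injective. For $x\in\mathsf{s}(T)$, $[T]_x$ is the unique $\gamma\in T$ with $\mathsf{s}(\gamma)=x$. A family $\{F_i\}$ of bisections is compatible if $F_iF_j^{-1}$ and $F_i^{-1}F_j$ are idempotents for all $i,j$; then $\bigcup F_i$ is a bisection. A continuous morphism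 $\varphi\colon\widetilde{\mathcal{G}}\to\widetilde{\mathcal{H}}$ (for groupoids over $X$, $Y$) is a semigroup homomorphism that preserves unions of compatible families, with $\varphi(\varnothing)=\varnothing$ and $\varphi(X)=Y$. Full groups. $\mathsf{F}(\mathcal{G})$ is the group of bisections $g$ with $\mathsf{s}(g)=\mathsf{r}(g)=X$. For $X$ a Cantor space (homeomorphic to the Cantor set), $\mathsf{A}(\mathcal{G})\le\mathsf{F}(\mathcal{G})$ is the subgroup generated by all 3-cycles, i.e. elements $g\in\mathsf{F}(\mathcal{G})$ with $g^3=1$ for which there are disjoint clopen sets $U_1,U_2,U_3\subset X$ cyclically permuted by $\tau(g)$ ($U_1\mapsto U_2\mapsto U_3\mapsto U_1$) and $X\setminus(U_1\cup U_2\cup U_3)\subset g$. It is a normal subgroup of $\mathsf{F}(\mathcal{G})$. Support and restriction. For $g\in\mathsf{F}(\mathcal{H})$, $\mathrm{Supp}(g)=\{y\in Y\colon[g]_y\ne y\}$; for $K\le\mathsf{F}(\mathcal{H})$, $\mathrm{Supp}(K)=\overline{\bigcup_{k\in K}\mathrm{Supp}(k)}$. $\mathcal{H}|Z=\{\gamma\in\mathcal{H}\colon\mathsf{s}(\gamma),\mathsf{r}(\gamma)\in Z\}$; for $Z$ clopen, $\mathsf{F}(\mathcal{H}|Z)$ is identified with the subgroup of $\mathsf{F}(\mathcal{H})$ of elements with support contained in $Z$. Symmetric power. $X^{[r]}$ is the space of non-empty subsets of $X$ of cardinality at most $r$, with the quotient topology of $X^r$. $\mathcal{G}^{[r]}$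 is the étale groupoid over $X^{[r]}$ whose elements are the non-empty finite subsets $\mathcal{Q}\subset\mathcal{G}$ of cardinality at most $r$ such that any two distinct elements of $\mathcal{Q}$ have different sources and different ranges; source and range are $\mathsf{s}(\mathcal{Q}),\mathsf{r}(\mathcal{Q})$ (images), and for $\mathsf{s}(\mathcal{Q}_1)=\mathsf{r}(\mathcal{Q}_2)$ the product is $\mathcal{Q}_1\mathcal{Q}_2=\{\gamma_1\gamma_2\colon\gamma_i\in\mathcal{Q}_i,\ \mathsf{s}(\gamma_1)=\mathsf{r}(\gamma_2)\}$. Its topology is the quotient topology from the set of tuples $(\gamma_1,\dots,\gamma_r)\in\mathcal{G}^r$ such that $\gamma_i\ne\gamma_j$ implies $\mathsf{s}(\gamma_i)\ne\mathsf{s}(\gamma_j)$ and $\mathsf{r}(\gamma_i)\ne\mathsf{r}(\gamma_j)$. The group $\mathsf{F}(\mathcal{G})$ (hence $G$ and $\mathsf{A}(\mathcal{G})$) is viewed as a subgroup of $\mathsf{F}(\mathcal{G}^{[r]})\subset\widetilde{\mathcal{G}^{[r]}}$ through $g\mapsto g^{[r]}=\{\mathcal{Q}\in\mathcal{G}^{[r]}\colon\mathcal{Q}\subset g\}$; with this identification ''extends'' means $\widetilde{\rho}(g)=\rho(g)$ for $g\in\mathsf{A}(\mathcal{G})$, and $\widetilde{\rho}(g)\in\mathsf{F}(\mathcal{H}|Z)\le\mathsf{F}(\mathcal{H})$ for $g\in G$. *)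

(* Defs.v *)
From HB Require Import structures.
From mathcomp Require Import all_boot all_order all_algebra generic_quotient.
From mathcomp Require Import all_classical all_reals all_analysis.

Set Implicit Arguments.
Unset Strict Implicit.
Unset Printing Implicit Defensive.

Local Open Scope classical_set_scope.
Local Open Scope card_scope.

Definition homeomorphic (S T : topologicalType) : Prop :=
  exists (f : S -> T) (g : T -> S),
    [/\ continuous f, continuous g, cancel f g & cancel g f].

(* [f] restricts to a homeomorphism from [U] onto its image [f @` U]. *)
Definition homeo_on (S T : topologicalType) (U : set S) (f : S -> T) : Prop :=
  exists g : T -> S, [/\ {in U, cancel f g}, {within U, continuous f} &
    {within f @` U, continuous g}].

Definition open_map (S T : topologicalType) (f : S -> T) : Prop :=
  forall U : set S, open U -> open (f @` U).

Definition local_homeo (S T : topologicalType) (f : S -> T) : Prop :=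
  forall x : S, exists U : set S,
    [/\ open U, U x, open (f @` U) & homeo_on U f].

(* Groupoids.  Multiplication is a total function, but it is only meaningful
   (and only constrained) on pairs [(a, b)] such that [gsrc a = grng b].  The
   unit space is the range of [gunit]; a continuous [gunit] is a topological
   embedding, because [gsrc] is then a continuous left inverse. *)

Record groupoid (X : topologicalType) : Type := Groupoid {
  arrow :> topologicalType;
  gsrc : arrow -> X;
  grng : arrow -> X;
  gunit : X -> arrow;
  ginv : arrow -> arrow;
  gmul : arrow -> arrow -> arrow;
  gsrc_unit : forall x, gsrc (gunit x) = x;
  grng_unit : forall x, grng (gunit x) = x;
  gsrc_inv : forall a, gsrc (ginv a) = grng a;
  grng_inv : forall a, grng (ginv a) = gsrc a;
  gsrc_mul : forall a b, gsrc a = grng b -> gsrc (gmul a b) = gsrc b;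
  grng_mul : forall a b, gsrc a = grng b -> grng (gmul a b) = grng a;
  gmulA : forall a b c, gsrc a = grng b -> gsrc b = grng c ->
    gmul a (gmul b c) = gmul (gmul a b) c;
  gmul1 : forall a, gmul a (gunit (gsrc a)) = a;
  g1mul : forall a, gmul (gunit (grng a)) a = a;
  gmulV : forall a, gmul a (ginv a) = gunit (grng a);
  gVmul : forall a, gmul (ginv a) a = gunit (gsrc a)
}.

Record etale (X : topologicalType) (G : groupoid X) : Prop := Etale {
  etale_hausdorff : hausdorff_space X;
  etale_unit : continuous (@gunit X G);
  etale_inv : continuous (@ginv X G);
  etale_mul : {within [set p : G * G | gsrc p.1 = grng p.2],
    continuous (fun p : G * G => gmul p.1 p.2)};
  etale_src : open_map (@gsrc X G) /\ local_homeo (@gsrc X G);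
  etale_rng : open_map (@grng X G) /\ local_homeo (@grng X G)
}.

Section Pseudogroup.
Context {X : topologicalType} (G : groupoid X).
Implicit Types (T S : set G) (x : X) (F K : set (set G)).

Definition unit_space : set G := range (@gunit X G).

Definition set_mul T S : set G :=
  [set c | exists a b, [/\ T a, S b, gsrc a = grng b & c = gmul a b]].

Definition set_inv T : set G := (@ginv X G) @` T.

Definition bisection T : Prop :=
  [/\ open T, homeo_on T (@gsrc X G) & homeo_on T (@grng X G)].

Definition bis_idempotent T : Prop := set_mul T T = T.

Definition compatible F : Prop := forall T S, F T -> F S ->
  bis_idempotent (set_mul T (set_inv S)) /\
  bis_idempotent (set_mul (set_inv T) S).

(* The partial homeomorphism induced by a bisection, given by its graph
   (this determines its domain and range). *)
Definition tau T : set (X * X) := (fun a => (gsrc a, grng a)) @` T.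

Definition tau_image T (U : set X) : set X :=
  [set y | exists2 x, U x & tau T (x, y)].

(* The default value [gunit x] is only used if [x] is not in [gsrc @` T]. *)
Definition germ T x : G := xget (gunit G x) [set a | T a /\ gsrc a = x].

Definition gorbit x : set X := (@grng X G) @` [set a | gsrc a = x].

Definition minimal_groupoid : Prop := forall x, dense (gorbit x).

Definition effective_groupoid : Prop :=
  forall T S, bisection T -> bisection S -> tau T = tau S -> T = S.

Definition full_group : set (set G) :=
  [set g | [/\ bisection g, (@gsrc X G) @` g = setT &
    (@grng X G) @` g = setT]].

Definition subgroup K : Prop :=
  [/\ K `<=` full_group, K unit_space,
    forall g h, K g -> K h -> K (set_mul g h) &
    forall g, K g -> K (set_inv g)].

Definition three_cycle : set (set G) :=
  [set g | [/\ full_group g, set_mul g (set_mul g g) = unit_space &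
    exists U1 U2 U3 : set X,
      [/\ [/\ clopen U1, clopen U2 & clopen U3],
        [/\ U1 `&` U2 = set0, U2 `&` U3 = set0 & U1 `&` U3 = set0],
        [/\ tau_image g U1 = U2, tau_image g U2 = U3 &
          tau_image g U3 = U1] &
        (@gunit X G) @` (~` (U1 `|` U2 `|` U3)) `<=` g]]].

Definition alternating_group : set (set G) := smallest subgroup three_cycle.

Definition supp (g : set G) : set X := [set x | germ g x <> gunit G x].

Definition group_supp K : set X := closure (\bigcup_(k in K) supp k).

Definition left_coset K (g : set G) : set (set G) :=
  [set set_mul g k | k in K].

(* The quotient of the group [L] by its normal subgroup [K]. *)
Definition coset_group L K : set (set (set G)) :=
  [set left_coset K g | g in L].

Definition left_coset_mul (C D : set (set G)) : set (set G) :=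
  [set T | exists g h, [/\ C g, D h & T = set_mul g h]].

End Pseudogroup.

Arguments unit_space {X} G.
Arguments minimal_groupoid {X} G.
Arguments effective_groupoid {X} G.
Arguments full_group {X} G.
Arguments three_cycle {X} G.
Arguments alternating_group {X} G.

Section Morphisms.
Context {X Y : topologicalType} (G : groupoid X) (H : groupoid Y).

Definition group_morphism (K : set (set G)) (rho : set G -> set H) : Prop :=
  (forall g, K g -> full_group H (rho g)) /\
  (forall g h, K g -> K h -> rho (set_mul g h) = set_mul (rho g) (rho h)).

Definition quotient_morphism (L K : set (set G))
    (psi : set (set G) -> set H) : Prop :=
  (forall C, coset_group L K C -> full_group H (psi C)) /\
  (forall C D, coset_group L K C -> coset_group L K D ->
     psi (left_coset_mul C D) = set_mul (psi C) (psi D)).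

(* Only the values of [phi] on bisections are meaningful. *)
Definition continuous_morphism (phi : set G -> set H) : Prop :=
  [/\ forall T, bisection T -> bisection (phi T),
      forall T S, bisection T -> bisection S ->
        phi (set_mul T S) = set_mul (phi T) (phi S),
      forall F : set (set G), F `<=` bisection (G := G) -> compatible F ->
        phi (\bigcup_(T in F) T) = \bigcup_(T in F) phi T,
      phi set0 = set0 &
      phi (unit_space G) = unit_space H].

End Morphisms.

Section Restriction.
Context {Y : topologicalType} (H : groupoid Y) (Z : set Y).

Definition restr_arrow : set H := [set a | Z (gsrc a) /\ Z (grng a)].

Let A := set_type restr_arrow.
Let B := set_type Z.

Let AP (a : A) : restr_arrow (val a). Proof. exact: set_mem (valP a). Qed.

Definition restr_src (a : A) : B := SigSub (mem_set (AP a).1).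
Definition restr_rng (a : A) : B := SigSub (mem_set (AP a).2).

Let unitP (x : B) : restr_arrow (gunit H (val x)).
Proof.
have := set_mem (valP x).
by split; rewrite ?gsrc_unit ?grng_unit.
Qed.

Definition restr_unit (x : B) : A := SigSub (mem_set (unitP x)).

Let invP (a : A) : restr_arrow (ginv (val a)).
Proof. by have [] := AP a; split; rewrite ?gsrc_inv ?grng_inv. Qed.

Definition restr_inv (a : A) : A := SigSub (mem_set (invP a)).

(* [insubd a c] is [c] if [c] is in the restriction; this is the case for the
   product of composable arrows. *)
Definition restr_mul (a b : A) : A := insubd a (gmul (val a) (val b)).

Let comp_val (a b : A) :
  restr_src a = restr_rng b -> gsrc (val a) = grng (val b).
Proof. by move=> /(congr1 val). Qed.

Lemma val_restr_mul (a b : A) : restr_src a = restr_rng b ->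
  val (restr_mul a b) = gmul (val a) (val b).
Proof.
move=> /comp_val ab; rewrite /restr_mul insubdK //; apply/mem_set.
by split; rewrite ?gsrc_mul ?grng_mul //; [case: (AP b)|case: (AP a)].
Qed.

Let src_unit x : restr_src (restr_unit x) = x.
Proof. by apply: val_inj; rewrite /= gsrc_unit. Qed.

Let rng_unit x : restr_rng (restr_unit x) = x.
Proof. by apply: val_inj; rewrite /= grng_unit. Qed.

Let src_inv a : restr_src (restr_inv a) = restr_rng a.
Proof. by apply: val_inj; rewrite /= gsrc_inv. Qed.

Let rng_inv a : restr_rng (restr_inv a) = restr_src a.
Proof. by apply: val_inj; rewrite /= grng_inv. Qed.

Let src_mul a b : restr_src a = restr_rng b ->
  restr_src (restr_mul a b) = restr_src b.
Proof.
move=> ab; apply: val_inj; rewrite /= val_restr_mul // gsrc_mul //.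
exact: comp_val.
Qed.

Let rng_mul a b : restr_src a = restr_rng b ->
  restr_rng (restr_mul a b) = restr_rng a.
Proof.
move=> ab; apply: val_inj; rewrite /= val_restr_mul // grng_mul //.
exact: comp_val.
Qed.

Let mulA a b c : restr_src a = restr_rng b -> restr_src b = restr_rng c ->
  restr_mul a (restr_mul b c) = restr_mul (restr_mul a b) c.
Proof.
move=> ab bc; apply: val_inj.
rewrite !val_restr_mul ?rng_mul ?src_mul //.
by rewrite gmulA //; exact: comp_val.
Qed.

Let mul1 a : restr_mul a (restr_unit (restr_src a)) = a.
Proof. by apply: val_inj; rewrite val_restr_mul ?rng_unit //= gmul1. Qed.

Let unit_mul a : restr_mul (restr_unit (restr_rng a)) a = a.
Proof. by apply: val_inj; rewrite val_restr_mul ?src_unit //= g1mul. Qed.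

Let mulV a : restr_mul a (restr_inv a) = restr_unit (restr_rng a).
Proof. by apply: val_inj; rewrite val_restr_mul ?rng_inv //= gmulV. Qed.

Let Vmul a : restr_mul (restr_inv a) a = restr_unit (restr_src a).
Proof. by apply: val_inj; rewrite val_restr_mul ?src_inv //= gVmul. Qed.

Definition restriction : groupoid B :=
  Groupoid (arrow := A) src_unit rng_unit src_inv rng_inv src_mul rng_mul
    mulA mul1 unit_mul mulV Vmul.

(* The identification of the full group of the restriction with a group of
   elements of the full group of [H]: extension by units outside of [Z]. *)
Definition ext_unit (T : set restriction) : set H :=
  ((val : A -> H) @` T) `|` (@gunit Y H) @` (~` Z).

End Restriction.

(* Non-empty subsets of cardinality at most [r] satisfying [P], as a quotient
   of the space of [r]-tuples whose set of entries satisfies [P].  For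
   [0 < r], the condition [range f !=set0] is vacuous. *)

Section FiniteSubsets.
Context (r : nat) (T : topologicalType) (P : set (set T)).

Definition small_subset : set (set T) :=
  [set Q | [/\ Q !=set0, Q #<= `I_r & P Q]].

Definition small_tuple : set (prod_topology (fun _ : 'I_r => T)) :=
  [set f | range f !=set0 /\ P (range f)].

Definition subset_type : Type := set_type small_subset.

Lemma range_small_subset (f : set_type small_tuple) :
  small_subset (range (val f)).
Proof.
have [f0 Pf] := set_mem (valP f); split=> //.
apply: card_le_trans (card_image_le _ _) _.
by rewrite (card_le_eqr card_II) card_lexx.
Qed.

Lemma small_subset_range (Q : subset_type) :
  exists f : set_type small_tuple, range (val f) = val Q.
Proof.
case: Q => Q /= /set_mem[[q0 Qq0] Qr PQ].
have /pcard_leP/unsquash i := Qr.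
pose f (k : 'I_r) := xget q0 [set q | Q q /\ i q = nat_of_ord k].
have fQ : range f = Q.
  apply/seteqP; split=> [_ [k _ <-]|q Qq].
    by rewrite /f; case: xgetP => [_ -> []|].
  have lt_iq_r : (i q < r)%N by exact: (@funS _ _ Q `I_r i).
  exists (Ordinal lt_iq_r) => //; rewrite /f; case: xgetP => /= [_ -> [Qx ix]|].
    by apply: (@inj _ _ Q i); rewrite ?inE.
  by move=> /(_ q) [].
have ft : f \in small_tuple.
  by apply/mem_set; rewrite /small_tuple /= fQ; split=> //; exists q0.
by exists (SigSub ft).
Qed.

Definition subset_of_tuple (f : set_type small_tuple) : subset_type :=
  SigSub (mem_set (range_small_subset f)).

Definition tuple_of_subset (Q : subset_type) : set_type small_tuple :=
  sval (cid (small_subset_range Q)).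

Lemma tuple_of_subsetK : cancel tuple_of_subset subset_of_tuple.
Proof.
by move=> Q; apply: val_inj; exact: (svalP (cid (small_subset_range Q))).
Qed.

HB.instance Definition _ :=
  isQuotient.Build (set_type small_tuple) subset_type tuple_of_subsetK.

Definition finite_subsets : topologicalType :=
  quotient_topology (subset_type : quotType _).

Definition members (Q : finite_subsets) : set T := val (Q : subset_type).

End FiniteSubsets.

Definition symmetric_power (r : nat) (X : topologicalType) : topologicalType :=
  finite_subsets r [set: set X].

Section SymmetricPower.
Context {X : topologicalType} (G : groupoid X) (r : nat).

Definition multisection : set (set G) :=
  [set Q | forall a b, Q a -> Q b -> a <> b ->
    gsrc a <> gsrc b /\ grng a <> grng b].

Definition sym_arrow : topologicalType := finite_subsets r multisection.

Local Notation A := sym_arrow.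
Local Notation B := (symmetric_power r X).
Local Notation small := (small_subset r multisection).

Let mk_arrow Q (hQ : small Q) : A := SigSub (mem_set hQ).

Let AP (Q : A) : small (members Q).
Proof. exact: set_mem (valP (Q : set_type small)). Qed.

Let members_inj (Q Q' : A) : members Q = members Q' -> Q = Q'.
Proof. exact: val_inj. Qed.

Let bmembers_inj (P P' : B) : members P = members P' -> P = P'.
Proof. exact: val_inj. Qed.

Let msec_src Q a b : multisection Q -> Q a -> Q b -> gsrc a = gsrc b -> a = b.
Proof. by move=> mQ Qa Qb sab; apply: contrapT => /(mQ _ _ Qa Qb)[]. Qed.

Let msec_rng Q a b : multisection Q -> Q a -> Q b -> grng a = grng b -> a = b.
Proof. by move=> mQ Qa Qb rab; apply: contrapT => /(mQ _ _ Qa Qb)[]. Qed.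

Let imageP (f : G -> X) (Q : A) : small_subset r [set: set X] (f @` members Q).
Proof.
have [Q0 Qr _] := AP Q; split=> //; first exact: image_nonempty.
exact: card_le_trans (card_image_le _ _) Qr.
Qed.

Definition sym_src (Q : A) : B := SigSub (mem_set (imageP (@gsrc X G) Q)).
Definition sym_rng (Q : A) : B := SigSub (mem_set (imageP (@grng X G) Q)).

Let unitP (P : B) : small ((@gunit X G) @` members P).
Proof.
have [P0 Pr _] := set_mem (valP (P : set_type (small_subset r [set: set X]))).
split; first exact: image_nonempty.
  exact: card_le_trans (card_image_le _ _) Pr.
move=> _ _ [x _ <-] [y _ <-] xy; rewrite !gsrc_unit !grng_unit.
by split=> exy; apply: xy; rewrite exy.
Qed.

Definition sym_unit (P : B) : A := mk_arrow (unitP P).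

Let invP (Q : A) : small (set_inv (members Q)).
Proof.
have [Q0 Qr mQ] := AP Q; split; first exact: image_nonempty.
  exact: card_le_trans (card_image_le _ _) Qr.
move=> _ _ [a Qa <-] [b Qb <-] ab; rewrite !gsrc_inv !grng_inv.
have nab : a <> b by move=> eab; apply: ab; rewrite eab.
by have [] := mQ _ _ Qa Qb nab.
Qed.

Definition sym_inv (Q : A) : A := mk_arrow (invP Q).

(* [insubd Q Q'] is [Q'] if [Q'] is an element of the symmetric power; this is
   the case for the product of composable elements. *)
Definition sym_mul (Q1 Q2 : A) : A :=
  insubd (Q1 : set_type small) (set_mul (members Q1) (members Q2)).

Let comp_members (Q1 Q2 : A) : sym_src Q1 = sym_rng Q2 ->
  (@gsrc X G) @` members Q1 = (@grng X G) @` members Q2.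
Proof. by move=> /(congr1 (@members _ _ _)). Qed.

Lemma members_sym_mul (Q1 Q2 : A) : sym_src Q1 = sym_rng Q2 ->
  members (sym_mul Q1 Q2) = set_mul (members Q1) (members Q2).
Proof.
move=> /comp_members e12.
have [[a0 Qa0] Q1r m1] := AP Q1; have [Q20 Q2r m2] := AP Q2.
rewrite /members /sym_mul insubdK //; apply/mem_set; split.
- have : ((@gsrc X G) @` members Q1) (gsrc a0) by exists a0.
  by rewrite e12 => -[b Qb ab]; exists (gmul a0 b), a0, b.
- pose f b := gmul (xget b [set a | members Q1 a /\ gsrc a = grng b]) b.
  apply: card_le_trans Q2r; apply: card_le_trans (card_image_le f _).
  apply: subset_card_le => _ [a [b [Qa Qb ab ->]]]; exists b => //.
  rewrite /f; congr (gmul _ b); case: xgetP => [c _ [Qc cb]|/(_ a)[]//].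
  by apply: (msec_src m1 Qc Qa); rewrite cb ab.
- move=> _ _ [a [b [Qa Qb ab ->]]] [c [d [Qc Qd cd ->]]] ne.
  rewrite !gsrc_mul // !grng_mul //; split=> e; apply: ne.
    have bd := msec_src m2 Qb Qd e; rewrite -bd in cd *.
    by rewrite (msec_src m1 Qa Qc) // ab cd.
  have ac := msec_rng m1 Qa Qc e; rewrite -ac in cd *.
  by rewrite (msec_rng m2 Qb Qd) // -ab cd.
Qed.

Let src_unit P : sym_src (sym_unit P) = P.
Proof.
apply: bmembers_inj; rewrite /members /= image_comp.
rewrite -[RHS]image_id; apply: eq_imagel => x _ /=; exact: gsrc_unit.
Qed.

Let rng_unit P : sym_rng (sym_unit P) = P.
Proof.
apply: bmembers_inj; rewrite /members /= image_comp.
rewrite -[RHS]image_id; apply: eq_imagel => x _ /=; exact: grng_unit.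
Qed.

Let src_inv Q : sym_src (sym_inv Q) = sym_rng Q.
Proof.
apply: bmembers_inj; rewrite /members /= image_comp.
by apply: eq_imagel => a _ /=; exact: gsrc_inv.
Qed.

Let rng_inv Q : sym_rng (sym_inv Q) = sym_src Q.
Proof.
apply: bmembers_inj; rewrite /members /= image_comp.
by apply: eq_imagel => a _ /=; exact: grng_inv.
Qed.

Let src_mul Q1 Q2 : sym_src Q1 = sym_rng Q2 ->
  sym_src (sym_mul Q1 Q2) = sym_src Q2.
Proof.
move=> c12; apply: bmembers_inj; rewrite {1}/members /= members_sym_mul //.
apply/seteqP; split=> [_ [_ [a [b [Qa Qb ab ->]]] <-]|_ [b Qb <-]].
  by exists b => //; rewrite gsrc_mul.
have : ((@grng X G) @` members Q2) (grng b) by exists b.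
rewrite -(comp_members c12) => -[a Qa ab].
by exists (gmul a b); [exists a, b|rewrite gsrc_mul].
Qed.

Let rng_mul Q1 Q2 : sym_src Q1 = sym_rng Q2 ->
  sym_rng (sym_mul Q1 Q2) = sym_rng Q1.
Proof.
move=> c12; apply: bmembers_inj; rewrite {1}/members /= members_sym_mul //.
apply/seteqP; split=> [_ [_ [a [b [Qa Qb ab ->]]] <-]|_ [a Qa <-]].
  by exists a => //; rewrite grng_mul.
have : ((@gsrc X G) @` members Q1) (gsrc a) by exists a.
rewrite (comp_members c12) => -[b Qb ab].
by exists (gmul a b); [exists a, b|rewrite grng_mul].
Qed.

Let set_mulA (Q1 Q2 Q3 : set G) :
  set_mul Q1 (set_mul Q2 Q3) = set_mul (set_mul Q1 Q2) Q3.
Proof.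
apply/seteqP; split=> d.
  move=> [a [_ [Qa [b [c [Qb Qc bc ->]]] abc ->]]].
  have ab : gsrc a = grng b by rewrite abc grng_mul.
  exists (gmul a b), c; split; rewrite ?gsrc_mul ?gmulA //.
  by exists a, b.
move=> [_ [c [[a [b [Qa Qb ab ->]]] Qc abc ->]]].
have bc : gsrc b = grng c by rewrite -abc gsrc_mul.
exists a, (gmul b c); split; rewrite ?grng_mul ?gmulA //.
by exists b, c.
Qed.

Let mulA Q1 Q2 Q3 : sym_src Q1 = sym_rng Q2 -> sym_src Q2 = sym_rng Q3 ->
  sym_mul Q1 (sym_mul Q2 Q3) = sym_mul (sym_mul Q1 Q2) Q3.
Proof.
move=> c12 c23; apply: members_inj.
by rewrite !members_sym_mul ?rng_mul ?src_mul // set_mulA.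
Qed.

Let mul1 Q : sym_mul Q (sym_unit (sym_src Q)) = Q.
Proof.
apply: members_inj; rewrite members_sym_mul ?rng_unit //; apply/seteqP.
split=> [_ [a [_ [Qa [_ [b Qb <-] <-] ab ->]]]|a Qa].
  by move: ab; rewrite grng_unit => <-; rewrite gmul1.
exists a, (gunit G (gsrc a)); split; rewrite ?grng_unit ?gmul1 //.
by exists (gsrc a) => //; exists a.
Qed.

Let unit_mul Q : sym_mul (sym_unit (sym_rng Q)) Q = Q.
Proof.
apply: members_inj; rewrite members_sym_mul ?src_unit //; apply/seteqP.
split=> [_ [_ [a [[_ [b Qb <-] <-] Qa ab ->]]]|a Qa].
  by move: ab; rewrite gsrc_unit => ->; rewrite g1mul.
exists (gunit G (grng a)), a; split; rewrite ?gsrc_unit ?g1mul //.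
by exists (grng a) => //; exists a.
Qed.

Let mulV Q : sym_mul Q (sym_inv Q) = sym_unit (sym_rng Q).
Proof.
have [_ _ mQ] := AP Q.
apply: members_inj; rewrite members_sym_mul ?rng_inv //; apply/seteqP.
split=> [_ [a [_ [Qa [b Qb <-] ab ->]]]|_ [_ [a Qa <-] <-]].
  move: ab; rewrite grng_inv => /(msec_src mQ Qa Qb) <-; rewrite gmulV.
  by exists (grng a) => //; exists a.
by exists a, (ginv a); split; rewrite ?grng_inv ?gmulV //; exists a.
Qed.

Let Vmul Q : sym_mul (sym_inv Q) Q = sym_unit (sym_src Q).
Proof.
have [_ _ mQ] := AP Q.
apply: members_inj; rewrite members_sym_mul ?src_inv //; apply/seteqP.
split=> [_ [_ [a [[b Qb <-] Qa ab ->]]]|_ [_ [a Qa <-] <-]].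
  move: ab; rewrite gsrc_inv => /(msec_rng mQ Qb Qa) ->; rewrite gVmul.
  by exists (gsrc a) => //; exists a.
by exists (ginv a), a; split; rewrite ?gsrc_inv ?gVmul //; exists a.
Qed.

Definition symmetric_groupoid : groupoid (symmetric_power r X) :=
  Groupoid (arrow := A) src_unit rng_unit src_inv rng_inv src_mul rng_mul
    mulA mul1 unit_mul mulV Vmul.

Definition sym_elt (g : set G) : set symmetric_groupoid :=
  [set Q | members (Q : A) `<=` g].

End SymmetricPower.

Arguments sym_elt {X G} r g.

Definition exactly_one (P Q R : Prop) : Prop :=
  [\/ [/\ P, ~ Q & ~ R], [/\ ~ P, Q & ~ R] | [/\ ~ P, ~ Q & R]].

(* Main.v *)
Require Import Defs.
From HB Require Import structures.
From mathcomp Require Import all_boot all_order all_algebra generic_quotient.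
From mathcomp Require Import all_classical all_reals all_analysis.
From mathcomp Require Import zify.

(** The proof first forgets the groupoid: the full group of a minimal effective groupoid
    over a Cantor space is a group of homeomorphisms with dense orbits that contains every
    bijection that agrees locally with its elements ([homeo_full_dynamics]), and the
    alternating group is generated by the 3-cycles $V \to gV \to hV \to V$ of this
    group ([alternatingP]).

    For $y \in Z$ let $K_y$ be the group of the $g$ such that $\rho(g)$ has trivial germ
    at $y$.  If some germ map $g \mapsto [\rho(g)]_y$ is injective, this is the second
    alternative.  Otherwise every $K_y$ is non-trivial; a trivial germ at $y$ is trivial at
    the points near $y$ and $Z$ is compact, so finitely many non-trivial elements meet all
    the $K_y$ ([confining_family]).  As $K_{\rho(g) y} = g K_y g^{-1}$, the family of the
    $K_y$ is invariant under conjugation, hence uniformly confined.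

    The main dynamical fact is [confined_subgroups].  If the members of a family of
    subgroups that is invariant under conjugation all meet a finite set of non-trivial
    elements, then each member $L$ contains all elements of the alternating group that are
    trivial near a finite set $Q(L)$ of bounded cardinality.  Commutators of suitable
    conjugates of the given elements show that $L$ contains the alternating group of one
    of finitely many open sets ([confined_core], [confined_regions]).  The points without a
    neighbourhood $W$ such that the alternating group of $W$ lies in $L$ are then few,
    since too many of them could be moved into these open sets, and off these bad points
    every small 3-cycle can be conjugated by elements of $L$ into one of the known
    subgroups ([good_cycle]).  That elements with trivial germs at the bad points are
    products of 3-cycles supported away from them is a separate fact about the alternating
    group ([alt_trivial_germ]).

    The sets $Q(y) = Q(K_y)$ have at most $r$ points.  They are equivariant, and they depend
    continuously on $y$: finitely many elements of $K_y$ that preserve no set of at most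
    $r$ points meeting $W$ keep $Q(z)$ away from $W$ for $z$ near $y$
    ([upper_semicontinuity]), and an element that moves a point of $Q(y)$ moves $y$, hence
    also the $z$ near $y$ ([lower_semicontinuity]).  The same argument shows that $Z$ is
    open.  The germ of $\rho(a)$ at $y$, for $a$ in the alternating group, only depends on
    the germs of $a$ at $Q(y)$, and every element of the symmetric power with source $Q(y)$
    consists of the germs of some $a$ ([multisection_alternating]).  Sending these germs to
    the germ of $\rho(a)$ at $y$ defines $\widetilde\rho$ ([rhot]), which visibly preserves
    products and unions.  The quotient $\psi(g) = \widetilde\rho(g)^{-1} \rho(g)$ is trivial
    on the alternating group and centralises its image.  So it preserves the $K_y$ and the
    sets $Q(y)$, and therefore commutes with all of $\widetilde\rho(G)$ ([psi0_comm]); this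
    makes it a homomorphism.

    For the uniqueness of $\widetilde\rho$ and for the exclusion of the second alternative by
    the third, consider any continuous morphism on the symmetric power that extends $\rho$.
    Every bisection is a union of products of elements of the alternating group and of
    idempotents, so only the values on open subsets of $X^{[r]}$ matter.  A point $y$ lies in
    the image of a neighbourhood of a finite set $P$ only if $P = Q(y)$, because an element
    of the alternating group that distinguishes $P$ from $Q(y)$ would act on $y$ in two
    different ways ([pullE], [morphism_determined]).  On the other hand, of $r + 1$
    non-trivial elements with disjoint supports one is trivial near any given set of at most
    $r$ points, and this forces one of their images to have a trivial germ at any given
    point of $Z$ ([injective_germs_absurd]). *)

Set Implicit Arguments.
Unset Strict Implicit.
Unset Printing Implicit Defensive.

Local Open Scope classical_set_scope.
Local Open Scope group_scope.

(** * The group of bijections of a type *)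

Record bijection (T : Type) := Bijection {
  bfun :> T -> T;
  binv : T -> T;
  bfunK : cancel bfun binv;
  binvK : cancel binv bfun }.

HB.instance Definition _ (T : Type) := gen_eqMixin (bijection T).
HB.instance Definition _ (T : Type) := gen_choiceMixin (bijection T).

Section BijGroup.
Variable T : Type.
Implicit Types f g h : bijection T.

Lemma bijP f g : f =1 g -> f = g.
Proof.
case: f g => [f f' fK f'K] [g g' gK g'K] /= /funext fg.
have f'g' : f' = g' by apply/funext => x; rewrite -{1}(g'K x) -fg fK.
by subst; congr Bijection; exact: Prop_irrelevance.
Qed.

Definition bij1 : bijection T := @Bijection T id id (fun _ => erefl) (fun _ => erefl).
Definition bijV f : bijection T := Bijection (@binvK T f) (@bfunK T f).
Definition bijM f g : bijection T :=
  Bijection (can_comp (@bfunK T f) (@bfunK T g)) (can_comp (@binvK T g) (@binvK T f)).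

Lemma bijMA : associative bijM. Proof. by move=> f g h; exact: bijP. Qed.
Lemma bij1M : left_id bij1 bijM. Proof. by move=> f; exact: bijP. Qed.
Lemma bijM1 : right_id bij1 bijM. Proof. by move=> f; exact: bijP. Qed.
Lemma bijVM : left_inverse bij1 bijV bijM.
Proof. by move=> f; apply: bijP => x /=; rewrite bfunK. Qed.
Lemma bijMV : right_inverse bij1 bijV bijM.
Proof. by move=> f; apply: bijP => x /=; rewrite binvK. Qed.

HB.instance Definition _ := isGroup.Build (bijection T) bijMA bij1M bijM1 bijVM bijMV.

Lemma bME f g x : (f * g) x = f (g x). Proof. by []. Qed.
Lemma b1E x : (1 : bijection T) x = x. Proof. by []. Qed.
Lemma bK f x : f^-1 (f x) = x. Proof. exact: bfunK. Qed.
Lemma bVK f x : f (f^-1 x) = x. Proof. exact: binvK. Qed.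
Lemma b_inj f x y : f x = f y -> x = y.
Proof. by move=> /(congr1 (f^-1)%g); rewrite !bK. Qed.

End BijGroup.

(** * Three-cycles on three disjoint translates of a set *)

Section ThreeCycles.
Variable T : Type.
Implicit Types (V : set T) (f g h k : bijection T).

Definition disjoint_translates V g h : Prop := forall x y, V x -> V y ->
  [/\ x <> g y, x <> h y & g x <> h y].

Definition cycle_fun V g h (x : T) : T :=
  if `[< V x >] then g x
  else if `[< V (g^-1 x) >] then h (g^-1 x)
  else if `[< V (h^-1 x) >] then h^-1 x else x.

Lemma disjoint_translatesC V g h :
  disjoint_translates V g h -> disjoint_translates V h g.
Proof.
by move=> d x y Vx Vy; have [? ? _] := d x y Vx Vy; have [_ _ /nesym] := d y x Vy Vx.
Qed.

Variant cycle_spec V g h x : Prop :=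
| CycleBase of V x
| CycleFst y of V y & x = g y
| CycleSnd y of V y & x = h y
| CycleOut of ~ V x & ~ V (g^-1 x) & ~ V (h^-1 x).

Lemma cycleP V g h x : cycle_spec V g h x.
Proof.
have [Vx|Vx] := pselect (V x); first exact: CycleBase.
have [Vgx|Vgx] := pselect (V (g^-1 x)).
  by apply: (@CycleFst _ _ _ _ (g^-1 x)); rewrite ?bVK.
have [Vhx|Vhx] := pselect (V (h^-1 x)).
  by apply: (@CycleSnd _ _ _ _ (h^-1 x)); rewrite ?bVK.
exact: CycleOut.
Qed.

Section CycleFun.
Variables (V : set T) (g h : bijection T).
Hypothesis dis : disjoint_translates V g h.

Lemma cycle_funB x : V x -> cycle_fun V g h x = g x.
Proof. by move=> Vx; rewrite /cycle_fun asboolT. Qed.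

Lemma cycle_funF x : V x -> cycle_fun V g h (g x) = h x.
Proof.
move=> Vx; rewrite /cycle_fun bK asboolF ?(asboolT Vx) //.
by move=> Vgx; have [] := dis Vgx Vx.
Qed.

Lemma cycle_funS x : V x -> cycle_fun V g h (h x) = x.
Proof.
move=> Vx; rewrite /cycle_fun bK asboolF ?(asboolT Vx) ?asboolF //.
  by move=> Vghx; have [_ _] := dis Vghx Vx; rewrite bVK.
by move=> Vhx; have [_] := dis Vhx Vx.
Qed.

Lemma cycle_fun0 x : ~ V x -> ~ V (g^-1 x) -> ~ V (h^-1 x) ->
  cycle_fun V g h x = x.
Proof. by move=> *; rewrite /cycle_fun !asboolF. Qed.

End CycleFun.

Lemma cycle_funK V g h : disjoint_translates V g h ->
  cancel (cycle_fun V g h) (cycle_fun V h g).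
Proof.
move=> d x; have d' := disjoint_translatesC d.
case: (cycleP V g h x) => [Vx|y Vy ->|y Vy ->|n1 n2 n3].
- by rewrite (cycle_funB g h) // cycle_funS.
- by rewrite (@cycle_funF V g h) // cycle_funF.
- by rewrite (@cycle_funS V g h) // cycle_funB.
- by rewrite !cycle_fun0.
Qed.

(** The bijection that moves [V] to [g V] by [g], then [g V] to [h V] by
    [h g^-1], and [h V] back to [V] by [h^-1].  The identity is a dummy value for
    translates that are not disjoint. *)
Definition cycle3 V g h : bijection T :=
  match pselect (disjoint_translates V g h) with
  | left d => Bijection (cycle_funK d) (cycle_funK (disjoint_translatesC d))
  | right _ => 1
  end.

Section Cycle3.
Variables (V : set T) (g h : bijection T).
Hypothesis dis : disjoint_translates V g h.

Lemma cycle3E x : cycle3 V g h x = cycle_fun V g h x.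
Proof. by rewrite /cycle3; case: pselect. Qed.

Lemma cycle3B x : V x -> cycle3 V g h x = g x.
Proof. by rewrite cycle3E; exact: cycle_funB. Qed.

Lemma cycle3F x : V x -> cycle3 V g h (g x) = h x.
Proof. by rewrite cycle3E; exact: cycle_funF. Qed.

Lemma cycle3S x : V x -> cycle3 V g h (h x) = x.
Proof. by rewrite cycle3E; exact: cycle_funS. Qed.

Lemma cycle30 x : ~ V x -> ~ V (g^-1 x) -> ~ V (h^-1 x) -> cycle3 V g h x = x.
Proof. by rewrite cycle3E; exact: cycle_fun0. Qed.

Lemma cycle3V : (cycle3 V g h)^-1 = cycle3 V h g.
Proof.
have d := disjoint_translatesC dis.
apply: bijP => x; rewrite /cycle3; do 2 case: pselect => //.
Qed.

End Cycle3.

Lemma disjoint_translatesS U V g h : U `<=` V ->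
  disjoint_translates V g h -> disjoint_translates U g h.
Proof. by move=> UV d x y /UV Vx /UV; exact: d. Qed.

Definition translate g V : set T := [set x | V (g^-1 x)].

Lemma translateE g V x : translate g V (g x) = V x.
Proof. by rewrite /translate /mkset bK. Qed.

Lemma translateM g h V : translate (g * h) V = translate g (translate h V).
Proof. by []. Qed.

Lemma translate_image g V x : translate g V x -> exists2 y, V y & x = g y.
Proof. by exists (g^-1 x) => //; rewrite bVK. Qed.

Lemma disjoint_translates_rot V g h : disjoint_translates V g h ->
  disjoint_translates (translate g V) (h * g^-1) g^-1.
Proof.
move=> d _ _ /translate_image[x Vx ->] /translate_image[y Vy ->].
rewrite !bME !bK; have [? ? ?] := d x y Vx Vy; have [? ? ?] := d y x Vy Vx.
by split=> //; exact/nesym.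
Qed.

Lemma cycle3_rot V g h : disjoint_translates V g h ->
  cycle3 V g h = cycle3 (translate g V) (h * g^-1) g^-1.
Proof.
move=> d; have d' := disjoint_translates_rot d.
apply: bijP => x; case: (cycleP V g h x) => [Vx|y Vy ->|y Vy ->|n1 n2 n3].
- by rewrite cycle3B // -{2}(bK g x) cycle3S ?translateE.
- by rewrite cycle3F // cycle3B ?translateE // bME bK.
- rewrite cycle3S // (_ : h y = (h * g^-1) (g y)); last by rewrite bME bK.
  by rewrite cycle3F ?translateE // bK.
- rewrite !cycle30 //; last by rewrite /translate /mkset invgK bK.
  by rewrite /translate /mkset invgM invgK bME bK.
Qed.

Lemma disjoint_translatesJ V g h k : disjoint_translates V g h ->
  disjoint_translates (translate k V) (k * g * k^-1) (k * h * k^-1).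
Proof.
move=> d _ _ /translate_image[x Vx ->] /translate_image[y Vy ->].
rewrite !bME !bK; have [n1 n2 n3] := d x y Vx Vy.
by split=> e; [apply: n1|apply: n2|apply: n3]; exact: b_inj e.
Qed.

Lemma cycle3J V g h k : disjoint_translates V g h ->
  k * cycle3 V g h * k^-1 =
  cycle3 (translate k V) (k * g * k^-1) (k * h * k^-1).
Proof.
move=> d; have d' := @disjoint_translatesJ _ _ _ k d.
apply: bijP => z; rewrite -(bVK k z); move: (k^-1 z) => {z} x.
rewrite !bME bK; case: (cycleP V g h x) => [Vx|y Vy ->|y Vy ->|n1 n2 n3].
- by rewrite [RHS]cycle3B ?translateE // cycle3B // !bME bK.
- rewrite cycle3F // (_ : k (g y) = (k * g * k^-1) (k y)); last by rewrite !bME bK.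
  by rewrite cycle3F ?translateE // !bME bK.
- rewrite cycle3S // (_ : k (h y) = (k * h * k^-1) (k y)); last by rewrite !bME bK.
  by rewrite cycle3S ?translateE.
- rewrite !cycle30 ?translateE //.
  all: by rewrite /= bfunK.
Qed.

Lemma cycle3U V g h U : disjoint_translates V g h ->
  cycle3 V g h = cycle3 (V `&` U) g h * cycle3 (V `\` U) g h.
Proof.
move=> d; have d1 := @disjoint_translatesS _ _ _ _ (@subIsetl _ V U) d.
have d2 := @disjoint_translatesS _ _ _ _ (@subDsetl _ V U) d.
have nV x y : V x -> V y -> x <> g y /\ x <> h y by move=> Vx Vy; have [] := d x y Vx Vy.
have ngh x y : V x -> V y -> g x <> h y by move=> Vx Vy; have [] := d x y Vx Vy.
have nVg x : V x -> ~ V (g x) by move=> Vx Vgx; have [] := nV _ x Vgx Vx.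
have nVh x : V x -> ~ V (h x) by move=> Vx Vgx; have [] := nV _ x Vgx Vx.
have nVgV x : V x -> ~ V (g^-1 x) by move=> Vx /nVg; rewrite bVK.
have nVhV x : V x -> ~ V (h^-1 x) by move=> Vx /nVh; rewrite bVK.
have nVhg x : V x -> ~ V (h^-1 (g x)).
  by move=> Vx Vh; have := ngh _ _ Vx Vh; rewrite bVK.
have nVgh x : V x -> ~ V (g^-1 (h x)).
  by move=> Vx Vh; have := ngh _ _ Vh Vx; rewrite bVK.
apply: bijP => x; rewrite bME.
case: (cycleP V g h x) => [Vx|y Vy ->|y Vy ->|n1 n2 n3].
- rewrite cycle3B //; have [Ux|Ux] := pselect (U x).
    rewrite (@cycle30 (V `\` U)) ?cycle3B //.
    + by case.
    + by case=> + _; exact: nVgV.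
    + by case=> + _; exact: nVhV.
  rewrite (@cycle3B (V `\` U)) // cycle30 //.
  + by case=> + _; exact: nVg.
  + by rewrite bK; case.
  + by case=> + _; exact: nVhg.
- rewrite cycle3F //; have [Uy|Uy] := pselect (U y).
    rewrite (@cycle30 (V `\` U)) ?cycle3F //.
    + by case=> + _; exact: nVg.
    + by rewrite bK; case.
    + by case=> + _; exact: nVhg.
  rewrite (@cycle3F (V `\` U)) // cycle30 //.
  + by case=> + _; exact: nVh.
  + by case=> + _; exact: nVgh.
  + by rewrite bK; case.
- rewrite cycle3S //; have [Uy|Uy] := pselect (U y).
    rewrite (@cycle30 (V `\` U)) ?cycle3S //.
    + by case=> + _; exact: nVh.
    + by case=> + _; exact: nVgh.
    + by rewrite bK; case.
  rewrite (@cycle3S (V `\` U)) // cycle30 //.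
  + by case.
  + by case=> + _; exact: nVgV.
  + by case=> + _; exact: nVhV.
- have o W : W `<=` V -> disjoint_translates W g h -> cycle3 W g h x = x.
    by move=> WV dW; rewrite cycle30 // => /WV.
  by rewrite !o // => z [].
Qed.

Definition disjoint_translates3 V g h k : Prop :=
  [/\ disjoint_translates V g h, disjoint_translates V g k &
      disjoint_translates V h k].

(** On the points $x$, $u = g x$, $w = h x$, $z = k x$ this is the identity
    $(x\,u\,z) = (x\,u\,w)(u\,z\,w)$; the last factor fixes [V] pointwise. *)
Lemma cycle3_third V g h k : disjoint_translates3 V g h k ->
  cycle3 V g k = cycle3 V g h * cycle3 (translate g V) (k * g^-1) (h * g^-1).
Proof.
move=> [dgh dgk dhk].
have d : disjoint_translates (translate g V) (k * g^-1) (h * g^-1).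
  move=> _ _ /translate_image[x Vx ->] /translate_image[y Vy ->].
  rewrite !bME !bK; have [? ? ?] := dgh x y Vx Vy; have [? ? ?] := dgk x y Vx Vy.
  by have [? ? ?] := dhk y x Vy Vx; split=> //; exact/nesym.
have D g' h' y z : disjoint_translates V g' h' -> V y -> V z ->
   [/\ y <> g' z, y <> h' z & g' y <> h' z] by exact.
have e g' h' x y : V x -> V (g'^-1 (h' x)) -> V y -> g' (g'^-1 (h' x)) = h' x by rewrite bVK.
have nin g' h' x : (forall y, V y -> h' x <> g' y) -> ~ V (g'^-1 (h' x)).
  by move=> n /n; rewrite bVK.
apply: bijP => x; rewrite bME; have tg y : V y -> translate g V (g y) by rewrite translateE.
case: (cycleP V g k x) => [Vx|y Vy ->|y Vy ->|n1 n2 n3].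
- rewrite cycle3B // (@cycle30 (translate g V)) ?cycle3B // /translate /mkset ?invgM ?invgK ?bME ?bK.
  + by apply: (@nin g 1) => y Vy; have [] := dgk x y Vx Vy.
  + by apply: (@nin k 1) => y Vy; have [] := dgk x y Vx Vy.
  + by apply: (@nin h 1) => y Vy; have [] := dgh x y Vx Vy.
- rewrite cycle3F // (@cycle3B (translate g V)) ?translateE // bME bK.
  rewrite cycle30 //.
  + by move=> Vky; have [] := dgk _ _ Vky Vy.
  + by apply: nin => z Vz /esym; have [] := dgk _ _ Vz Vy.
  + by apply: nin => z Vz /esym; have [] := dhk _ _ Vz Vy.
- rewrite cycle3S //.
  have -> : k y = (k * g^-1) (g y) by rewrite bME bK.
  rewrite (@cycle3F (translate g V)) ?translateE // bME bK.
  by rewrite cycle3S.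
- have [[y Vy ->]|n4] := pselect (exists2 y, V y & x = h y).
    rewrite cycle30 //; last 3 first.
    + by move=> Vhy; have [] := dgh _ _ Vhy Vy.
    + by apply: nin => z Vz /esym; have [] := dgh _ _ Vz Vy.
    + by apply: nin => z Vz; have [] := dhk _ _ Vy Vz.
    rewrite [in RHS](_ : h y = (h * g^-1) (g y)); last by rewrite bME bK.
    by rewrite (@cycle3S (translate g V)) ?translateE // cycle3F.
  have n5 : ~ V (h^-1 x) by move=> Vh; apply: n4; exists (h^-1 x); rewrite ?bVK.
  rewrite cycle30 // (@cycle30 (translate g V)) ?cycle30 //.
  + by rewrite /translate /mkset invgM invgK bME bK.
  + by rewrite /translate /mkset invgM invgK bME bK.
Qed.

(** On the points $x$, $u = g x$, $u' = h x$, $w = k x$ this is the identity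
    $(u\,u'\,w)(x\,u\,w) = (x\,u'\,w)$: it composes the germs at $x$ and at $u$. *)
Lemma cycle3_triangle V g h k : disjoint_translates3 V g h k ->
  cycle3 (translate g V) (h * g^-1) (k * g^-1) * cycle3 V g k = cycle3 V h k.
Proof.
move=> [dgh dgk dhk].
have d : disjoint_translates (translate g V) (h * g^-1) (k * g^-1).
  move=> _ _ /translate_image[x Vx ->] /translate_image[y Vy ->].
  rewrite !bME !bK; have [? ? ?] := dgh x y Vx Vy; have [? ? ?] := dgk x y Vx Vy.
  by have [? ? ?] := dhk x y Vx Vy; split.
have nin g' h' x : (forall y, V y -> h' x <> g' y) -> ~ V (g'^-1 (h' x)).
  by move=> n /n; rewrite bVK.
have tg y : V y -> translate g V (g y) by rewrite translateE.
apply: bijP => x; rewrite bME.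
case: (cycleP V h k x) => [Vx|y Vy ->|y Vy ->|n1 n2 n3].
- by rewrite !cycle3B ?translateE // bME bK.
- rewrite [RHS]cycle3F // (@cycle30 V g k) //; last 3 first.
  + by move=> Vhy; have [] := dgh _ _ Vhy Vy.
  + by apply: nin => z Vz /esym; have [] := dgh _ _ Vz Vy.
  + by apply: nin => z Vz; have [] := dhk _ _ Vy Vz.
  have -> : h y = (h * g^-1) (g y) by rewrite bME bK.
  by rewrite (@cycle3F (translate g V)) ?translateE // bME bK.
- rewrite !cycle3S // (@cycle30 (translate g V)) // /translate /mkset ?invgM ?invgK ?bME ?bK.
  + by apply: (@nin g 1) => z Vz; have [] := dgk y z Vy Vz.
  + by apply: (@nin h 1) => z Vz; have [] := dhk y z Vy Vz.
  + by apply: (@nin k 1) => z Vz; have [] := dgk y z Vy Vz.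
- rewrite (@cycle30 V h k) //.
  have [[y Vy ->]|n4] := pselect (exists2 y, V y & x = g y).
    rewrite cycle3F // -[k y](_ : (k * g^-1) (g y) = _); last by rewrite bME bK.
    by rewrite cycle3S ?translateE.
  have n5 : ~ V (g^-1 x) by move=> Vh; apply: n4; exists (g^-1 x); rewrite ?bVK.
  rewrite (@cycle30 V g k) // cycle30 //.
  + by rewrite /translate /mkset invgM invgK bME bK.
  + by rewrite /translate /mkset invgM invgK bME bK.
Qed.

(** Where only one of [u] and [v] acts, they commute; what remains is the interaction on
    [V], whose points travel to [g V], then to [h V] and back. *)
Lemma cycle3_commutator V g h (u v : bijection T) (Cu Cv : set T) :
    disjoint_translates V g h ->
    (forall x, ~ Cu x -> u x = x) -> (forall x, ~ Cv x -> v x = x) ->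
    Cu `&` Cv `<=` V ->
    (forall x, V x -> u x = g x) -> (forall x, V x -> v x = h x) ->
  u * v * u^-1 * v^-1 = cycle3 V g h.
Proof.
move=> d u0 v0 CV ug vh.
have uV x : ~ Cu x -> u^-1 x = x by move=> /u0 {1}<-; rewrite bK.
have vV x : ~ Cv x -> v^-1 x = x by move=> /v0 {1}<-; rewrite bK.
have Cu' x : u x <> x -> Cu x by move=> ux; apply: contrapT => /u0.
have Cv' x : v x <> x -> Cv x by move=> vx; apply: contrapT => /v0.
have CuV x : Cu x -> Cu (u^-1 x).
  move=> Cx; have [uxx|uxx] := pselect (u (u^-1 x) = u^-1 x).
    by rewrite -uxx bVK.
  exact: Cu'.
have CvV x : Cv x -> Cv (v^-1 x).
  move=> Cx; have [vxx|vxx] := pselect (v (v^-1 x) = v^-1 x).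
    by rewrite -vxx bVK.
  exact: Cv'.
have VCu x : V x -> Cu x.
  by move=> Vx; apply: Cu'; rewrite ug // => /esym; have [] := d x x Vx Vx.
have VCv x : V x -> Cv x.
  by move=> Vx; apply: Cv'; rewrite vh // => /esym; have [] := d x x Vx Vx.
have gVCu x : V x -> Cu (g x).
  move=> Vx; apply: Cu'; rewrite -ug // => /(@b_inj _ _ _ _); rewrite ug // => /esym.
  by have [] := d x x Vx Vx.
have hVCv x : V x -> Cv (h x).
  move=> Vx; apply: Cv'; rewrite -vh // => /(@b_inj _ _ _ _); rewrite vh // => /esym.
  by have [] := d x x Vx Vx.
have ngV x : V x -> ~ V (g x) by move=> Vx Vg; have [] := d _ _ Vg Vx.
have nhV x : V x -> ~ V (h x) by move=> Vx Vg; have [] := d _ _ Vg Vx.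
have nCv x : Cu x -> ~ V x -> ~ Cv x by move=> Cx Vx Cvx; apply: Vx; apply: CV.
have nCu x : Cv x -> ~ V x -> ~ Cu x by move=> Cx Vx Cvx; apply: Vx; apply: CV.
have u'g x : V x -> u^-1 (g x) = x by move=> Vx; rewrite -ug // bK.
have v'h x : V x -> v^-1 (h x) = x by move=> Vx; rewrite -vh // bK.
apply: bijP => x; rewrite !bME.
case: (cycleP V g h x) => [Vx|y Vy ->|y Vy ->|n1 n2 n3].
- rewrite cycle3B // uV ?bVK ?ug //.
  apply: nCu; first exact/CvV/VCv.
  by move=> Vv; have [_] := d _ _ Vx Vv; rewrite -vh ?bVK.
- rewrite cycle3F // vV ?u'g ?vh ?u0 //; last exact/nCv/ngV/Vy/gVCu.
  by apply: nCu; [exact: hVCv|exact: nhV].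
- rewrite cycle3S // v'h // v0 ?bVK //.
  apply: nCv; first exact/CuV/VCu.
  by move=> Vv; have [] := d _ _ Vy Vv; rewrite -ug ?bVK.
- rewrite cycle30 //.
  have nv : ~ V (v^-1 x) by move=> Vv; apply: n3; rewrite -{1}(bVK v x) vh // bK.
  have nu : ~ V (u^-1 x) by move=> Vv; apply: n2; rewrite -{1}(bVK u x) ug // bK.
  have [Cx|Cx] := pselect (Cv x).
    by rewrite uV ?bVK ?u0 //; [exact: nCu|apply: nCu => //; exact: CvV].
  rewrite (vV x) // v0 ?bVK // => Cvu.
  have [Cux|Cux] := pselect (Cu x); last by rewrite uV in Cvu.
  by apply: nu; apply: CV; split=> //; exact: CuV.
Qed.

End ThreeCycles.

(** * Full groups of homeomorphisms of a Cantor set *)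

(** Otherwise the complements in [C] of the sets with the property would generate a
    filter without cluster points. *)
Lemma compact_union_induction (T : topologicalType) (C : set T)
    (P : set T -> Prop) :
  compact C -> P set0 -> (forall A B, A `<=` B -> P B -> P A) ->
  (forall A B, P A -> P B -> P (A `|` B)) ->
  (forall x, C x -> exists2 U, nbhs x U & P U) -> P C.
Proof.
move=> Ccpt P0 PS PU Ploc; apply: contrapT => nPC.
pose F := filter_from P (fun D => C `\` D).
have FF : Filter F.
  apply: filter_from_filter; first by exists set0.
  move=> A B PA PB; exists (A `|` B); first exact: PU.
  by rewrite setDUr.
have PF : ProperFilter F.
  apply: filter_from_proper => D PD; apply: contrapT => /set0P/negP/negPn/eqP CD.
  by apply: nPC; apply: PS PD; rewrite -setD_eq0.
have [|x [Cx clx]] := Ccpt F PF; first by exists set0 => // x [].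
have [U xU PU'] := Ploc x Cx.
by have [|y [[_ nUy] Uy]] := clx (C `\` U) U _ xU; first by exists U.
Qed.

Section ChooseFamily.
Variables (J : finType) (S : eqType) (T : Type).
Variables (R : J -> T -> Prop) (pts : J -> T -> seq S).

(** The objects are chosen one after the other, each away from the points of the
    previous ones. *)
Lemma choose_disjoint_family :
  (forall j (s : seq S), exists2 v, R j v & forall x, x \in pts j v -> x \notin s) ->
  forall s0 : seq S, exists v : J -> T,
    [/\ forall j, R j (v j), forall j x, x \in pts j (v j) -> x \notin s0 &
      forall i j x, x \in pts i (v i) -> x \in pts j (v j) -> i = j].
Proof.
move=> ex s0.
have ex0 j : exists v, R j v /\ forall x, x \in pts j v -> x \notin s0.
  by have [v] := ex j s0; exists v.
have [v0 v0P] := choice ex0.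
suff /(_ (enum J)) [v [v1 v2 v3]] : forall js : seq J, exists v : J -> T,
    [/\ forall j, R j (v j), forall j x, x \in pts j (v j) -> x \notin s0 &
    forall i j x, i \in js -> j \in js ->
      x \in pts i (v i) -> x \in pts j (v j) -> i = j].
  by exists v; split=> // i j x; apply: v3; rewrite mem_enum.
elim=> [|k js [v [v1 v2 v3]]].
  by exists v0; split=> // [j|j]; have [] := v0P j.
have [w w1 w2] := ex k (s0 ++ flatten [seq pts j (v j) | j <- js]).
have w2' j x : j \in js -> x \in pts j (v j) -> x \in pts k w -> False.
  move=> js_j xj /w2; rewrite mem_cat negb_or => /andP[_ /negP]; apply.
  by apply/flattenP; exists (pts j (v j)) => //; exact/map_f.
have w3 x : x \in pts k w -> x \notin s0.
  by move=> /w2; rewrite mem_cat negb_or => /andP[].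
exists (fun j => if j == k then w else v j); split=> [j|j x|i j x].
- by case: eqP => [->|].
- by case: eqP => [->|_]; [exact: w3|exact: v2].
- rewrite !inE; case: (eqVneq i k) => [->|ik] /=; case: (eqVneq j k) => [->|jk] //=.
  + by move=> _ js_j xk xj; case: (w2' j x).
  + by move=> js_i _ xi xk; case: (w2' i x).
  + exact: v3.
Qed.

End ChooseFamily.

Definition is_subgroup (T : Type) (L : set (bijection T)) : Prop :=
  [/\ L 1, forall f g, L f -> L g -> L (f * g) & forall f, L f -> L f^-1].

Section Subgroups.
Variables (T : Type) (L : set (bijection T)).
Hypothesis sL : is_subgroup L.

Lemma sub1 : L 1. Proof. by case: sL. Qed.
Lemma subM f g : L f -> L g -> L (f * g). Proof. by case: sL => _ + _; exact. Qed.
Lemma subV f : L f -> L f^-1. Proof. by case: sL => _ _; exact. Qed.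
Lemma subX f n : L f -> L (f ^+ n).
Proof.
move=> Lf; elim: n => [|n IH]; first by rewrite expg0; exact: sub1.
by rewrite expgS; exact: subM.
Qed.
Lemma subMl f g : L f -> L (f * g) -> L g.
Proof. by move=> Lf Lfg; rewrite -(mulKg f g); apply: subM => //; exact: subV. Qed.
Lemma subMr f g : L g -> L (f * g) -> L f.
Proof. by move=> Lf Lfg; rewrite -(mulgK g f); apply: subM => //; exact: subV. Qed.
End Subgroups.

(** The properties of the full group of a minimal effective groupoid, acting on the
    unit space, on which the dynamical part of the proof rests. *)
Record full_dynamics (X : topologicalType) (F : set (bijection X)) : Prop := {
  full_subgroup : is_subgroup F;
  full_continuous : forall g, F g -> continuous g;
  full_glue : forall f : bijection X,
    (forall x : X, exists2 g, F g & \forall z \near x, f z = g z) -> F f;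
  full_minimal : forall x (U : set X), open U -> U !=set0 ->
    exists2 g, F g & U (g x) }.

(** The topological properties of the Cantor set in the form in which they are used:
    compactness and a basis of clopen sets reduce questions to small clopen sets, and
    every open set offers new points. *)
Record cantor_basics (X : topologicalType) : Prop := {
  cantor_compact : compact [set: X];
  cantor_hausdorff : hausdorff_space X;
  cantor_basis : forall (x : X) U, nbhs x U ->
    exists D, [/\ clopen D, D x & D `<=` U];
  cantor_no_isolated : forall x : X, ~ open [set x] }.

Lemma cantor_like_basics (X : topologicalType) : cantor_like X -> cantor_basics X.
Proof.
case=> pX cX hX zX; split=> // [x U xU|]; last exact/perfectTP.
have [D [Dx cD] DU] := zero_dimensional_cvg (x := x) hX zX cX xU.
by exists D.
Qed.

Section Dynamics.
Variables (X : topologicalType) (F : set (bijection X)).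
Hypotheses (hX : cantor_basics X) (hF : full_dynamics F).
Implicit Types (x y z p q : X) (f g h k t a b : bijection X) (U V W O D : set X).
Let sF := full_subgroup hF.

Lemma finite_closed : forall A : set X, finite_set A -> closed A.
Proof.
apply/accessible_finite_set_closed.
exact: hausdorff_accessible (cantor_hausdorff hX).
Qed.

Lemma open_minus_finite O (s : seq X) : open O -> O !=set0 ->
  exists2 x, O x & x \notin s.
Proof.
move=> oO O0; apply: contrapT => n.
have Os : O `<=` [set` s] by move=> x Ox; apply: contrapT => /negP xs; apply: n; exists x.
have fO : finite_set O by exact: sub_finite_set Os (finite_seq s).
have [x Ox] := O0.
apply: (@cantor_no_isolated _ hX x).
have -> : [set x] = O `&` ~` (O `\ x).
  apply/seteqP; split=> [z ->|z [Oz nz]]; first by split=> // -[_ /(_ erefl)].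
  by apply: contrapT => zx; apply: nz; split.
apply: openI => //; apply: closed_openC; apply: finite_closed.
by apply: sub_finite_set fO => z [].
Qed.

(** Orbits are dense and open sets are infinite, so that every orbit offers points of
    an open set outside of any finite set.  All general position arguments rest on
    this. *)
Lemma fresh_translate x O (s : seq X) : open O -> O !=set0 ->
  exists g, [/\ F g, O (g x) & g x \notin s].
Proof.
move=> oO O0; pose O' := O `\` [set` s].
have oO' : open O'.
  by apply: openI => //; apply: closed_openC; apply: finite_closed; exact: finite_seq.
have [y Oy ys] := @open_minus_finite O s oO O0.
have [|g Fg [Og gs]] := full_minimal hF x oO'.
  by exists y; split=> //; exact/negP.
by exists g; split=> //; exact/negP.
Qed.

Lemma full_nbhs g x U : F g -> nbhs (g x) U -> nbhs x [set z | U (g z)].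
Proof. by move=> Fg; exact: (full_continuous hF Fg). Qed.

Lemma clopen_translate g U : F g -> clopen U -> clopen (translate g U).
Proof.
move=> Fg cU; apply: (@preimage_clopen X X (g^-1)%g) => //.
exact: (full_continuous hF (subV sF Fg)).
Qed.

Lemma compact_clopen V : clopen V -> compact V.
Proof.
move=> [_ cV]; rewrite -[V]setTI; apply: compact_closedI => //; exact: cantor_compact.
Qed.

Lemma near_apart f g x : F f -> F g -> f x <> g x ->
  exists2 U, nbhs x U & forall y z, U y -> U z -> f y <> g z.
Proof.
move=> Ff Fg /eqP fg; have := cantor_hausdorff hX; rewrite open_hausdorff.
move=> /(_ _ _ fg)[[A B] /= [/set_mem Af /set_mem Bg] [oA oB AB0]].
exists ([set y | A (f y)] `&` [set z | B (g z)]).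
  by apply: filterI; apply: full_nbhs => //; exact: open_nbhs_nbhs.
move=> y z [Ay _] [_ Bz] e; suff : (A `&` B) (f y) by rewrite (eqP AB0).
by split=> //; rewrite e.
Qed.

Lemma translates_nbhd (J : finType) x (g : J -> bijection X) (O : J -> set X) :
  (forall j, F (g j)) -> (forall j, nbhs (g j x) (O j)) ->
  (forall i j, g i x = g j x -> i = j) ->
  exists V, [/\ clopen V, V x, forall j y, V y -> O j (g j y) &
    forall i j y z, V y -> V z -> g i y = g j z -> i = j].
Proof.
move=> Fg gO gI.
have n1 : \forall z \near x, forall j, O j (g j z).
  by apply: filter_forall => j; apply: full_nbhs.
have /choice[U UP] : forall ij : J * J, exists U, nbhs x U /\
    forall y z, U y -> U z -> g ij.1 y = g ij.2 z -> ij.1 = ij.2.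
  move=> [i j] /=; have [ij|/eqP ij] := eqVneq i j.
    by exists setT; split=> //; exact: filterT.
  have [|U xU UP] := @near_apart (g i) (g j) x (Fg i) (Fg j).
    by move=> /gI.
  by exists U; split=> // y z Uy Uz /(UP _ _ Uy Uz).
have n2 : \forall z \near x, forall ij, U ij z.
  by apply: filter_forall => ij; have [] := UP ij.
have [V [cV Vx VP]] := cantor_basis hX (filterI n1 n2).
exists V; split=> // [j y /VP[] //|i j y z /VP[_ Uy] /VP[_ Uz]].
by have [_] := UP (i, j); apply.
Qed.

Lemma separate_points (J : finType) (p : J -> X) (O : J -> set X) :
  (forall j, nbhs (p j) (O j)) -> (forall i j, p i = p j -> i = j) ->
  exists D : J -> set X, [/\ forall j, clopen (D j), forall j, D j (p j),
    forall j, D j `<=` O j & forall i j x, D i x -> D j x -> i = j].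
Proof.
move=> pO pI.
have /choice[E EP] : forall j, exists E, [/\ clopen E, E (p j), E `<=` O j &
    forall i, E (p i) -> i = j].
  move=> j; have : \forall z \near p j, forall i, z = p i -> i = j.
    apply: filter_forall => i; have [->|/eqP ij] := eqVneq i j.
      by apply: filterE.
    have : open (~` [set p i]).
      by apply: closed_openC; apply: finite_closed; exact: finite_set1.
    move=> oC; have : nbhs (p j) (~` [set p i]).
      by apply: open_nbhs_nbhs; split=> // /= /esym/pI.
    by apply: filterS => z nz /nz.
  move=> /(filterI (pO j)) /(cantor_basis hX)[E [cE Ej EO]].
  by exists E; split=> // [x /EO[]//|i /EO[_]]; exact.
(* [E i] contains no [p j] for [j != i], so removing it from [E j] keeps [p j]. *)
pose D j := E j `\` \big[setU/set0]_(i | i != j) E i.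
have DP j x : D j x <-> E j x /\ forall i, E i x -> i = j.
  rewrite /D; split=> [[Ex n]|[Ex n]]; split=> //.
    move=> i Ei; apply: contrapT => /eqP ij; apply: n.
    by rewrite (bigD1 i) //=; left.
  elim/big_ind: _ => [//|A B nA nB []//|i ij /n e].
  by rewrite e eqxx in ij.
exists D; split=> [j|j|j x [Ex _]|i j x].
- apply: clopenI; first by have [] := EP j.
  suff [oB cB] : clopen (\big[setU/set0]_(i | i != j) E i).
    by split; [exact: closed_openC|exact: open_closedC].
  apply: (big_ind (@clopen X)); first exact: clopen0.
    by move=> ? ?; exact: clopenU.
  by move=> i _; have [] := EP i.
- apply/DP; split=> [|i]; first by have [] := EP j.
  by have [_ _ _ /[apply]] := EP i.
- by have [_ _ EO _] := EP j; exact: EO.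
- by move=> /DP[Ei _] /DP[_]; apply.
Qed.

End Dynamics.

(** * Alternating groups *)

Section Alternating.
Variables (X : topologicalType) (F : set (bijection X)).
Hypotheses (hX : cantor_basics X) (hF : full_dynamics F).
Implicit Types (x y z p q : X) (f g h k t a b : bijection X) (U V W O D : set X).
Let sF := full_subgroup hF.

(** The data of a 3-cycle with support in [W]. *)
Definition cycle_in W V g h : Prop :=
  [/\ clopen V, F g, F h, disjoint_translates V g h &
    forall x, V x -> [/\ W x, W (g x) & W (h x)]].

(** The group generated by the 3-cycles with support in [W].  Words suffice, because
    the inverse of a 3-cycle is a 3-cycle. *)
Inductive alt W : bijection X -> Prop :=
| alt1 : alt W 1
| altMl V g h a : cycle_in W V g h -> alt W a -> alt W (cycle3 V g h * a).

Lemma cycle_inS W W' V g h : W `<=` W' -> cycle_in W V g h -> cycle_in W' V g h.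
Proof. by move=> WW' [? ? ? ? VW]; split=> // x /VW[/WW' ? /WW' ? /WW' ?]. Qed.

Lemma cycle_in_base W U V g h : clopen U -> U `<=` V ->
  cycle_in W V g h -> cycle_in W U g h.
Proof.
move=> cU UV [? ? ? d VW]; split=> //; first exact: disjoint_translatesS d.
by move=> x /UV/VW.
Qed.

Lemma cycle_in_inv W V g h : cycle_in W V g h -> cycle_in W V h g.
Proof.
move=> [? ? ? d VW]; split=> //; first exact: disjoint_translatesC.
by move=> x /VW[].
Qed.

Lemma cycle_in_rot W V g h : cycle_in W V g h ->
  cycle_in W (translate g V) (h * g^-1) g^-1.
Proof.
move=> [cV Fg Fh d VW]; split.
- exact: (clopen_translate hF).
- by apply: (subM sF) => //; exact: (subV sF).
- exact: (subV sF).
- exact: disjoint_translates_rot.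
- by move=> z Tz; have [x Vx ->] := translate_image Tz; have [? ? ?] := VW x Vx; rewrite bME bK.
Qed.

Lemma cycle_fix W V g h x : cycle_in W V g h -> ~ W x -> cycle3 V g h x = x.
Proof.
move=> [_ _ _ d VW] Wx; apply: cycle30 => // /VW[]//; rewrite ?bVK //.
Qed.

Lemma cycle_near_fix V g h y : clopen V -> F g -> F h ->
  disjoint_translates V g h ->
  ~ V y -> ~ V (g^-1 y) -> ~ V (h^-1 y) ->
  \forall z \near y, cycle3 V g h z = z.
Proof.
move=> cV Fg Fh d n1 n2 n3.
have nC W : clopen W -> ~ W y -> nbhs y (~` W).
  by move=> [_ cW] Wy; apply: open_nbhs_nbhs; split=> //; exact: closed_openC.
have N1 := nC _ cV n1.
have N2 := nC _ (clopen_translate hF Fg cV) n2.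
have N3 := nC _ (clopen_translate hF Fh cV) n3.
apply: filterS (filterI N1 (filterI N2 N3)) => z [m1 [m2 m3]].
exact: cycle30.
Qed.

(** A 3-cycle agrees near each point with one of [g], [h g^-1], [h^-1] and 1, so it
    belongs to the full group. *)
Lemma cycle_full W V g h : cycle_in W V g h -> F (cycle3 V g h).
Proof.
move=> [cV Fg Fh d _]; apply: (full_glue hF) => x.
have nV W' : clopen W' -> forall y, W' y -> nbhs y W'.
  by move=> [oW _] y Wy; exact: open_nbhs_nbhs.
case: (cycleP V g h x) => [Vx|y Vy ->|y Vy ->|n1 n2 n3].
- by exists g => //; apply: filterS (nV _ cV _ Vx) => z Vz; exact: cycle3B.
- exists (h * g^-1); first by apply: (subM sF) => //; exact: (subV sF).
  have Ty : translate g V (g y) by rewrite translateE.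
  apply: filterS (nV _ (clopen_translate hF Fg cV) _ Ty) => w Tw.
  by have [z Vz ->] := translate_image Tw; rewrite cycle3F // bME bK.
- exists h^-1; first exact: (subV sF).
  have Ty : translate h V (h y) by rewrite translateE.
  apply: filterS (nV _ (clopen_translate hF Fh cV) _ Ty) => w Tw.
  by have [z Vz ->] := translate_image Tw; rewrite cycle3S // bK.
- by exists 1; [exact: (sub1 sF)|exact: cycle_near_fix].
Qed.

Lemma alt_cycle W V g h : cycle_in W V g h -> alt W (cycle3 V g h).
Proof. by move=> c; rewrite -[cycle3 _ _ _]mulg1; apply: altMl => //; exact: alt1. Qed.

Lemma alt_mul W a b : alt W a -> alt W b -> alt W (a * b).
Proof.
move=> + Ab; elim=> [|V g h c Vc _ IH]; first by rewrite mul1g.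
by rewrite -mulgA; exact: altMl.
Qed.

Lemma alt_subgroup W : is_subgroup (alt W).
Proof.
split; [exact: alt1|exact: alt_mul|move=> a].
elim=> [|V g h b Vc _ IH]; first by rewrite invg1; exact: alt1.
rewrite invgM; apply: alt_mul => //; have [_ _ _ d _] := Vc.
rewrite cycle3V //; apply: alt_cycle; exact: cycle_in_inv.
Qed.
Hint Resolve alt_subgroup : core.

Lemma alt_sub W (L : set (bijection X)) : is_subgroup L ->
  (forall V g h, cycle_in W V g h -> L (cycle3 V g h)) -> alt W `<=` L.
Proof.
move=> sL Lc a; elim=> [|V g h b Vc _ Lb]; first exact: (sub1 sL).
by apply: (subM sL) => //; exact: Lc.
Qed.

Lemma alt_full W : alt W `<=` F.
Proof. by apply: alt_sub => // V g h; exact: cycle_full. Qed.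

Lemma altS W W' : W `<=` W' -> alt W `<=` alt W'.
Proof. by move=> WW'; apply: alt_sub => // V g h /(cycle_inS WW'); exact: alt_cycle. Qed.

Lemma alt_fix W a x : alt W a -> ~ W x -> a x = x.
Proof.
move=> + Wx; elim=> [//|V g h b Vc _ IH].
by rewrite bME IH (cycle_fix Vc).
Qed.

Lemma alt_stable W a x : alt W a -> W x -> W (a x).
Proof.
move=> Wa Wx; apply: contrapT => nW.
have := alt_fix (subV (alt_subgroup W) Wa) nW.
by rewrite bK => e; apply: nW; rewrite -e.
Qed.

Lemma cycle_inJ W V g h k : F k -> cycle_in W V g h ->
  cycle_in (translate k W) (translate k V) (k * g * k^-1) (k * h * k^-1).
Proof.
move=> Fk [cV Fg Fh d VW]; have FkV := subV sF Fk.
split; first exact: (clopen_translate hF).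
- by do !apply: (subM sF).
- by do !apply: (subM sF).
- exact: disjoint_translatesJ.
- by move=> z Tz; have [x Vx ->] := translate_image Tz; have [? ? ?] := VW x Vx; rewrite !bME bK !translateE.
Qed.

Lemma altJ W k a : F k -> alt W a -> alt (translate k W) (k * a * k^-1).
Proof.
move=> Fk; elim=> [|V g h b Vc _ IH]; first by rewrite mulg1 mulgV; exact: alt1.
have -> : k * (cycle3 V g h * b) * k^-1 =
  (k * cycle3 V g h * k^-1) * (k * b * k^-1) by rewrite !mulgA mulgVK.
apply: alt_mul => //; have [_ _ _ d _] := Vc.
by rewrite cycle3J //; apply: alt_cycle; exact: cycle_inJ.
Qed.

Lemma altJ_sub W W' k a : F k -> (forall x, W x -> W' (k x)) -> alt W a ->
  alt W' (k * a * k^-1).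
Proof.
move=> Fk WW' /(altJ Fk); apply: altS => x Tx; have [y Wy ->] := translate_image Tx.
exact: WW'.
Qed.

(** A 3-cycle is a product of its restrictions to the pieces of any clopen
    partition of its base, so that compactness allows to consider only 3-cycles
    with a small base. *)
Lemma cycle_local W V g h (L : set (bijection X)) : is_subgroup L ->
  cycle_in W V g h ->
  (forall x, V x -> exists2 O, nbhs x O & forall U, clopen U ->
     U `<=` V `&` O -> L (cycle3 U g h)) ->
  L (cycle3 V g h).
Proof.
move=> sL [cV Fg Fh d _] loc.
suff: exists O, [/\ clopen O, V `<=` O &
    forall U, clopen U -> U `<=` V `&` O -> L (cycle3 U g h)].
  move=> [ O [_ VO LO]].
  by apply: LO => // x Vx; split=> //; exact: VO.
apply: (@compact_union_induction _ V (fun A => exists O, [/\ clopen O, A `<=` O &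
    forall U, clopen U -> U `<=` V `&` O -> L (cycle3 U g h)])).
- exact: compact_clopen.
- exists set0; split=> // [|U _ U0]; first exact: clopen0.
  have -> : cycle3 U g h = 1; last exact: (sub1 sL).
  have e x : ~ U x by move=> /U0[].
  by apply: bijP => x; rewrite cycle30 // => y z /e.
- by move=> A B AB [ O [cO BO PO]]; exists O; split=> // x /AB/BO.
- move=> A B [ O [cO AO PO]] [ O' [cO' BO' PO']]; exists (O `|` O').
  split=> [||U cU UO]; first exact: clopenU.
    by move=> x [/AO|/BO'] Ox; [left|right].
  rewrite (@cycle3U _ U g h O); last by apply: disjoint_translatesS d => x /UO[].
  apply: (subM sL); [apply: PO|apply: PO'].
  + exact: clopenI.
  + by move=> x [/UO[]].
  + have [[oO kO] [oU kU]] := (cO, cU).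
    by split; [apply: openI => //; exact: closed_openC|
      apply: closedI => //; exact: open_closedC].
  + by move=> x [/UO[Vx []]].
- move=> x /loc[ O xO PO]; have [D [cD Dx DO]] := cantor_basis hX xO.
  exists D; first by apply: open_nbhs_nbhs; split=> //; case: cD.
  by exists D; split=> // U cU UD; apply: PO => // y /UD[Vy /DO].
Qed.

Lemma disjoint_translates_at x g h : F g -> F h ->
  x <> g x -> x <> h x -> g x <> h x ->
  exists2 U, nbhs x U & disjoint_translates U g h.
Proof.
move=> Fg Fh xg xh gh.
have [U1 N1 P1] := near_apart hX hF (sub1 sF) Fg xg.
have [U2 N2 P2] := near_apart hX hF (sub1 sF) Fh xh.
have [U3 N3 P3] := near_apart hX hF Fg Fh gh.
exists (U1 `&` (U2 `&` U3)); first by do !apply: filterI.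
by move=> y z [y1 [y2 y3]] [z1 [z2 z3]]; split; [exact: P1|exact: P2|exact: P3].
Qed.

(** A small neighbourhood of [x] has disjoint translates, because the three points are
    distinct, and it can avoid the preimages of the points of [s]. *)
Lemma small_cycle W x g h (s : seq X) O : open W -> F g -> F h ->
  W x -> W (g x) -> W (h x) -> x <> g x -> x <> h x -> g x <> h x ->
  nbhs x O -> (forall y, y \in s -> [/\ y <> x, y <> g x & y <> h x]) ->
  exists V, [/\ cycle_in W V g h, V x, V `<=` O &
    forall y, y \in s -> \forall z \near y, cycle3 V g h z = z].
Proof.
move=> oW Fg Fh Wx Wgx Whx xg xh gh xO sx.
have [U xU dU] := disjoint_translates_at Fg Fh xg xh gh.
have nW y : W y -> nbhs y W by move=> Wy; exact: open_nbhs_nbhs.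
pose E := ~` [set` s ++ map (g^-1)%g s ++ map (h^-1)%g s].
have xE : nbhs x E.
  apply: open_nbhs_nbhs; split.
    by apply: closed_openC; apply: (finite_closed hX); exact: finite_seq.
  rewrite /E /= !mem_cat => /orP[/sx[]//|/orP[]] /mapP[y /sx[_ y1 y2]] e.
    by apply: y1; rewrite e bVK.
  by apply: y2; rewrite e bVK.
have [V [cV Vx VP]] := cantor_basis hX (filterI xO (filterI xU (filterI xE
   (filterI (nW x Wx) (filterI (full_nbhs hF Fg (nW _ Wgx))
      (full_nbhs hF Fh (nW _ Whx))))))).
have dV : disjoint_translates V g h.
  by apply: disjoint_translatesS dU => y /VP[_ []].
exists V; split=> // [|y /VP[]//|y ys].
  by split=> // y /VP[_ [_ [_ [? []]]]].
have nE z : z \in s ++ map (g^-1)%g s ++ map (h^-1)%g s -> ~ V z.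
  by move=> zs /VP[_ [_ [/(_ zs)]]].
apply: cycle_near_fix => //; apply: nE; rewrite !mem_cat ?ys ?map_f ?orbT //.
Qed.

Lemma near_mul x a b f g : F g -> (\forall z \near x, b z = g z) ->
  (\forall z \near g x, a z = f z) -> \forall z \near x, (a * b) z = (f * g) z.
Proof.
move=> Fg bg /(full_nbhs hF Fg); apply: filterS2 bg => z.
by rewrite !bME => -> ->.
Qed.

Section Prescribed.
Variables (W : set X) (J : finType).
Hypothesis oW : open W.

(** If the sources and the targets of the germs are all distinct, the germ at [p k] is
    realised by a 3-cycle through [p k], [g k (p k)] and a fresh point, which is trivial
    near the other sources and targets. *)
Let prescribed_apart (p : J -> X) (g : J -> bijection X) :
  (forall j, F (g j)) -> (forall j, W (p j)) -> (forall j, W (g j (p j))) ->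
  (forall i j, p i = p j -> i = j) -> (forall i j, g i (p i) = g j (p j) -> i = j) ->
  (forall i j, p i <> g j (p j)) ->
  exists2 a, alt W a & forall j, \forall z \near p j, a z = g j z.
Proof.
move=> Fg Wp Wg pI gI pg.
suff /(_ (enum J) (enum_uniq _)) [a Wa [aj _ _]] : forall js : seq J, uniq js ->
    exists2 a, alt W a & [/\ forall j, j \in js -> \forall z \near p j, a z = g j z,
      forall j, j \notin js -> \forall z \near p j, a z = z &
      forall j, j \notin js -> \forall z \near g j (p j), a z = z].
  by exists a => // j; apply: aj; rewrite mem_enum.
elim=> [_|k js IH /= /andP[kjs /IH[a Wa [a1 a2 a3]]]].
  by exists 1; [exact: alt1|split=> // j _; exact: filterE].
have [|h [Fh Wh hs]] := @fresh_translate _ _ hX hF (p k) W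
    (codom p ++ codom (fun j => g j (p j))) oW.
  by exists (p k).
have hp j : h (p k) <> p j.
  by move=> e; move: hs; rewrite mem_cat e codom_f.
have hg j : h (p k) <> g j (p j).
  by move=> e; move: hs; rewrite mem_cat e (codom_f (fun j => g j (p j))) orbT.
pose s := [seq p j | j <- enum J & j != k] ++ [seq g j (p j) | j <- enum J & j != k].
have [||||y|V [Vc Vk _ Vs]] := @small_cycle W (p k) (g k) h s setT oW (Fg k) Fh
    (Wp k) (Wg k) Wh.
- exact: pg.
- exact/nesym.
- exact/nesym.
- exact: filterT.
- rewrite mem_cat => /orP[] /mapP[j]; rewrite mem_filter => /andP[/eqP jk _] ->.
    by split; [move=> /pI|exact: pg|exact/nesym].
  by split; [exact/nesym|move=> /gI|exact/nesym].
have Vp j : j != k -> \forall z \near p j, cycle3 V (g k) h z = z.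
  move=> jk; apply: Vs; rewrite mem_cat; apply/orP; left.
  by apply/map_f; rewrite mem_filter jk mem_enum.
have Vg j : j != k -> \forall z \near g j (p j), cycle3 V (g k) h z = z.
  move=> jk; apply: Vs; rewrite mem_cat; apply/orP; right.
  by apply: (map_f (fun j => g j (p j))); rewrite mem_filter jk mem_enum.
have [cV _ _ d _] := Vc.
have Vg0 : \forall z \near p k, cycle3 V (g k) h z = g k z.
  have : nbhs (p k) V by apply: open_nbhs_nbhs; split=> //; case: cV.
  by apply: filterS => z; exact: cycle3B.
exists (cycle3 V (g k) h * a); first exact: altMl.
split=> j; rewrite inE.
- have [-> _|jk /= jjs] := eqVneq j k.
    exact: (near_mul (g := 1) (sub1 sF) (a2 _ kjs) Vg0).
  exact: (near_mul (f := 1) (Fg j) (a1 _ jjs) (Vg _ jk)).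
- rewrite negb_or => /andP[jk jjs].
  exact: (near_mul (f := 1) (g := 1) (sub1 sF) (a2 _ jjs) (Vp _ jk)).
- rewrite negb_or => /andP[jk jjs].
  exact: (near_mul (f := 1) (g := 1) (sub1 sF) (a3 _ jjs) (Vg _ jk)).
Qed.

(** Finitely many germs with distinct sources and distinct targets extend to one
    element.  Each source is first moved to a fresh point and from there to its target;
    each of these two stages has no source among its targets. *)
Lemma alt_prescribed (p : J -> X) (g : J -> bijection X) :
  (forall j, F (g j)) -> (forall j, W (p j)) -> (forall j, W (g j (p j))) ->
  (forall i j, p i = p j -> i = j) -> (forall i j, g i (p i) = g j (p j) -> i = j) ->
  exists2 a, alt W a & forall j, \forall z \near p j, a z = g j z.
Proof.
move=> Fg Wp Wg pI gI.
have [j s|k [kP ks kI]] := @choose_disjoint_family J X _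
    (fun j k => F k /\ W (k (p j))) (fun j k => [:: k (p j)]) _
    (codom p ++ codom (fun j => g j (p j))).
  have [|k [Fk Wk nk]] := @fresh_translate _ _ hX hF (p j) W s oW.
    by exists (p j).
  by exists k => // x; rewrite inE => /eqP ->.
have kp i j : p i <> k j (p j).
  move=> e; have := ks j (k j (p j)); rewrite inE eqxx => /(_ isT).
  by rewrite mem_cat -e codom_f.
have kg i j : k i (p i) <> g j (p j).
  move=> e; have := ks i (k i (p i)); rewrite inE eqxx => /(_ isT).
  by rewrite mem_cat e (codom_f (fun j => g j (p j))) orbT.
have kI' i j : k i (p i) = k j (p j) -> i = j.
  by move=> e; apply: (kI i j (k i (p i))); rewrite inE ?e.
have Fk j : F (k j) by have [] := kP j.
have Wk j : W (k j (p j)) by have [] := kP j.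
have [a Wa aP] := prescribed_apart Fk Wp Wk pI kI' kp.
have gkE j : (g j * (k j)^-1) (k j (p j)) = g j (p j) by rewrite bME bK.
have [b Wb bP] : exists2 b, alt W b &
    forall j, \forall z \near k j (p j), b z = (g j * (k j)^-1) z.
  apply: (prescribed_apart (p := fun j => k j (p j))) => // [j|j|i j|i j].
  - by apply: (subM sF) => //; exact: (subV sF).
  - by rewrite gkE.
  - by rewrite !gkE; exact: gI.
  - by rewrite gkE.
exists (b * a) => [|j]; first exact: alt_mul.
by have := near_mul (Fk j) (aP j) (bP j); rewrite mulgVK.
Qed.

End Prescribed.

End Alternating.

(** * Elements of the alternating group with a trivial germ *)

Section TrivialGerm.
Variables (X : topologicalType) (F : set (bijection X)).
Hypotheses (hX : cantor_basics X) (hF : full_dynamics F).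
Implicit Types (x y z p q : X) (f g h k t a b d : bijection X) (U V O D : set X).
Let sF := full_subgroup hF.
Local Notation cycle_in := (cycle_in F).
Local Notation alt := (alt F).
Variable W : set X.
Hypothesis oW : open W.

(** Congruence modulo the elements supported away from [p]. *)
Let same p a b := alt (W `\ p) (a^-1 * b).

Let sA p : is_subgroup (alt (W `\ p)) := alt_subgroup F _.

Let same_refl p a : same p a a.
Proof. by rewrite /same mulVg; exact: alt1. Qed.

Let same_sym p a b : same p a b -> same p b a.
Proof. by move=> /(subV (sA p)); rewrite /same invgM invgK. Qed.

Let same_trans p a b c : same p a b -> same p b c -> same p a c.
Proof. by move=> ab /(subM (sA p) ab); rewrite /same mulgA mulgK. Qed.

Let same_mulr p a b : alt (W `\ p) b -> same p a (a * b).
Proof. by rewrite /same mulKg. Qed.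

Let same_mull p c a b : same p a b -> same p (c * a) (c * b).
Proof. by rewrite /same invgM mulgA mulgVK. Qed.

Let alt_move p q d b : alt W d -> d p = q ->
  alt (W `\ p) b -> alt (W `\ q) (d * b * d^-1).
Proof.
move=> Wd dp; apply: (altJ_sub hF) => [|x [Wx xp]]; first exact: (alt_full hF Wd).
split; first exact: (alt_stable Wd).
by move=> /= dx; apply: xp; apply: (@b_inj _ d); rewrite dp.
Qed.

Let same_mulJ p q a b d : alt W d -> d p = q -> same q a b ->
  same p (a * d) (b * d).
Proof.
move=> Wd dp ab; have := @alt_move q p d^-1 _ (subV (alt_subgroup F W) Wd) _ ab.
rewrite invgK /same invgM => H; have := H; rewrite !mulgA; apply.
by rewrite -dp bK.
Qed.

(** Only the part of a 3-cycle near [p] matters: by [cycle3U] the base can be shrunk. *)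
Let peel p V g h O : cycle_in W V g h -> V p -> nbhs p O ->
  exists U, [/\ clopen U, U p, U `<=` V `&` O & same p (cycle3 V g h) (cycle3 U g h)].
Proof.
move=> Vc Vp pO; have [cV Fg Fh d VW] := Vc.
have nV : nbhs p V by apply: open_nbhs_nbhs; split=> //; case: cV.
have [U [cU Up UVO]] := cantor_basis hX (filterI nV pO).
exists U; split=> //; have UV : V `&` U = U.
  by apply/seteqP; split=> [x []|x Ux] //; split=> //; have [] := UVO _ Ux.
rewrite (cycle3U U d) UV; apply: same_sym; apply: same_mulr.
apply: alt_cycle; split=> //.
- have [[oU kU] [oV kV]] := (cU, cV).
  by split; [apply: openI => //; exact: closed_openC|
    apply: closedI => //; exact: open_closedC].
- by apply: disjoint_translatesS d => x [].
- move=> x [Vx Ux]; have [? ? ?] := VW x Vx; have [m1 m2 _] := d p x Vp Vx.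
  split; split=> // e; [|exact: m1 (esym e)|exact: m2 (esym e)].
  by apply: Ux; rewrite (e : x = p).
Qed.

(** The third point of a 3-cycle through [p] does not matter, by [cycle3_third]. *)
Let third p V g h k : disjoint_translates3 V g h k -> V p ->
  cycle_in W V g h -> cycle_in W V g k -> same p (cycle3 V g h) (cycle3 V g k).
Proof.
move=> d Vp [cV Fg Fh dgh VWh] [_ _ Fk dgk VWk].
rewrite (cycle3_third d); apply: same_mulr; apply: alt_cycle.
have FgV := subV sF Fg; split.
- exact: (clopen_translate hF).
- exact: (subM sF).
- exact: (subM sF).
- have [_ _ dhk] := d; move=> x y Tx Ty.
  have [x' Vx' ->] := translate_image Tx; have [y' Vy' ->] := translate_image Ty.
  rewrite !bME !bK; have [_ _ ?] := dgh _ _ Vx' Vy'; have [_ _ ?] := dgk _ _ Vx' Vy'.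
  by have [_ _ /nesym ?] := dhk _ _ Vy' Vx'.
- move=> x Tx; have [y Vy ->] := translate_image Tx; rewrite !bME bK.
  have [? ? ?] := VWh y Vy; have [? ? ?] := VWk y Vy.
  have [m1 m2 _] := dgh _ _ Vp Vy; have [_ m3 _] := dgk _ _ Vp Vy.
  by split; split=> // e; [apply: m1|apply: m3|apply: m2]; exact: esym e.
Qed.

Let cycle3_ext V g h g' h' : disjoint_translates V g h ->
  (forall x, V x -> g x = g' x) -> (forall x, V x -> h x = h' x) ->
  cycle3 V g h = cycle3 V g' h'.
Proof.
move=> d gg' hh'; have d' : disjoint_translates V g' h'.
  by move=> x y Vx Vy; rewrite -!gg' -?hh' //; exact: d.
apply: bijP => x; case: (cycleP V g h x) => [Vx|y Vy ->|y Vy ->|n1 n2 n3].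
- by rewrite !cycle3B ?gg'.
- by rewrite cycle3F // gg' // cycle3F // hh'.
- by rewrite cycle3S // hh' // cycle3S.
- rewrite !cycle30 //.
  + move=> V1; apply: n2; have e : g (g'^-1 x) = x by rewrite gg' // bVK.
    by rewrite -{1}e bK.
  + move=> V1; apply: n3; have e : h (h'^-1 x) = x by rewrite hh' // bVK.
    by rewrite -{1}e bK.
Qed.

Let fresh p (s : seq X) : W p -> exists k, [/\ F k, W (k p) & k p \notin s].
Proof. by move=> Wp; apply: fresh_translate => //; exists p. Qed.

Let near3 p g h k : F g -> F h -> F k ->
  p <> g p -> p <> h p -> p <> k p -> g p <> h p -> g p <> k p -> h p <> k p ->
  exists2 U, nbhs p U & disjoint_translates3 U g h k.
Proof.
move=> Fg Fh Fk n1 n2 n3 n4 n5 n6.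
have [A pA dA] := disjoint_translates_at hX hF Fg Fh n1 n2 n4.
have [B pB dB] := disjoint_translates_at hX hF Fg Fk n1 n3 n5.
have [C pC dC] := disjoint_translates_at hX hF Fh Fk n2 n3 n6.
exists (A `&` (B `&` C)); first by do !apply: filterI.
by split; [apply: disjoint_translatesS dA|apply: disjoint_translatesS dB|
  apply: disjoint_translatesS dC] => x [? []].
Qed.

Let disjoint3S U V g h k : U `<=` V -> disjoint_translates3 V g h k ->
  disjoint_translates3 U g h k.
Proof. by move=> UV [? ? ?]; split; exact: disjoint_translatesS UV _. Qed.

(** The form of [third] for a new third point that need only be apart from the three
    points of the 3-cycle at [p]: the base is shrunk first. *)
Let change_third p V g h k : cycle_in W V g h -> V p ->
  F k -> W (k p) -> k p <> p -> k p <> g p -> k p <> h p ->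
  exists U, [/\ nbhs p U, U `<=` V & forall D, clopen D -> D p -> D `<=` U ->
    cycle_in W D g k /\ same p (cycle3 V g h) (cycle3 D g k)].
Proof.
move=> Vc Vp Fk Wk kp kg kh; have [cV Fg Fh d VW] := Vc.
have [n1 n2 n3] := d p p Vp Vp.
have [A pA dA] := @near3 p g h k Fg Fh Fk n1 n2 (nesym kp) n3 (nesym kg) (nesym kh).
have kW : nbhs p [set x | W (k x)].
  by apply: (full_nbhs hF Fk); exact: open_nbhs_nbhs.
have [U [cU Up UP S]] := peel Vc Vp (filterI pA kW).
exists U; split=> [|x /UP[]//|D cD Dp DU].
  by apply: open_nbhs_nbhs; split=> //; case: cU.
have Uc := cycle_in_base cU (fun x Ux => (UP x Ux).1) Vc.
have dU : disjoint_translates3 U g h k by apply: disjoint3S dA => x /UP[_ []].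
have Uk : cycle_in W U g k.
  have [_ ? _] := dU; split=> // x /UP[/VW[? ? _] [_ ?]]; by split.
have Dk := cycle_in_base cD DU Uk.
split=> //; apply: same_trans S _; apply: same_trans (third dU Up Uc Uk) _.
have [E [cE Ep EP SE]] := peel Uk Up (open_nbhs_nbhs (conj cD.1 Dp)).
have [E' [cE' Ep' EP' SE']] := peel Dk Dp (open_nbhs_nbhs (conj cE.1 Ep)).
have [_ _ _ dk _] := Uk.
have DUe : U `&` D = D by apply/seteqP; split=> [x []|x Dx] //; split=> //; exact: DU.
rewrite (cycle3U D dk) DUe; apply: same_sym; apply: same_mulr.
apply: alt_cycle; have [_ ? ? ? UW] := Uk; split=> //.
- have [[oU kU] [oD kD]] := (cU, cD).
  by split; [apply: openI => //; exact: closed_openC|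
    apply: closedI => //; exact: open_closedC].
- by apply: disjoint_translatesS dk => x [].
- move=> x [Ux Dx]; have [? ? ?] := UW x Ux; have [m1 m2 _] := dk p x Up Ux.
  split; split=> // e; [|exact: m1 (esym e)|exact: m2 (esym e)].
  by apply: Dx; rewrite (e : x = p).
Qed.

(** A 3-cycle that moves [p] is determined by its germ at [p] modulo the elements
    supported away from [p]: replace the third points of both with one fresh point. *)
Lemma cycle_germ p V g h V' g' h' : cycle_in W V g h -> cycle_in W V' g' h' ->
  V p -> V' p -> (\forall z \near p, g z = g' z) ->
  alt (W `\ p) ((cycle3 V g h)^-1 * cycle3 V' g' h').
Proof.
move=> Vc Vc' Vp Vp' gg'.
have [cV Fg Fh d VW] := Vc; have [cV' Fg' Fh' d' VW'] := Vc'.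
have [Wp _ _] := VW p Vp.
have [k [Fk Wk]] := fresh [:: p; g p; h p; g' p; h' p] Wp.
rewrite !inE !negb_or => /and5P[/eqP k1 /eqP k2 /eqP k3 /eqP k4 /eqP k5].
have [U [pU UV UP]] := change_third Vc Vp Fk Wk k1 k2 k3.
have [U' [pU' UV' UP']] := change_third Vc' Vp' Fk Wk k1 k4 k5.
have [D [cD Dp DP]] := cantor_basis hX (filterI pU (filterI pU' gg')).
have [|_ S] := UP D cD Dp; first by move=> x /DP[].
have [|[_ _ _ dD _] S'] := UP' D cD Dp; first by move=> x /DP[_ []].
apply: same_trans S _; apply: same_sym; apply: same_trans S' _.
rewrite (_ : cycle3 D g' k = cycle3 D g k); first exact: same_refl.
by apply: cycle3_ext => // x /DP[_ [_ ->]].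
Qed.

(** A 3-cycle can be based at any of the three translates that it permutes. *)
Let rebase V g h p : cycle_in W V g h -> cycle3 V g h p <> p ->
  exists V' g' h', [/\ cycle_in W V' g' h', V' p & cycle3 V g h = cycle3 V' g' h'].
Proof.
move=> Vc; have [_ _ _ d _] := Vc; have Vr := cycle_in_rot hF Vc.
have [_ _ _ dr _] := Vr.
case: (cycleP V g h p) => [Vp|y Vy ->|y Vy ->|n1 n2 n3].
- by exists V, g, h.
- exists (translate g V), (h * g^-1), g^-1.
  by rewrite translateE cycle3_rot.
- exists (translate (h * g^-1) (translate g V)), (g^-1 * (h * g^-1)^-1), (h * g^-1)^-1.
  split; first exact: (cycle_in_rot hF Vr).
    by rewrite -translateM mulgVK translateE.
  by rewrite -cycle3_rot // -cycle3_rot.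
- by rewrite cycle30.
Qed.

(** By [cycle3_triangle], a product of two 3-cycles whose germs are composed along
    three distinct points agrees with a 3-cycle for the composed germ. *)
Let triangle p Vt gt ht V g h V' g' h' :
  cycle_in W Vt gt ht -> cycle_in W V g h -> cycle_in W V' g' h' ->
  V p -> V' p -> cycle3 Vt gt ht (g p) <> p ->
  (\forall z \near p, g' z = cycle3 Vt gt ht (g z)) ->
  same p (cycle3 V' g' h') (cycle3 Vt gt ht * cycle3 V g h).
Proof.
move=> Tc Vc Vc' Vp Vp' tp g't.
have [cV Fg Fh d VW] := Vc; have [Wp Wgp Whp] := VW p Vp.
have [tgp|tgp] := pselect (cycle3 Vt gt ht (g p) = g p).
  have [cT FgT FhT dT TW] := Tc.
  have nT : ~ Vt (g p).
    move=> Tg; have [n _ _] := dT _ _ Tg Tg; apply: n.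
    by rewrite -{1}tgp (cycle3B dT Tg).
  have nT1 : ~ Vt (gt^-1 (g p)).
    move=> Tg; have [_ _ n] := dT _ _ Tg Tg; apply: n.
    by rewrite -(cycle3F dT Tg) bVK tgp.
  have nT2 : ~ Vt (ht^-1 (g p)).
    move=> Tg; have [_ n _] := dT _ _ Tg Tg; apply: n.
    by have := cycle3S dT Tg; rewrite bVK tgp => /esym.
  have At : alt (W `\ g p) (cycle3 Vt gt ht).
    apply: alt_cycle; split=> // x Tx; have [? ? ?] := TW _ Tx.
    by split; split=> // /= e; [apply: nT|apply: nT1|apply: nT2]; rewrite -e ?bK.
  have nt : \forall z \near g p, cycle3 Vt gt ht z = z by exact: (cycle_near_fix hF).
  apply: (@same_trans _ _ (cycle3 V g h)).
    apply: cycle_germ => //; have := full_nbhs hF Fg nt; apply: filterS2 g't.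
    by move=> z -> ->.
  have := @alt_move (g p) p (cycle3 V g h)^-1 _ _ _ At; rewrite invgK.
  rewrite /same mulgA; apply.
    exact/(subV (alt_subgroup F W))/alt_cycle.
  by apply: (@b_inj _ (cycle3 V g h)); rewrite bVK cycle3B.
have [V1 [g1 [h1 [Vc1 V1g e1]]]] := rebase Tc tgp; rewrite e1 in tp tgp g't *.
have {Tc tgp} [cV1 Fg1 Fh1 d1 VW1] := Vc1; have [_ Wu _] := VW1 _ V1g.
have [n1 _ _] := d1 _ _ V1g V1g; have [m1 _ _] := d _ _ Vp Vp.
rewrite cycle3B // in tp.
have [k [Fk Wk]] := fresh [:: p; g p; h p; g1 (g p)] Wp.
rewrite !inE !negb_or => /and4P[/eqP k1 /eqP k2 /eqP k3 /eqP k4].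
have Fgg : F (g1 * g) by exact: (subM sF).
have [A pA dA] := @near3 p g (g1 * g) k Fg Fgg Fk m1 (nesym tp) (nesym k1)
  n1 (nesym k2) (nesym k4).
have [U [pU UV UP]] := change_third Vc Vp Fk Wk k1 k2 k3.
have nVt : nbhs p [set z | V1 (g z)].
  by apply: (full_nbhs hF Fg); apply: open_nbhs_nbhs; split=> //; case: cV1.
have [D [cD Dp DP]] := cantor_basis hX (filterI pA (filterI pU (filterI nVt g't))).
have dD : disjoint_translates3 D g (g1 * g) k by apply: disjoint3S dA => x /DP[].
have [|Dk S] := UP D cD Dp; first by move=> x /DP[_ []].
have [_ _ _ dgk DW] := Dk; have [dD1 _ dD2] := dD.
have Dh : cycle_in W D (g1 * g) k.
  split=> // x Dx; have [? ? ?] := DW x Dx; split=> //.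
  by have [_ [_ [/VW1[]]]] := DP x Dx.
have [_ _ _ _ DhW] := Dh; have := cycle3_triangle dD; rewrite mulgK => eD.
have Dt : cycle_in W (translate g D) g1 (k * g^-1).
  split=> //; first exact: (clopen_translate hF).
  - by apply: (subM sF) => //; exact: (subV sF).
  - move=> x y Tx Ty; have [x' Dx' ->] := translate_image Tx.
    have [y' Dy' ->] := translate_image Ty; rewrite !bME !bK.
    have [_ _ ?] := dD1 _ _ Dx' Dy'; have [_ _ ?] := dgk _ _ Dx' Dy'.
    by have [_ _ ?] := dD2 _ _ Dx' Dy'.
  - move=> x Tx; have [y Dy ->] := translate_image Tx; rewrite bME bK.
    by have [? ? ?] := DW y Dy; have [_ ? _] := DhW y Dy.
apply: (@same_trans _ _ (cycle3 D (g1 * g) k)).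
  apply: cycle_germ => //; apply: filterS2 g't nVt => z -> Vz.
  by rewrite cycle3B.
rewrite -eD; apply: (@same_trans _ _ (cycle3 V1 g1 h1 * cycle3 D g k)); last first.
  by apply: same_mull; exact: same_sym.
apply: (@same_mulJ p (g p)).
- exact: alt_cycle.
- by rewrite cycle3B.
- apply: cycle_germ => //; first by rewrite translateE.
  exact: filterE.
Qed.

(** Multiplying a 3-cycle that moves [p] to [q] by the letters of the word [a] from the
    left, [triangle] applies at each letter as soon as [p] avoids the finitely many
    points [s] through which the word takes [q]. *)
Let track a : alt W a -> forall q, exists s : seq X, forall p, W p -> p \notin s ->
  forall V g h V' g' h', cycle_in W V g h -> cycle_in W V' g' h' ->
  V p -> V' p -> g p = q -> (\forall z \near p, g' z = a (g z)) ->
  same p (cycle3 V' g' h') (a * cycle3 V g h).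
Proof.
elim=> [|Vt gt ht b Tc Wb IH] q.
  exists [::] => p _ _ V g h V' g' h' Vc Vc' Vp Vp' _ g'g; rewrite mul1g.
  exact: cycle_germ.
have [s sP] := IH q; exists [:: b q, cycle3 Vt gt ht (b q) & s].
move=> p Wp; rewrite !inE !negb_or => /and3P[/eqP pb /eqP pt ps].
move=> V g h V' g' h' Vc Vc' Vp Vp' gp g'g.
have [cV Fg Fh d VW] := Vc; have [_ Wgp _] := VW p Vp.
have [h2 [Fh2 Wh2]] := fresh [:: p; b q] Wp.
rewrite !inE !negb_or => /andP[/eqP n1 /eqP n2].
have Fb := alt_full hF Wb.
have [||||||V2 [Vc2 Vp2 _ _]] := @small_cycle _ _ hX hF W p (b * g) h2 [::] setT oW
  (subM sF Fb Fg) Fh2 Wp _ Wh2.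
- by rewrite bME; exact: (alt_stable Wb).
- by rewrite bME gp.
- exact/nesym.
- by rewrite bME gp; exact/nesym.
- exact: filterT.
- by [].
have N : \forall z \near p, (b * g) z = b (g z) by exact: filterE.
have S := sP p Wp ps _ _ _ _ _ _ Vc Vc2 Vp Vp2 gp N.
rewrite -mulgA; apply: (same_trans _ (same_mull (cycle3 Vt gt ht) S)).
apply: triangle => //; first by rewrite bME gp; exact/nesym.
Qed.

(** If the germ of [a] at [q] is trivial, take a 3-cycle [d] that moves to [q] a point
    [p] that the word [a] never meets.  By [track], [a d] agrees with a 3-cycle for the
    germ of [a d] at [p], that is, with [d], up to elements supported away from [p];
    conjugation by [d] moves [p] to [q]. *)
Lemma alt_trivial_germ a q : W q -> alt W a -> (\forall z \near q, a z = z) ->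
  alt (W `\ q) a.
Proof.
move=> Wq Wa aq; have [s sP] := track Wa q.
have [k [Fk Wk]] := fresh (q :: s) Wq.
rewrite inE negb_or => /andP[/eqP kq ks].
have [h [Fh Wh]] := fresh [:: k q; q] Wk.
rewrite !inE !negb_or => /andP[/eqP n1 /eqP n2].
have [||||||V [Vc Vp _ _]] := @small_cycle _ _ hX hF W (k q) k^-1 h [::] setT oW
  (subV sF Fk) Fh Wk _ Wh; rewrite ?bK //.
- exact/nesym.
- exact/nesym.
- exact: filterT.
have N : \forall z \near k q, k^-1 z = a (k^-1 z).
  have kqq : nbhs (k^-1 (k q)) [set z | a z = z] by rewrite bK.
  by apply: filterS (full_nbhs hF (subV sF Fk) kqq) => z ->.
have S := sP _ Wk ks _ _ _ _ _ _ Vc Vc Vp Vp (bK _ _) N.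
have Wd := alt_cycle Vc.
have dq : cycle3 V k^-1 h (k q) = q.
  by have [_ _ _ d _] := Vc; rewrite cycle3B // bK.
have := alt_move Wd dq S.
by rewrite mulVKg mulgK.
Qed.

End TrivialGerm.

(** * Products of elements with disjoint supports, and shifts *)

Section DisjointProducts.
Variables (T : Type) (J : eqType).
Implicit Types (b : J -> bijection T) (D : J -> set T).

Definition gprod (js : seq J) b : bijection T := foldr (fun j a => b j * a) 1 js.

Lemma fixed_complement (D : set T) (a : bijection T) x :
  (forall x, ~ D x -> a x = x) -> D x -> D (a x).
Proof.
move=> aD Dx; apply: contrapT => nD; apply: (nD).
by rewrite (b_inj (aD _ nD)).
Qed.

Lemma gprod_sub (L : set (bijection T)) js b : is_subgroup L ->
  (forall j, L (b j)) -> L (gprod js b).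
Proof.
by move=> sL Lb; elim: js => [|j js IH]; [exact: (sub1 sL)|exact: (subM sL)].
Qed.

Lemma gprod_disjoint js b D : uniq js -> (forall j x, ~ D j x -> b j x = x) ->
  (forall i j x, D i x -> D j x -> i = j) ->
  (forall j x, j \in js -> D j x -> gprod js b x = b j x) /\
  (forall x, (forall j, j \in js -> ~ D j x) -> gprod js b x = x).
Proof.
move=> + bD dD; elim: js => [|k js IH]; first by split.
rewrite cons_uniq => /andP[kjs /IH[IH1 IH2]].
rewrite -[gprod (k :: js) b]/(b k * gprod js b).
split=> [j x|x nD].
  rewrite inE => /orP[/eqP -> Dx|jjs Dx].
    rewrite bME IH2 // => i ijs Di; move: kjs.
    by rewrite -(dD _ _ _ Di Dx) ijs.
  rewrite bME (IH1 j) // bD // => Dk.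
  have := fixed_complement (bD j) Dx; move=> Dj.
  by move: kjs; rewrite (dD _ _ _ Dk Dj) jjs.
rewrite bME IH2 ?bD //; first by apply: nD; rewrite inE eqxx.
by move=> j jjs; apply: nD; rewrite inE jjs orbT.
Qed.

Lemma bX_stable (D : set T) (a : bijection T) n x :
  (forall x, D x -> D (a x)) -> D x -> D ((a ^+ n) x).
Proof.
move=> aD Dx; elim: n => [|n IH]; first by rewrite expg0.
by rewrite expgS bME; exact: aD.
Qed.

Lemma bX_agree (D : set T) (a b : bijection T) n x :
  (forall x, D x -> D (b x)) -> (forall x, D x -> a x = b x) -> D x ->
  (a ^+ n) x = (b ^+ n) x.
Proof.
move=> bD ab Dx; elim: n => [|n IH]; first by rewrite !expg0.
by rewrite !expgS !bME IH ab //; exact: bX_stable.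
Qed.

Lemma bX_fix (a : bijection T) n x : a x = x -> (a ^+ n) x = x.
Proof. by move=> ax; elim: n => [|n IH]; rewrite ?expg0 // expgS bME IH. Qed.

End DisjointProducts.

(** Two functions [e], [e'] with the same colour [i] that differ only at [i] exist,
    because there are more functions than pairs of a colour and a restriction to the
    other indices. *)
Lemma pigeonhole_line n (c : {ffun 'I_n.+1 -> 'I_n.+2} -> 'I_n.+1) :
  exists (i : 'I_n.+1) (e e' : {ffun 'I_n.+1 -> 'I_n.+2}),
    [/\ c e = i, c e' = i, (e i < e' i)%N & forall j, j != i -> e j = e' j].
Proof.
pose f (e : {ffun 'I_n.+1 -> 'I_n.+2}) :=
  (c e, [ffun j : 'I_n => e (lift (c e) j)]).
have : ~ injective f.
  move=> /leq_card; rewrite card_prod !card_ffun !card_ord expnS leq_pmul2r ?expn_gt0 //.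
  by rewrite ltnn.
move=> /existsNP[e /existsNP[e' /not_implyP[fe /eqP ee']]].
have [ce] := fe; move=> /ffunP ffe.
have same j : j != c e -> e j = e' j.
  rewrite eq_sym => /unlift_some[k -> _].
  by have := ffe k; rewrite !ffunE -ce.
have ne : e (c e) != e' (c e).
  apply: contra ee' => /eqP ec; apply/eqP/ffunP => j.
  by have [->|/same] := eqVneq j (c e).
have : (e (c e) : nat) != e' (c e) by [].
rewrite neq_ltn => /orP[lt|lt].
  by exists (c e), e, e'; split.
by exists (c e), e', e; split=> // j /same.
Qed.

Section Rotation.
Variables (X : topologicalType) (F : set (bijection X)).
Hypotheses (hX : cantor_basics X) (hF : full_dynamics F).
Implicit Types (x y z p q : X) (f g h k t a b d : bijection X) (U V W O D : set X).
Let sF := full_subgroup hF.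
Local Notation cycle_in := (cycle_in F).
Local Notation alt := (alt F).

(** The cyclic shift of $2r + 1$ disjoint translates is the product of the 3-cycles
    $(0\,1\,2)(2\,3\,4)\cdots$; an even number of translates would ask for an odd
    permutation. *)
Lemma alt_shift W V (c : nat -> bijection X) r : clopen V -> (forall j, F (c j)) ->
  (forall j y, (j <= r.*2)%N -> V y -> W (c j y)) ->
  (forall i j y z, (i <= r.*2)%N -> (j <= r.*2)%N -> V y -> V z ->
     c i y = c j z -> i = j) ->
  exists u, [/\ alt W u, forall j y, (j < r.*2)%N -> V y -> u (c j y) = c j.+1 y &
    forall x, (forall j, (j <= r.*2)%N -> ~ V ((c j)^-1 x)) -> u x = x].
Proof.
move=> cV Fc; elim: r => [|r IH] Wc dc.
  by exists 1; split=> //; exact: alt1.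
have lt2 j : (j <= r.*2)%N -> (j <= r.+1.*2)%N.
  by move=> jr; rewrite doubleS; apply: leq_trans jr _; rewrite ltnW.
have [||u [Wu u1 u2]] := IH.
- by move=> j y /lt2; exact: Wc.
- by move=> i j y z /lt2 ir /lt2 jr; exact: dc.
pose A := translate (c r.*2) V.
pose g := c r.*2.+1 * (c r.*2)^-1; pose h := c r.*2.+2 * (c r.*2)^-1.
have Ac : cycle_in W A g h.
  split; first exact: (clopen_translate hF).
  - by apply: (subM sF) => //; exact: (subV sF).
  - by apply: (subM sF) => //; exact: (subV sF).
  - move=> x y Tx Ty; have [x' Vx ->] := translate_image Tx.
    have [y' Vy ->] := translate_image Ty; rewrite !bME !bK.
    split=> /dc; rewrite doubleS; move=> /(_ _ _ Vx Vy).
    + by move=> /(_ (ltnW (ltnW (leqnn _))) (ltnW (leqnn _))) /eqP; rewrite ltn_eqF.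
    + move=> /(_ (ltnW (ltnW (leqnn _))) (leqnn _)) /eqP.
      by rewrite ltn_eqF // ltnS ltnW.
    + by move=> /(_ (ltnW (leqnn _)) (leqnn _)) /eqP; rewrite ltn_eqF.
  - move=> x Tx; have [y Vy ->] := translate_image Tx; rewrite !bME bK.
    by split; apply: Wc => //; rewrite doubleS ?leqnn // ltnW // ltnW.
have [_ _ _ dA _] := Ac.
have nA i j y : (i <= r.+1.*2)%N -> (j <= r.+1.*2)%N -> V y -> i <> j ->
  ~ V ((c i)^-1 (c j y)).
  by move=> ir jr Vy ij Vi; apply/ij/(dc i j _ _ ir jr Vi Vy); rewrite bVK.
have cA y : V y -> A (c r.*2 y) by move=> Vy; rewrite /A translateE.
have t1 y : V y -> cycle3 A g h (c r.*2 y) = c r.*2.+1 y.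
  by move=> Vy; have Ay := cA y Vy; rewrite cycle3B // /g bME bK.
have t2 y : V y -> cycle3 A g h (c r.*2.+1 y) = c r.*2.+2 y.
  move=> Vy; have e : c r.*2.+1 y = g (c r.*2 y) by rewrite /g bME bK.
  by have Ay := cA y Vy; rewrite e cycle3F // /h bME bK.
have t0 x : ~ V ((c r.*2)^-1 x) -> ~ V ((c r.*2.+1)^-1 x) ->
    ~ V ((c r.*2.+2)^-1 x) -> cycle3 A g h x = x.
  move=> n0 n1 n2; apply: cycle30 => //.
    by rewrite /A /translate /mkset /g invgM invgK bME bK.
  by rewrite /A /translate /mkset /h invgM invgK bME bK.
exists (u * cycle3 A g h); split.
- by apply: (subM (alt_subgroup F W)) => //; exact: alt_cycle.
- move=> j y jr Vy; rewrite bME.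
  have [->|j1] := eqVneq j r.*2.+1.
    by rewrite t2 // u2 // => i ir; apply: nA => //; lia.
  have [->|j2] := eqVneq j r.*2.
    by rewrite t1 // u2 // => i ir; apply: nA => //; lia.
  by rewrite t0 ?u1 //; first lia; apply: nA => //; lia.
- move=> x nV; rewrite bME t0 ?u2 //; first (by move=> j jr; apply: nV; lia);
    by apply: nV; lia.
Qed.

End Rotation.

(** * Confined subgroups contain a local alternating group *)

Section PowerCommutators.
Variables (X : topologicalType) (F : set (bijection X)).
Hypotheses (hX : cantor_basics X) (hF : full_dynamics F).
Implicit Types (x y z p q : X) (f g h k t a b d : bijection X) (U V W O D : set X).
Implicit Types (L : set (bijection X)).
Let sF := full_subgroup hF.
Local Notation cycle_in := (cycle_in F).
Local Notation alt := (alt F).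

(** A missing 3-cycle can be taken with a small base [V].  Two chains of disjoint
    translates of [V] that meet only in [V] lead from [V] to [g V] and to [h V]; the
    shifts [u] and [v] along them have powers that act on [V] as [g] and [h], so
    [cycle3_commutator] applies to these powers. *)
Lemma missing_power_commutator W L r : open W -> is_subgroup L -> (0 < r)%N ->
  ~ (alt W `<=` L) ->
  exists V g h u v Cu Cv,
    [/\ cycle_in W V g h, ~ L (cycle3 V g h), alt W u /\ alt W v,
      (forall x, ~ Cu x -> u x = x) /\ (forall x, ~ Cv x -> v x = x) &
      [/\ Cu `<=` W, Cv `<=` W, Cu `&` Cv `<=` V,
        forall x, V x -> (u ^+ r.*2) x = g x &
        forall x, V x -> (v ^+ r.*2) x = h x]].
Proof.
move=> oW sL r0 nWL; set m := r.*2; have m0 : (1 < m)%N by lia.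
have [V [g [h [Vc nL]]]] : exists V g h, cycle_in W V g h /\ ~ L (cycle3 V g h).
  apply: contrapT => n; apply: nWL; apply: (alt_sub sL) => V g h Vc.
  by apply: contrapT => nL; apply: n; exists V, g, h.
have [cV Fg Fh d VW] := Vc.
have [x [Vx xP]] : exists x, V x /\ forall O, nbhs x O ->
    exists U, [/\ clopen U, U `<=` V `&` O & ~ L (cycle3 U g h)].
  apply: contrapT => n; apply: nL; apply: (cycle_local hX sL Vc) => x Vx.
  apply: contrapT => nO; apply: n; exists x; split=> // O xO.
  apply: contrapT => nU; apply: nO; exists O => // U cU UO.
  by apply: contrapT => nLU; apply: nU; exists U.
have [Wx Wg Wh] := VW x Vx; have [xg xh gh] := d x x Vx Vx.
have [j s|k [kP ks kI]] := @choose_disjoint_family 'I_m.*2.+1 X (bijection X)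
    (fun _ k => F k /\ W (k x)) (fun _ k => [:: k x]) _ [:: x; g x; h x].
  have [|k [Fk Wk nk]] := @fresh_translate _ _ hX hF x W s oW; first by exists x.
  by exists k => // y; rewrite inE => /eqP ->.
have kx j : [/\ k j x <> x, k j x <> g x & k j x <> h x].
  have := ks j (k j x); rewrite inE eqxx => /(_ isT).
  by rewrite !inE !negb_or => /and3P[/eqP ? /eqP ? /eqP ?].
have kI' i j : k i x = k j x -> i = j.
  by move=> e; apply: (kI i j (k i x)); rewrite inE ?e.
(* The chain from [x] to [g x] is [c 0, .., c m], and the chain from [x] to [h x] is
   [c 0, c m.+1, .., c m.*2]. *)
pose c (j : 'I_m.*2.+1) : bijection X :=
  if (j : nat) == 0%N then 1 else if (j : nat) == m then g
  else if (j : nat) == m.*2 then h else k j.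
have Fc j : F (c j).
  rewrite /c; do !case: ifP => // _; first exact: (sub1 sF).
  by have [] := kP j.
have Wc j : W (c j x).
  rewrite /c; do !case: ifP => // _.
  by have [] := kP j.
have cI i j : c i x = c j x -> i = j.
  have [k1 k2 k3] := kx i; have [l1 l2 l3] := kx j.
  have eqo (e : nat) : (i : nat) = e -> (j : nat) = e -> i = j.
    by move=> ie je; apply: val_inj; rewrite /= ie je.
  rewrite /c; case: ((i : nat) =P 0%N) => ?; case: ((i : nat) =P m) => ?;
    case: ((i : nat) =P m.*2) => ?; case: ((j : nat) =P 0%N) => ?;
    case: ((j : nat) =P m) => ?; case: ((j : nat) =P m.*2) => ?.
  all: try by exfalso; lia.
  all: rewrite /=.
  all: try by move=> e; exfalso; congruence.
  all: try by move=> _; apply: eqo; eassumption.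
  exact: kI'.
have cO j : nbhs (c j x) W by exact: open_nbhs_nbhs.
have [D [cD Dx DW Dd]] := translates_nbhd hX hF Fc cO cI.
have [|U [cU UVD nLU]] := xP D; first by apply: open_nbhs_nbhs; case: cD.
have Uc : cycle_in W U g h by apply: cycle_in_base Vc => // y /UVD[].
pose cu (j : nat) := c (inord j).
pose cv (j : nat) := if j == 0%N then 1 else c (inord (m + j)).
have lt1 j : (j <= m)%N -> (j < m.*2.+1)%N by lia.
have c0 : c (inord 0) = 1 by rewrite /c inordK.
have cm : c (inord m) = g.
  rewrite /c inordK ?eqxx; last by lia.
  by case: eqP => // e; lia.
have cm2 : c (inord m.*2) = h.
  rewrite /c inordK ?eqxx; last by lia.
  by do 2 (case: eqP => ?; first lia).
have inord_eq i j : (i <= m.*2)%N -> (j <= m.*2)%N ->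
    inord i = inord j :> 'I_m.*2.+1 -> i = j.
  by move=> im jm /(congr1 val) /=; rewrite !inordK.
have [|j y _ Uy|i j y z im jm Uy Uz e|u [Wu u1 u2]] :=
    alt_shift hF (W := W) (r := r) (c := cu) cU.
- by move=> j; exact: Fc.
- by apply: DW; have [] := UVD _ Uy.
- have := Dd _ _ _ _ (UVD _ Uy).2 (UVD _ Uz).2 e.
  by apply: inord_eq; lia.
have [|j y jm Uy|i j y z im jm Uy Uz|v [Wv v1 v2]] :=
    alt_shift hF (W := W) (r := r) (c := cv) cU.
- by move=> j; rewrite /cv; case: eqP => // _; exact: (sub1 sF).
- rewrite /cv; case: eqP => // _; last by apply: DW; have [] := UVD _ Uy.
  by have [_ _ _ _ UW] := Uc; have [] := UW _ Uy.
- have Dy := (UVD _ Uy).2; have Dz := (UVD _ Uz).2.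
  rewrite /cv; case: eqP => [->|i0]; case: eqP => [->|j0] //.
  + by rewrite -c0 => /(Dd _ _ _ _ Dy Dz)/inord_eq; lia.
  + by rewrite -c0 => /(Dd _ _ _ _ Dy Dz)/inord_eq; lia.
  + by move=> /(Dd _ _ _ _ Dy Dz)/inord_eq; lia.
pose Cu := [set y | exists2 j, (j <= m)%N & U ((cu j)^-1 y)].
pose Cv := [set y | exists2 j, (j <= m)%N & U ((cv j)^-1 y)].
exists U, g, h, u, v, Cu, Cv; split=> //.
  split=> y nC; [apply: u2|apply: v2] => j jm Uj; apply: nC; by exists j.
have uX j y : (j <= m)%N -> U y -> (u ^+ j) y = cu j y.
  move=> + Uy; elim: j => [_|j IH jm]; first by rewrite expg0 /cu c0.
  by rewrite expgS bME IH ?u1 // ltnW.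
have vX j y : (j <= m)%N -> U y -> (v ^+ j) y = cv j y.
  move=> + Uy; elim: j => [_|j IH jm]; first by rewrite expg0 /cv.
  by rewrite expgS bME IH ?v1 // ltnW.
split=> [y [j jm Uj]|y [j jm Uj]|y [[i im Ui] [j jm Uj]]|y Uy|y Uy].
- by rewrite -(bVK (cu j) y); apply: DW; have [] := UVD _ Uj.
- rewrite -(bVK (cv j) y) /cv; move: Uj; rewrite /cv; case: eqP => // _ Uj.
    by rewrite !b1E; have [_ _ _ _ UW] := Uc; have [] := UW _ Uj.
  by apply: DW; have [] := UVD _ Uj.
- have Dy := (UVD _ Ui).2; have Dz := (UVD _ Uj).2.
  have e : cu i ((cu i)^-1 y) = cv j ((cv j)^-1 y) by rewrite !bVK.
  move: Uj Dz e; rewrite /cv; case: eqP => [_ //|j0] Uj Dz e.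
  by have /inord_eq := Dd _ _ _ _ Dy Dz e; lia.
- by rewrite uX // /cu cm.
- by rewrite vX // /cv; case: eqP => [?|_]; [lia|rewrite addnn cm2].
Qed.

End PowerCommutators.

Section ConfinedCore.
Variables (X : topologicalType) (F : set (bijection X)).
Hypotheses (hX : cantor_basics X) (hF : full_dynamics F).
Implicit Types (x y z p q : X) (f g h t a b d : bijection X) (U V W O D : set X).
Implicit Types (L : set (bijection X)).
Let sF := full_subgroup hF.
Local Notation cycle_in := (cycle_in F).
Local Notation alt := (alt F).

(** Among the conjugates of the $\varphi_i$ by the products $\prod_i s_i^{e_i}$ with
    $0 \le e_i \le n + 1$, two lie in [L] with the same [i] and exponents that differ
    only at [i].  Their quotient acts on [U i] as a power of [s i], whose exponent
    divides [m]. *)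
Lemma power_in_confined n (U : 'I_n.+1 -> set X) (phi s : 'I_n.+1 -> bijection X)
    (m : nat) L :
  is_subgroup L ->
  (forall a, alt setT a -> exists i, L (a^-1 * phi i * a)) ->
  (forall i, alt setT (s i)) -> (forall i x, ~ U i x -> s i x = x) ->
  (forall i j x, U i x -> U j x -> i = j) ->
  (forall i j x, U i x -> ~ U j (phi j x)) ->
  (n.+1)`! %| m ->
  exists i l, [/\ L l, forall x, U i x -> l x = (s i ^+ m) x &
    forall x, ~ U i x -> ~ U i (phi i x) -> l x = x].
Proof.
move=> sL Lphi As sU dU dphi dm.
have sUs i x : U i x -> U i (s i x) by exact: fixed_complement (sU i).
have sUX i j x : U i x -> U i ((s i ^+ j) x) by apply: bX_stable => y; exact: sUs.
pose g (e : {ffun 'I_n.+1 -> 'I_n.+2}) := gprod (enum 'I_n.+1) (fun i => s i ^+ e i).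
have gE e : (forall i x, U i x -> g e x = (s i ^+ e i) x) /\
    (forall x, (forall i, ~ U i x) -> g e x = x).
  have [|i x nU||g1 g2] := @gprod_disjoint _ _ (enum 'I_n.+1) (fun i => s i ^+ e i) U.
  - exact: enum_uniq.
  - by apply: bX_fix; exact: sU.
  - exact: dU.
  - split=> [i x Ux|x nU]; first by apply: g1 => //; rewrite mem_enum.
    exact: g2.
have /choice[c cP] : forall e, exists i, L ((g e)^-1 * phi i * g e).
  move=> e; apply: Lphi; apply: gprod_sub (alt_subgroup F setT) _ => i.
  by apply: subX => //; exact: alt_subgroup.
have [i [e [e' [ce ce' lt_ee' eqe]]]] := pigeonhole_line c.
have := subM sL (subV sL (cP e)) (cP e'); rewrite ce ce'.
set l0 := _ * _ => Ll0.
have l0E x : l0 x = (g e)^-1 ((phi i)^-1 (g e ((g e')^-1 (phi i (g e' x))))).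
  by rewrite /l0 !invgM invgK !bME.
have [gU gfix] := gE e; have [gU' gfix'] := gE e'.
have gst j x : U j x -> U j (g e x) by move=> Ux; rewrite (gU _ _ Ux); exact: sUX.
have gst' j x : U j x -> U j (g e' x) by move=> Ux; rewrite (gU' _ _ Ux); exact: sUX.
have gfixU x : ~ U i x -> g e' x = g e x.
  move=> nU; have [[j Uj]|nUj] := pselect (exists j, U j x).
    by rewrite (gU _ _ Uj) (gU' _ _ Uj) eqe //; apply/eqP => ji; rewrite ji in Uj.
  by rewrite gfix ?gfix' // => j Uj; apply: nUj; exists j.
have gVfix x : ~ U i x -> g e ((g e')^-1 x) = x.
  move=> nU; rewrite -gfixU ?bVK // => Ui; apply: nU.
  by rewrite -(bVK (g e') x); exact: gst'.
have l0U x : U i x -> l0 x = (s i ^+ (e' i - e i)) x.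
  move=> Ux; rewrite l0E gVfix; last exact/(dphi i i)/gst'.
  rewrite bK; apply: (@b_inj _ (g e)); rewrite bVK (gU' _ _ Ux).
  rewrite (gU i); last exact: sUX.
  by rewrite -bME -expgnDr subnKC // ltnW.
have l0fix x : ~ U i x -> ~ U i (phi i x) -> l0 x = x.
  move=> nU nphi; rewrite l0E gVfix ?bK.
    by rewrite gfixU // bK.
  have [[j Uj]|nUj] := pselect (exists j, U j x).
    by apply: (dphi j i); exact: gst'.
  by rewrite gfix' // => j Uj; apply: nUj; exists j.
have cm : (e' i - e i)%N %| m.
  apply: dvdn_trans dm; apply: dvdn_fact; rewrite subn_gt0 lt_ee' /=.
  by rewrite (leq_trans (leq_subr _ _)) // -ltnS ltn_ord.
exists i, (l0 ^+ (m %/ (e' i - e i))); split; first by apply: subX.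
  move=> x Ux; rewrite -[in RHS](divnK cm) mulnC expgnA.
  by apply: (@bX_agree _ (U i)) => // y Uy; exact: sUX.
by move=> x nU nphi; apply: bX_fix; exact: l0fix.
Qed.

(** Suppose that [L] contains no [alt (W i k l)].  For $k < l$ take in [W i k l] the
    elements [u], [v] for a missing 3-cycle, and let [s i k] be the product of the [u]
    of the regions [W i k l] and of the [v] of the regions [W i l k].  For each [k],
    [power_in_confined] gives an index [i] and an element of [L] that acts as a power of
    [s i k] on [U i].  There are more [k] than indices, so two of them, $k < l$, share
    [i]; the commutator of their elements is the missing 3-cycle in [W i k l], since
    the supports meet nowhere else. *)
Lemma confined_core n (U : 'I_n.+1 -> set X)
    (phi : 'I_n.+1 -> 'I_n.+2 -> bijection X)
    (W : 'I_n.+1 -> 'I_n.+2 -> 'I_n.+2 -> set X) L :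
  is_subgroup L ->
  (forall a k, alt setT a -> exists i, L (a^-1 * phi i k * a)) ->
  (forall i j x, U i x -> U j x -> i = j) ->
  (forall i j k x, U i x -> ~ U j (phi j k x)) ->
  (forall i k l x, U i (phi i k x) -> U i (phi i l x) -> k = l) ->
  (forall i k l, open (W i k l)) -> (forall i k l, W i k l `<=` U i) ->
  (forall i k l k' l' x, W i k l x -> W i k' l' x -> k = k' /\ l = l') ->
  exists i k l, alt (W i k l) `<=` L.
Proof.
move=> sL Lphi dU dphi dphi' oW WU dW; apply: contrapT => nW.
pose r := (n.+1)`!; pose m := r.*2.
have r0 : (0 < r)%N := fact_gt0 _.
have dm : (n.+1)`! %| m by rewrite /m -muln2; exact: dvdn_mulr.
have /choice[w wP] : forall ikl : 'I_n.+1 * 'I_n.+2 * 'I_n.+2,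
    exists w : set X * bijection X * bijection X * bijection X * bijection X *
      (set X * set X),
    let: (V, g, h, u, v, (Cu, Cv)) := w in let Wi := W ikl.1.1 ikl.1.2 ikl.2 in
    [/\ cycle_in Wi V g h, ~ L (cycle3 V g h), alt Wi u /\ alt Wi v,
      (forall x, ~ Cu x -> u x = x) /\ (forall x, ~ Cv x -> v x = x) &
      [/\ Cu `<=` Wi, Cv `<=` Wi, Cu `&` Cv `<=` V,
        forall x, V x -> (u ^+ m) x = g x &
        forall x, V x -> (v ^+ m) x = h x]].
  move=> [[i k] l] /=.
  have [|V [g [h [u [v [Cu [Cv wP]]]]]]] :=
      @missing_power_commutator _ _ hX hF (W i k l) L r (oW i k l) sL r0.
    by move=> AW; apply: nW; exists i, k, l.
  by exists (V, g, h, u, v, (Cu, Cv)).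
pose u i k l := (w (i, k, l)).1.1.2; pose v i k l := (w (i, k, l)).1.2.
pose Cu i k l := (w (i, k, l)).2.1; pose Cv i k l := (w (i, k, l)).2.2.
pose V i k l := (w (i, k, l)).1.1.1.1.1; pose g i k l := (w (i, k, l)).1.1.1.1.2.
pose h i k l := (w (i, k, l)).1.1.1.2.
have {}wP i k l : [/\ cycle_in (W i k l) (V i k l) (g i k l) (h i k l),
      ~ L (cycle3 (V i k l) (g i k l) (h i k l)),
      alt (W i k l) (u i k l) /\ alt (W i k l) (v i k l),
      (forall x, ~ Cu i k l x -> u i k l x = x) /\
      (forall x, ~ Cv i k l x -> v i k l x = x) &
      [/\ Cu i k l `<=` W i k l, Cv i k l `<=` W i k l,
        Cu i k l `&` Cv i k l `<=` V i k l,
        forall x, V i k l x -> (u i k l ^+ m) x = g i k l x &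
        forall x, V i k l x -> (v i k l ^+ m) x = h i k l x]].
  have := wP (i, k, l); rewrite /u /v /Cu /Cv /V /g /h.
  by case: (w (i, k, l)) => [[[[[? ?] ?] ?] ?] [? ?]].
(* the factor of [s i k] in the region [W i k' l'] *)
pose b i (k : 'I_n.+2) (kl : 'I_n.+2 * 'I_n.+2) : bijection X :=
  if (kl.1 < kl.2)%N then
    if kl.1 == k then u i kl.1 kl.2 else if kl.2 == k then v i kl.1 kl.2 else 1
  else 1.
pose C i (k : 'I_n.+2) x := exists kl : 'I_n.+2 * 'I_n.+2, (kl.1 < kl.2)%N /\
  ((kl.1 = k /\ Cu i kl.1 kl.2 x) \/ (kl.2 = k /\ Cv i kl.1 kl.2 x)).
pose s i k := gprod (enum {: 'I_n.+2 * 'I_n.+2}) (b i k).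
have bW i k kl x : ~ W i kl.1 kl.2 x -> b i k kl x = x.
  move=> nWx; have [_ _ [Au Av] _ _] := wP i kl.1 kl.2.
  rewrite /b; case: ifP => // _; case: ifP => _; first exact: alt_fix Au nWx.
  by case: ifP => // _; exact: alt_fix Av nWx.
have sE i k : (forall kl x, W i kl.1 kl.2 x -> s i k x = b i k kl x) /\
    (forall x, (forall kl, ~ W i kl.1 kl.2 x) -> s i k x = x).
  have [||kl kl' x Wx Wx'|s1 s2] := @gprod_disjoint _ _
      (enum {: 'I_n.+2 * 'I_n.+2}) (b i k) (fun kl => W i kl.1 kl.2).
  - exact: enum_uniq.
  - exact: bW.
  - have [e1 e2] := dW _ _ _ _ _ _ Wx Wx'.
    by rewrite [LHS]surjective_pairing e1 e2 -surjective_pairing.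
  - split=> [kl x Wx|x nWx]; first by apply: s1 => //; rewrite mem_enum.
    exact: s2.
have Ab i k kl : alt setT (b i k kl).
  have [_ _ [Au Av] _ _] := wP i kl.1 kl.2.
  have sub : W i kl.1 kl.2 `<=` setT by [].
  rewrite /b; case: ifP => _; last exact: alt1.
  case: ifP => _; first exact: (altS sub).
  by case: ifP => _; [exact: (altS sub)|exact: alt1].
have As i k : alt setT (s i k) by apply: gprod_sub (alt_subgroup F setT) _ => kl.
have sC i k x : ~ C i k x -> s i k x = x.
  move=> nC; have [s1 s2] := sE i k.
  have [[kl Wx]|nW'] := pselect (exists kl : 'I_n.+2 * 'I_n.+2, W i kl.1 kl.2 x).
    rewrite (s1 _ _ Wx) /b; case: ifP => // lt_kl.
    have [_ _ _ [u0 v0] _] := wP i kl.1 kl.2.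
    case: eqP => [e|_]; first by apply: u0 => Cx; apply: nC; exists kl; split=> //; left.
    case: eqP => [e|//]; by apply: v0 => Cx; apply: nC; exists kl; split=> //; right.
  by apply: s2 => kl Wx; apply: nW'; exists kl.
have CU i k x : C i k x -> U i x.
  move=> [kl [_ [[_ Cx]|[_ Cx]]]]; have [_ _ _ _ [CuW CvW _ _ _]] := wP i kl.1 kl.2.
    exact/WU/CuW/Cx.
  exact/WU/CvW/Cx.
have /choice[i iP] : forall k, exists i, exists l, [/\ L l,
    forall x, U i x -> l x = (s i k ^+ m) x &
    forall x, ~ U i x -> ~ U i (phi i k x) -> l x = x].
  move=> k; apply: (@power_in_confined n U (phi ^~ k) (s ^~ k) m L) => //.
  - by move=> a Aa; exact: Lphi.
  - by move=> j x nU; apply: sC => /CU.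
  - by move=> i j x; exact: dphi.
have {iP} /choice[l lP] := iP.
have : ~ injective i by move=> /leq_card; rewrite !card_ord ltnn.
move=> /existsNP[k0 /existsNP[k1 /not_implyP[ik /eqP k01]]].
have {k01 ik} [k [k' [lt_kk' ik]]] : exists k k' : 'I_n.+2, (k < k')%N /\ i k = i k'.
  have : (k0 : nat) != k1 by [].
  by rewrite neq_ltn => /orP[lt|lt]; [exists k0, k1|exists k1, k0].
have [Ll l1 l2] := lP k; have [Ll' l1' l2'] := lP k'; rewrite -ik in l1' l2'.
set j := i k in l1 l2 l1' l2'.
have [Vc nL [Au Av] [u0 v0] [CuW CvW CuCv uV vV]] := wP j k k'.
have [_ _ _ d VW] := Vc.
pose Bu x := C j k x \/ U j (phi j k x); pose Bv x := C j k' x \/ U j (phi j k' x).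
have lfix x : ~ Bu x -> l k x = x.
  move=> nB; have [Ux|nU] := pselect (U j x).
    by rewrite l1 // bX_fix // sC // => Cx; apply: nB; left.
  by apply: l2 => // Up; apply: nB; right.
have lfix' x : ~ Bv x -> l k' x = x.
  move=> nB; have [Ux|nU] := pselect (U j x).
    by rewrite l1' // bX_fix // sC // => Cx; apply: nB; left.
  by apply: l2' => // Up; apply: nB; right.
have VU x : V j k k' x -> U j x by move=> /VW[/WU].
have VWj x : V j k k' x -> W j k k' x by move=> /VW[].
have su x : W j k k' x -> s j k x = u j k k' x.
  by move=> Wx; have [s1 _] := sE j k; rewrite (s1 (k, k') x Wx) /b /= lt_kk' eqxx.
have sv x : W j k k' x -> s j k' x = v j k k' x.
  move=> Wx; have [s1 _] := sE j k'; rewrite (s1 (k, k') x Wx) /b /= lt_kk' eqxx.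
  by case: eqP => // e; rewrite e ltnn in lt_kk'.
apply: nL; rewrite -(@cycle3_commutator _ _ _ _ (l k) (l k') Bu Bv d lfix lfix').
- by do !apply: (subM sL); try apply: (subV sL).
- move=> x [[Cx|Ux] [Cx'|Ux']].
  + case: Cx Cx' => [[a a'] [/= lta Ca]] [[c c'] [/= ltc Cc]].
    have Wa : W j a a' x.
      have [_ _ _ _ [CuWa CvWa _ _ _]] := wP j a a'.
      by case: Ca => -[_]; [exact: CuWa|exact: CvWa].
    have Wc : W j c c' x.
      have [_ _ _ _ [CuWa CvWa _ _ _]] := wP j c c'.
      by case: Cc => -[_]; [exact: CuWa|exact: CvWa].
    have [ac ac'] := dW _ _ _ _ _ _ Wa Wc; subst c c'.
    case: Ca => -[ea Ca]; case: Cc => -[ec Cc].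
    * by move: lt_kk'; rewrite -ea -ec ltnn.
    * by subst a a'; exact: CuCv.
    * by move: lt_kk'; rewrite -ea -ec ltnNge ltnW.
    * by move: lt_kk'; rewrite -ea -ec ltnn.
  + by case: (dphi j j k' x (CU _ _ _ Cx)).
  + by case: (dphi j j k x (CU _ _ _ Cx')).
  + by move: lt_kk'; rewrite (dphi' _ _ _ _ Ux Ux') ltnn.
- move=> x Vx; rewrite l1 //; last exact: VU.
  rewrite -uV //; apply: (@bX_agree _ (W j k k')) => //; last exact: VWj.
  by move=> y; exact: alt_stable Au.
- move=> x Vx; rewrite l1' //; last exact: VU.
  rewrite -vV //; apply: (@bX_agree _ (W j k k')) => //; last exact: VWj.
  by move=> y; exact: alt_stable Av.
Qed.

End ConfinedCore.

Section ConfinedRegions.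
Variables (X : topologicalType) (F : set (bijection X)).
Hypotheses (hX : cantor_basics X) (hF : full_dynamics F).
Implicit Types (x y z p q : X) (f g h t a b d : bijection X) (U V W O D : set X).
Implicit Types (L : set (bijection X)).
Let sF := full_subgroup hF.
Local Notation cycle_in := (cycle_in F).
Local Notation alt := (alt F).

Definition conj_set a L : set (bijection X) := [set f | L (a^-1 * f * a)].

Variables (LL : set (set (bijection X))) (n : nat) (f : 'I_n.+1 -> bijection X).
Hypotheses (LLsub : forall L, LL L -> is_subgroup L)
  (LLconj : forall L a, LL L -> alt setT a -> LL (conj_set a L))
  (Ff : forall i, F (f i)) (f_moves : forall i, exists x, f i x <> x)
  (LLf : forall L, LL L -> exists i, L (f i)).

(** To satisfy the hypotheses of [confined_core] with open sets that serve all members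
    of the family, use the elements $d_k f_i d_k^{-1}$, where the $d_k$ fix the germs at
    points $x_i$ moved by $f_i^{-1}$, and send the points $f_i^{-1}(x_i)$ to distinct
    points. *)
Lemma confined_regions : exists (I : finType) (W : I -> set X),
  [/\ forall i, clopen (W i), forall i, W i !=set0 &
    forall L, LL L -> exists i, alt (W i) `<=` L].
Proof.
have [i s|x [xP _ xI]] := @choose_disjoint_family 'I_n.+1 X X
    (fun i x => (f i)^-1 x <> x) (fun i x => [:: x; (f i)^-1 x]) _ [::].
  have [x0 fx0] := f_moves i; have fx1 : (f i)^-1 (f i x0) <> f i x0.
    by rewrite bK; exact/nesym.
  have [U xU UP] := near_apart hX hF (subV sF (Ff i)) (sub1 sF) fx1.
  have [D [cD Dx DU]] := cantor_basis hX xU.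
  have [||y Dy ys] := @open_minus_finite _ hX D (s ++ map (f i) s); first by case: cD.
    by exists (f i x0).
  exists y; first by apply: (UP y y); exact: DU.
  move: ys; rewrite mem_cat negb_or => /andP[ys yfs] z; rewrite !inE => /orP[/eqP ->//|].
  move=> /eqP ->; apply: contra yfs => ys'; apply/mapP; exists ((f i)^-1 y) => //.
  by rewrite bVK.
pose y i := (f i)^-1 (x i).
have xy i j : x i <> y j.
  move=> e; have ij : i = j by apply: (xI i j (x i)); rewrite !inE ?eqxx ?e ?eqxx ?orbT.
  by subst j; apply: (xP i).
have xx i j : x i = x j -> i = j.
  by move=> e; apply: (xI i j (x i)); rewrite !inE ?e eqxx.
have yy i j : y i = y j -> i = j.
  by move=> e; apply: (xI i j (y i)); rewrite !inE ?e /y ?eqxx ?orbT // -/(y i) e eqxx orbT.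
have [ik s|h [hP hs hI]] := @choose_disjoint_family ('I_n.+1 * 'I_n.+2)%type X
    (bijection X) (fun _ h => F h) (fun ik h => [:: h (y ik.1)]) _ (codom x).
  have [|h [Fh _ hs]] := @fresh_translate _ _ hX hF (y ik.1) setT s openT.
    by exists (y ik.1).
  by exists h => // z; rewrite inE => /eqP ->.
pose z i k := h (i, k) (y i).
have zx i j k : z i k <> x j.
  move=> e; have := hs (i, k) (z i k); rewrite inE eqxx => /(_ isT).
  by rewrite e codom_f.
have zz ik ik' : z ik.1 ik.2 = z ik'.1 ik'.2 -> ik = ik'.
  move: ik ik' => [i k] [i' k'] /= e; apply: (hI _ _ (z i k)) => /=.
    by rewrite inE.
  by rewrite e inE.
have /choice[d dP] : forall k : 'I_n.+2, exists d, alt setT d /\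
    (forall i, \forall w \near x i, d w = w) /\
    (forall i, \forall w \near y i, d w = h (i, k) w).
  move=> k.
  pose p (j : 'I_n.+1 + 'I_n.+1) := match j with inl i => x i | inr i => y i end.
  pose g (j : 'I_n.+1 + 'I_n.+1) : bijection X :=
    match j with inl i => 1 | inr i => h (i, k) end.
  have [|||[i|i] [j|j] /=|[i|i] [j|j] /=|d Ad dP] :=
      @alt_prescribed _ _ hX hF setT _ openT p g => //.
  - by case=> [i|i]; [exact: (sub1 sF)|exact: hP].
  - by move=> /xx ->.
  - by move=> /xy.
  - by move=> /esym/xy.
  - by move=> /yy ->.
  - by move=> /xx ->.
  - by move=> /esym/zx.
  - by move=> /zx.
  - by move=> e; have [->] := zz (i, k) (j, k) e.
  - by exists d; split=> //; split=> i; [exact: (dP (inl i))|exact: (dP (inr i))].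
pose phi i k := d k * f i * (d k)^-1.
have Fd k : F (d k) by have [/(alt_full hF)] := dP k.
have Fphi i k : F (phi i k).
  by apply: (subM sF); [exact: (subM sF)|exact: (subV sF)].
have phix i k : (phi i k)^-1 (x i) = z i k.
  have [_ [dx dy]] := dP k; rewrite /phi !invgM invgK !bME.
  have -> : (d k)^-1 (x i) = x i.
    by apply: (@b_inj _ (d k)); rewrite bVK (nbhs_singleton (dx i)).
  by rewrite -/(y i) (nbhs_singleton (dy i)).
pose J := ('I_n.+1 + 'I_n.+1 * 'I_n.+2)%type.
pose pt (j : J) := match j with inl i => x i | inr ik => z ik.1 ik.2 end.
have [|[i|ik] [j|jk] /=|D [cD Dpt _ DI]] :=
    @separate_points _ hX J pt (fun=> setT).
- by move=> j; exact: filterT.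
- by move=> /xx ->.
- by move=> /esym/zx.
- by move=> /zx.
- by move=> /zz ->.
have /choice[U UP] : forall i, exists U, [/\ clopen U, U (x i), U `<=` D (inl i) &
    forall k u, U u -> D (inr (i, k)) ((phi i k)^-1 u)].
  move=> i; have Dn j : nbhs (pt j) (D j) by apply: open_nbhs_nbhs; case: (cD j).
  have n2 : \forall u \near x i, forall k, D (inr (i, k)) ((phi i k)^-1 u).
    apply: filter_forall => k; apply: (full_nbhs hF (subV sF (Fphi i k))).
    by rewrite phix; exact: (Dn (inr (i, k))).
  have [U [cU Ux UD]] := cantor_basis hX (filterI (Dn (inl i)) n2).
  by exists U; split=> // [u /UD[]|k u /UD[_]].
have UD i u : U i u -> D (inl i) u by have [_ _ + _] := UP i; exact.
have UD' i k u : U i (phi i k u) -> D (inr (i, k)) u.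
  by have [_ _ _ H] := UP i; move=> /(H k); rewrite bK.
(* The regions are disjoint neighbourhoods of distinct points of the [U i]. *)
have [j s|w [wU _ wI]] := @choose_disjoint_family ('I_n.+1 * 'I_n.+2 * 'I_n.+2)%type
    X X (fun j w => U j.1.1 w) (fun _ w => [:: w]) _ [::].
  have [cU Ux _ _] := UP j.1.1.
  have [||v Uv vs] := @open_minus_finite _ hX (U j.1.1) s; first by case: cU.
    by exists (x j.1.1).
  by exists v => // u; rewrite inE => /eqP ->.
have [j|i j e|W [cW Ww WU WI]] := @separate_points _ hX _ w (fun j => U j.1.1).
- by apply: open_nbhs_nbhs; split; [have [[]] := UP j.1.1|exact: wU].
- by apply: (wI i j (w i)); rewrite inE ?e.
exists ('I_n.+1 * 'I_n.+2 * 'I_n.+2)%type, W; split=> // [j|L LL_L].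
  by exists (w j).
have [|||||||i [k [l WL]]] := @confined_core _ _ hX hF n U phi
    (fun i k l => W (i, k, l)) L (LLsub LL_L); last by exists (i, k, l).
- move=> a k Aa.
  have [Ad _] := dP k.
  have A' : alt setT ((d k)^-1 * a).
    by apply: (subM (alt_subgroup F setT)) => //; apply: subV => //; exact: alt_subgroup.
  have [i Li] := LLf (LLconj LL_L A').
  exists i; move: Li; rewrite /conj_set /phi /mkset invgM invgK !mulgA.
  by rewrite -!mulgA.
- by move=> i j u /UD Di /UD Dj; have [] := DI _ _ _ Di Dj.
- by move=> i j k u /UD Di /UD' Dj; have := DI _ _ _ Di Dj.
- by move=> i k l u /UD' Di /UD' Dj; have [] := DI _ _ _ Di Dj.
- by move=> i k l; case: (cW (i, k, l)).
- by move=> i k l; exact: (WU (i, k, l)).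
- by move=> i k l k' l' u Wi Wj; have [-> ->] := WI _ _ _ Wi Wj.
Qed.

End ConfinedRegions.

(** * The finite set of bad points of a confined subgroup *)

Section BadPoints.
Variables (X : topologicalType) (F : set (bijection X)).
Hypotheses (hX : cantor_basics X) (hF : full_dynamics F).
Implicit Types (x y z p q : X) (f g h t a b d : bijection X) (U V W O D : set X).
Implicit Types (L : set (bijection X)).
Let sF := full_subgroup hF.
Local Notation cycle_in := (cycle_in F).
Local Notation alt := (alt F).

(** For the group of the elements that are trivial near a finite set, this is the
    finite set; it is defined without choices, so it is equivariant. *)
Definition bad_points L : set X :=
  [set x | ~ exists W, [/\ clopen W, W x & alt W `<=` L]].

Lemma bad_points_conj L a x : F a -> bad_points (conj_set a L) (a x) <-> bad_points L x.
Proof.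
move=> Fa; have Fa' := subV sF Fa; split=> nW [W [cW Wx WL]]; apply: nW.
  exists (translate a W); rewrite translateE; split=> //.
    exact: (clopen_translate hF).
  move=> b Ab; apply: WL; have := altJ_sub hF Fa' _ Ab; rewrite invgK; apply.
  by move=> y.
exists (translate a^-1 W); split; first exact: (clopen_translate hF).
  by rewrite /translate /mkset invgK.
move=> b Ab; have /WL : alt W (a * b * a^-1).
  by apply: (altJ_sub hF Fa _ Ab) => y; rewrite /translate /mkset invgK.
by rewrite /conj_set /mkset !mulgA mulVg mul1g mulgVK.
Qed.

(** [alt_trivial_germ] at one point after the other. *)
Lemma alt_trivial_on_finite a (s : seq X) : alt setT a ->
  (forall q, q \in s -> \forall z \near q, a z = z) -> alt (~` [set` s]) a.
Proof.
move=> Aa; elim: s => [_|q s IH sa]; first by apply: altS Aa.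
have A1 : alt (~` [set` s]) a by apply: IH => p ps; apply: sa; rewrite inE ps orbT.
have [qs|qs] := boolP (q \in s).
  by apply: altS A1 => x nx /=; rewrite inE => /orP[/eqP xq|//]; apply: nx; rewrite /= xq.
have oW : open (~` [set` s]).
  by apply: closed_openC; apply: (finite_closed hX); exact: finite_seq.
have aq : \forall z \near q, a z = z by apply: sa; rewrite inE eqxx.
have := alt_trivial_germ hX hF oW (negP qs) A1 aq.
by apply: altS => x [nx xq] /=; rewrite inE => /orP[/eqP|].
Qed.

Lemma small_set_seq (Q : set X) N :
  ~ (exists s : seq X, [/\ uniq s, size s = N & forall x, x \in s -> Q x]) ->
  exists s : seq X, [/\ uniq s, (size s < N)%N & forall x, Q x <-> x \in s].
Proof.
move=> nN; suff /(_ N) [//|] : forall k,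
    (exists s : seq X, [/\ uniq s, size s = k & forall x, x \in s -> Q x]) \/
    (exists s : seq X, [/\ uniq s, (size s < k)%N & forall x, Q x <-> x \in s]).
  by [].
elim=> [|k [[s [us sk sQ]]|[s [us sk sQ]]]].
- by left; exists [::].
- have [[x [Qx xs]]|n] := pselect (exists x, Q x /\ x \notin s).
    left; exists (x :: s); rewrite /= xs us sk; split=> // z.
    by rewrite inE => /orP[/eqP ->|/sQ].
  right; exists s; rewrite sk; split=> // x; split=> [Qx|/sQ//].
  by apply: contrapT => /negP xs; apply: n; exists x.
- by right; exists s; split=> //; rewrite (leq_trans sk).
Qed.

Lemma move_into W O p (s : seq X) : open W -> W p -> open O -> (W `&` O) !=set0 ->
  p \notin s -> exists c, [/\ alt W c, O (c p), c p \notin s &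
    forall y, y \in s -> \forall z \near y, c z = z].
Proof.
move=> oW Wp oO WO0 ps.
have [g [Fg [Wg Og] gs]] := fresh_translate hX hF p (p :: s) (openI oW oO) WO0.
move: gs; rewrite inE negb_or => /andP[/eqP gp gs].
have Wn0 : W !=set0 by exists p.
have [h [Fh Wh hs]] := fresh_translate hX hF p (p :: g p :: s) oW Wn0.
move: hs; rewrite !inE !negb_or => /and3P[/eqP hp /eqP hg hs].
have [||||y ys|V [Vc Vp _ Vs]] := @small_cycle _ _ hX hF W p g h s setT oW Fg Fh Wp Wg Wh.
- exact/nesym.
- exact/nesym.
- exact/nesym.
- exact: filterT.
- by split=> e; [move: ps|move: gs|move: hs]; rewrite -e ys.
exists (cycle3 V g h); have [_ _ _ d _] := Vc.
by rewrite cycle3B //; split=> //; exact: alt_cycle.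
Qed.

Variables (LL : set (set (bijection X))) (I : finType) (W : I -> set X).
Hypotheses (LLsub : forall L, LL L -> is_subgroup L)
  (LLconj : forall L a, LL L -> alt setT a -> LL (conj_set a L))
  (cW : forall i, clopen (W i)) (W0 : forall i, W i !=set0)
  (LLW : forall L, LL L -> exists i, alt (W i) `<=` L).

(** Some [a] moves all the points [q j] into their regions; the conjugate of [L] by [a]
    contains the alternating group of one of the regions. *)
Lemma good_set_through (J : finType) (r : J -> I) (q : J -> X) L : LL L ->
  (forall i j, q i = q j -> i = j) ->
  exists i W', [/\ clopen W', alt W' `<=` L & forall j, r j = i -> W' (q j)].
Proof.
move=> LL_L qI; have oW i : open (W i) by case: (cW i).
have [j s|g [gP _ gI]] := @choose_disjoint_family J X (bijection X)
    (fun j g => F g /\ W (r j) (g (q j))) (fun j g => [:: g (q j)]) _ [::].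
  have [g [Fg Wg gs]] := fresh_translate hX hF (q j) s (oW (r j)) (W0 (r j)).
  by exists g => // x; rewrite inE => /eqP ->.
have Fg j : F (g j) by have [] := gP j.
have gqI i j : g i (q i) = g j (q j) -> i = j.
  by move=> e; apply: (gI i j (g i (q i))); rewrite inE ?e.
have [a Aa aP] :=
  @alt_prescribed _ _ hX hF setT J openT q g Fg (fun=> Logic.I) (fun=> Logic.I) qI gqI.
have Fa := alt_full hF Aa; have [i Wi] := LLW (LLconj LL_L Aa).
exists i, (translate a^-1 (W i)); split.
- exact: (clopen_translate hF (subV sF Fa)).
- move=> b Ab; have /Wi : alt (W i) (a * b * a^-1).
    by apply: (altJ_sub hF Fa _ Ab) => y; rewrite /translate /mkset invgK.
  by rewrite /conj_set /mkset !mulgA mulVg mul1g mulgVK.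
- move=> j rj; rewrite /translate /mkset invgK (nbhs_singleton (aP j)) -rj.
  by have [] := gP j.
Qed.

(** With one bad point for each region, [good_set_through] would give a good
    neighbourhood of one of them. *)
Lemma bad_points_small L : LL L -> exists s : seq X,
  [/\ uniq s, (size s < #|I|)%N & forall x, bad_points L x <-> x \in s].
Proof.
move=> LL_L; apply: small_set_seq => -[s [us sI sQ]].
have [x0|nX] := pselect (exists x : X, True); last first.
  have : (0 < #|I|)%N by have [i _] := LLW LL_L; apply/card_gt0P; exists i.
  by rewrite -sI; case: (s) nX => // x s' []; exists x.
case: x0 => x0 _; pose q (i : I) := nth x0 s (enum_rank i).
have lt_s (i : I) : (enum_rank i < size s)%N by rewrite sI.
have [|i [W' [cW' W'L W'q]]] := @good_set_through I id q L LL_L.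
  move=> i j /eqP; rewrite nth_uniq // => /eqP/val_inj; exact: enum_rank_inj.
have := sQ (q i) (mem_nth _ (lt_s i)); apply; exists W'; split=> //.
exact: W'q.
Qed.

(** The three points of a 3-cycle away from the bad points have good neighbourhoods.
    Elements of [L] supported there move them into one good set that meets all three
    neighbourhoods, and there the conjugated 3-cycle lies in [L].  Such a good set comes
    from [good_set_through], with points of all three neighbourhoods for each region. *)
Lemma good_cycle L V g h : LL L -> cycle_in (~` bad_points L) V g h ->
  L (cycle3 V g h).
Proof.
move=> LL_L Vc; have sL := LLsub LL_L.
apply: (cycle_local hX sL Vc) => x Vx; have [cV Fg Fh d VQ] := Vc.
have good y : (~` bad_points L) y -> exists W', [/\ clopen W', W' y & alt W' `<=` L].
  by move=> ny; apply: contrapT => n; apply: ny.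
have [/good[Wx [cWx Wxx WxL]] /good[Wy [cWy Wyy WyL]] /good[Wz [cWz Wzz WzL]]] := VQ x Vx.
have [n1 n2 n3] := d x x Vx Vx.
pose Wc (c : 'I_3) := match (c : nat) with 0 => Wx | 1 => Wy | _ => Wz end.
have [j s|q [qP _ qI]] := @choose_disjoint_family (I * 'I_3)%type X X
    (fun j p => Wc j.2 p) (fun _ p => [:: p]) _ [::].
  have [||v Wv vs] := @open_minus_finite _ hX (Wc j.2) s.
  - by rewrite /Wc; case: (j.2 : nat) => [|[|]] *; [case: cWx|case: cWy|case: cWz].
  - by rewrite /Wc; case: (j.2 : nat) => [|[|]] *; [exists x|exists (g x)|exists (h x)].
  - by exists v => // u; rewrite inE => /eqP ->.
have [|i [W' [cW' W'L W'q]]] := @good_set_through (I * 'I_3)%type fst q L LL_L.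
  by move=> j k e; apply: (qI j k (q j)); rewrite inE ?e.
have meet (c : 'I_3) : (Wc c `&` W') !=set0.
  by exists (q (i, c)); split; [exact: (qP (i, c))|exact: W'q].
have oW' : open W' by case: cW'.
have meet0 := meet (inord 0); have meet1 := meet (inord 1); have meet2 := meet (inord 2).
rewrite /Wc !inordK // in meet0 meet1 meet2.
have [|c1 [A1 W1 s1 f1]] := move_into (s := [:: g x; h x]) cWx.1 Wxx oW' meet0.
  by rewrite !inE negb_or; apply/andP; split; exact/eqP.
rewrite !inE negb_or in s1; have /andP[/eqP m1 /eqP m2] := s1.
have [|c2 [A2 W2 s2 f2]] := move_into (s := [:: c1 x; h x]) cWy.1 Wyy oW' meet1.
  by rewrite !inE negb_or; apply/andP; split; apply/eqP => //; exact/nesym.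
rewrite !inE negb_or in s2; have /andP[/eqP m3 /eqP m4] := s2.
have [|c3 [A3 W3 s3 f3]] := move_into (s := [:: c1 x; c2 (g x)]) cWz.1 Wzz oW' meet2.
  by rewrite !inE negb_or; apply/andP; split; apply/eqP; exact/nesym.
pose c := c3 * (c2 * c1).
have Lc : L c by apply: (subM sL); [exact: WzL|apply: (subM sL); [exact: WyL|exact: WxL]].
have Fc : F c.
  by do !apply: (subM sF); [exact: alt_full A3|exact: alt_full A2|exact: alt_full A1].
have fix1 (a : bijection X) (s : seq X) y :
    (forall y, y \in s -> \forall z \near y, a z = z) -> y \in s -> a y = y.
  by move=> H /H/nbhs_singleton.
have cx : W' (c x).
  by rewrite /c !bME (fix1 _ _ _ f2) ?inE ?eqxx // (fix1 _ _ _ f3) ?inE ?eqxx.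
have cy : W' (c (g x)).
  rewrite /c !bME (fix1 _ _ (g x) f1) ?inE ?eqxx //.
  by rewrite (fix1 _ _ _ f3) ?inE ?eqxx ?orbT.
have cz : W' (c (h x)).
  rewrite /c !bME (fix1 _ _ (h x) f1) ?inE ?eqxx ?orbT //.
  by rewrite (fix1 _ _ (h x) f2) ?inE ?eqxx ?orbT.
have nW y : W' y -> nbhs y W' by move=> ?; exact: open_nbhs_nbhs.
exists ([set w | W' (c w)] `&` ([set w | W' (c (g w))] `&` [set w | W' (c (h w))])).
  apply: filterI; first by apply: (full_nbhs hF Fc); exact: nW.
  apply: filterI; first by apply: (full_nbhs hF (subM sF Fc Fg)); exact: nW.
  by apply: (full_nbhs hF (subM sF Fc Fh)); exact: nW.
move=> U cU UVO; have Uc : cycle_in [set w | W' (c w)] U g h.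
  by split=> // [|w /UVO[_ [? []]]] //; apply: disjoint_translatesS d => w /UVO[].
have /W'L Lcc : alt W' (c * cycle3 U g h * c^-1).
  by apply: (altJ_sub hF Fc _ (alt_cycle Uc)).
by apply: (subMl sL Lc); apply: (subMr sL (subV sL Lc)).
Qed.

Lemma alt_off_bad_points L : LL L -> alt (~` bad_points L) `<=` L.
Proof.
by move=> LL_L; apply: (alt_sub (LLsub LL_L)) => V g h; exact: good_cycle.
Qed.

End BadPoints.

(** The bound is the number of regions of [confined_regions].  The 3-cycles off the bad
    points lie in [L] by [good_cycle], and they generate all elements with trivial germs
    at the bad points by [alt_trivial_on_finite]. *)
Theorem confined_subgroups (X : topologicalType) (F : set (bijection X))
    (LL : set (set (bijection X))) n (f : 'I_n.+1 -> bijection X) :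
  cantor_basics X -> full_dynamics F ->
  (forall L, LL L -> is_subgroup L) ->
  (forall L a, LL L -> alt F setT a -> LL (conj_set a L)) ->
  (forall i, F (f i)) -> (forall i, exists x, f i x <> x) ->
  (forall L, LL L -> exists i, L (f i)) ->
  exists N, forall L, LL L -> exists s : seq X,
    [/\ uniq s, (size s <= N)%N, forall x, bad_points F L x <-> x \in s,
      alt F (~` bad_points F L) `<=` L &
      forall a, alt F setT a ->
        (forall q, q \in s -> \forall z \near q, a z = z) -> L a].
Proof.
move=> hX hF LLsub LLconj Ff fm LLf.
have [I [W [cW W0 LLW]]] := confined_regions hX hF LLsub LLconj Ff fm LLf.
exists #|I| => L LL_L.
have [s [us sI sQ]] := bad_points_small hX hF LLconj cW W0 LLW LL_L.
have AL := alt_off_bad_points hX hF LLsub LLconj cW W0 LLW LL_L.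
exists s; split=> // [|a Aa sa]; first exact: ltnW.
apply: AL; have := alt_trivial_on_finite hX hF Aa sa.
by apply: altS => x nx /sQ.
Qed.

(** * Finite sets that are invariant under a local alternating group *)

(** Near a point of [W], [r + 1] elements have distinct values everywhere, so that a set
    of at most [r] points preserved by them has no point there; [W] is compact. *)
Lemma alt_no_small_invariant (X : topologicalType) (F : set (bijection X))
    (W : set X) r : cantor_basics X -> full_dynamics F -> clopen W ->
  exists ss : seq (bijection X), (forall a, a \in ss -> alt F W a) /\
    forall t : seq X, (size t <= r)%N ->
      (forall a x, a \in ss -> x \in t -> a x \in t) ->
      forall x, x \in t -> ~ W x.
Proof.
move=> hX hF cW; have oW : open W by case: cW.
apply: (@compact_union_induction _ W (fun A => exists ss : seq (bijection X),
  (forall a, a \in ss -> alt F W a) /\ forall t : seq X, (size t <= r)%N ->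
    (forall a x, a \in ss -> x \in t -> a x \in t) -> forall x, x \in t -> ~ A x)).
- exact: (compact_clopen hX).
- by exists [::]; split=> // t _ _ x _ [].
- move=> A B AB [ss [ssW ssP]]; exists ss; split=> // t tr st x xt /AB.
  exact: (ssP t tr st x xt).
- move=> A B [ss [ssW ssP]] [ss' [ssW' ssP']]; exists (ss ++ ss'); split.
    by move=> a; rewrite mem_cat => /orP[/ssW|/ssW'].
  move=> t tr st x xt [].
    by apply: (ssP t tr) xt => a y ays; apply: st; rewrite mem_cat ays.
  by apply: (ssP' t tr) xt => a y ays; apply: st; rewrite mem_cat ays orbT.
move=> x Wx; have W0 : W !=set0 by exists x.
have [j s|k [kP ks kI]] := @choose_disjoint_family 'I_r.+1 X (bijection X)
    (fun _ k => F k /\ W (k x)) (fun _ k => [:: k x]) _ [:: x].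
  have [k [Fk Wk nk]] := fresh_translate hX hF x s oW W0.
  by exists k => // y; rewrite inE => /eqP ->.
have kx j : k j x <> x.
  by move=> e; have := ks j (k j x); rewrite !inE eqxx => /(_ isT) /eqP.
have /choice[a aP] : forall j, exists a, alt F W a /\ a x = k j x.
  move=> j; have [Fk Wk] := kP j.
  have [h [Fh Wh]] := fresh_translate hX hF x [:: x; k j x] oW W0.
  rewrite !inE !negb_or => /andP[/eqP h1 /eqP h2].
  have [||||//|V [Vc Vx _ _]] := @small_cycle _ _ hX hF W x (k j) h [::] setT oW
    Fk Fh Wx Wk Wh; [exact/nesym|exact/nesym|exact/nesym|exact: filterT|].
  exists (cycle3 V (k j) h); split; first exact: alt_cycle.
  by have [_ _ _ d _] := Vc; rewrite cycle3B.
have Fa j : F (a j) by have [/(alt_full hF)] := aP j.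
have aI (i j : 'I_r.+1) : i != j -> a i x <> a j x.
  have [_ ->] := aP i; have [_ ->] := aP j; move=> /eqP ij e; apply: ij.
  by apply: (kI i j (k i x)); rewrite inE ?e.
have /choice[U UP] : forall ij : 'I_r.+1 * 'I_r.+1, exists U, nbhs x U /\
    (ij.1 != ij.2 -> forall z, U z -> a ij.1 z <> a ij.2 z).
  move=> [i j] /=; have [ij|ij] := eqVneq i j.
    by exists setT; split=> //; exact: filterT.
  have [U xU UP] := near_apart hX hF (Fa i) (Fa j) (aI _ _ ij).
  by exists U; split=> // _ z Uz; exact: UP.
exists [set z | forall ij, U ij z].
  by apply: filter_forall => ij; have [] := UP ij.
exists (codom a); split=> [_ /codomP[j ->]|t tr st z zt Uz]; first by have [] := aP j.
have : {subset codom (fun j => a j z) <= t}.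
  by move=> _ /codomP[j ->]; apply: st => //; exact: codom_f.
have /uniq_leq_size/[apply] : uniq (codom (fun j => a j z)).
  apply/injectiveP => i j e; apply: contrapT => /eqP ij.
  by have [_ /(_ ij z (Uz _))] := UP (i, j).
by rewrite size_codom card_ord leqNgt ltnS tr.
Qed.

(** * Etale groupoids: bisections and germs *)

Section GroupoidAlgebra.
Variables (X : topologicalType) (G : groupoid X).
Implicit Types (a b c : G) (T S g h : set G).

Lemma gmulK a b : gsrc a = grng b -> gmul (gmul a b) (ginv b) = a.
Proof.
by move=> ab; rewrite -gmulA ?grng_inv // gmulV -ab gmul1.
Qed.

Lemma gmulVK a b : gsrc a = gsrc b -> gmul (gmul a (ginv b)) b = a.
Proof.
by move=> ab; rewrite -gmulA ?gsrc_inv ?grng_inv // gVmul -ab gmul1.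
Qed.

Lemma gmulKl a b : gsrc a = grng b -> gmul (ginv a) (gmul a b) = b.
Proof.
by move=> ab; rewrite gmulA ?gsrc_inv // gVmul ab g1mul.
Qed.

Lemma ginv_uniq a b : gsrc a = grng b -> gmul a b = gunit G (gsrc b) -> a = ginv b.
Proof.
move=> ab e; rewrite -(gmulK ab) e -[gsrc b]grng_inv; exact: g1mul.
Qed.

Lemma ginvK a : ginv (ginv a) = a.
Proof. by apply/esym/ginv_uniq; rewrite ?grng_inv // gmulV gsrc_inv. Qed.

Lemma ginv_unit x : ginv (gunit G x) = gunit G x.
Proof.
apply/esym/ginv_uniq; rewrite ?gsrc_unit ?grng_unit //.
by rewrite -{2}(gsrc_unit G x) gmul1.
Qed.

Lemma unit_mull x b : grng b = x -> gmul (gunit G x) b = b.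
Proof. by move=> <-; exact: g1mul. Qed.

Lemma unit_mulr a x : gsrc a = x -> gmul a (gunit G x) = a.
Proof. by move=> <-; exact: gmul1. Qed.

Lemma set_mulA T S R : set_mul T (set_mul S R) = set_mul (set_mul T S) R.
Proof.
apply/seteqP; split=> d.
  move=> [a [_ [Ta [b [c [Sb Rc bc ->]]] abc ->]]].
  have ab : gsrc a = grng b by rewrite abc grng_mul.
  exists (gmul a b), c; split; rewrite ?gsrc_mul ?gmulA //.
  by exists a, b.
move=> [_ [c [[a [b [Ta Sb ab ->]]] Rc abc ->]]].
have bc : gsrc b = grng c by rewrite -abc gsrc_mul.
exists a, (gmul b c); split; rewrite ?grng_mul ?gmulA //.
by exists b, c.
Qed.

Lemma set_mul1 T : set_mul T (unit_space G) = T.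
Proof.
apply/seteqP; split=> c.
  by move=> [a [_ [Ta [x _ <-] ax ->]]]; rewrite unit_mulr // ax grng_unit.
move=> Tc; exists c, (gunit G (gsrc c)); split; rewrite ?grng_unit ?gmul1 //.
by exists (gsrc c).
Qed.

Lemma set_1mul T : set_mul (unit_space G) T = T.
Proof.
apply/seteqP; split=> c.
  by move=> [_ [b [[x _ <-] Tb xb ->]]]; rewrite unit_mull // -xb gsrc_unit.
move=> Tc; exists (gunit G (grng c)), c; split; rewrite ?gsrc_unit ?g1mul //.
by exists (grng c).
Qed.

Lemma set_invE T a : set_inv T a <-> T (ginv a).
Proof.
split=> [[b Tb <-]|Ta]; first by rewrite ginvK.
by exists (ginv a) => //; rewrite ginvK.
Qed.

Definition src_inj T := forall a b, T a -> T b -> gsrc a = gsrc b -> a = b.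
Definition rng_inj T := forall a b, T a -> T b -> grng a = grng b -> a = b.

Lemma homeo_on_inj (S' R' : topologicalType) (U : set S') (f : S' -> R') (a b : S') :
  homeo_on U f -> U a -> U b -> f a = f b -> a = b.
Proof.
move=> [k [fk _ _]] Ua Ub e.
by rewrite -(fk a) ?inE // e fk ?inE.
Qed.

Lemma bisection_src T : bisection T -> src_inj T.
Proof. by move=> [_ h _] a b; exact: homeo_on_inj. Qed.

Lemma bisection_rng T : bisection T -> rng_inj T.
Proof. by move=> [_ _ h] a b; exact: homeo_on_inj. Qed.

Lemma germE T a : src_inj T -> T a -> germ T (gsrc a) = a.
Proof.
move=> sT Ta; rewrite /germ; case: xgetP => [b _ [Tb]|/(_ a)[]//].
exact: sT.
Qed.

Lemma set_mul_src_inj T S : src_inj T -> src_inj S -> src_inj (set_mul T S).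
Proof.
move=> sT sS _ _ [a [b [Ta Sb ab ->]]] [a' [b' [Ta' Sb' ab' ->]]].
rewrite !gsrc_mul // => /(sS _ _ Sb Sb') bb'; subst b'.
by rewrite (sT a a') // ab ab'.
Qed.

Lemma set_mul_rng_inj T S : rng_inj T -> rng_inj S -> rng_inj (set_mul T S).
Proof.
move=> rT rS _ _ [a [b [Ta Sb ab ->]]] [a' [b' [Ta' Sb' ab' ->]]].
rewrite !grng_mul // => /(rT _ _ Ta Ta') aa'; subst a'.
by rewrite (rS b b') // -ab -ab'.
Qed.

End GroupoidAlgebra.

Lemma local_homeo_continuous (R S : topologicalType) (f : R -> S) :
  local_homeo f -> continuous f.
Proof.
move=> lf x; have [U [oU Ux _ [k [_ cf _]]]] := lf x.
by have := cf; rewrite (continuous_open_subspace _ oU) => /(_ x); apply; rewrite inE.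
Qed.

Lemma homeo_on_open_inj (R S : topologicalType) (f : R -> S) (U : set R) (d : S -> R) :
  continuous f -> open_map f -> open U ->
  (forall a b : R, U a -> U b -> f a = f b -> a = b) -> homeo_on U f.
Proof.
move=> cf of_ oU fI.
pose k y := xget (d y) [set a | U a /\ f a = y].
have kf a : U a -> k (f a) = a.
  move=> Ua; rewrite /k; case: xgetP => [b _ [Ub]|/(_ a)[]//]; exact: fI.
exists k; split.
- by move=> a; rewrite inE => /kf.
- exact: continuous_subspaceT.
- rewrite (continuous_open_subspace _ (of_ _ oU)) => y.
  rewrite inE => -[a Ua <-] B; rewrite kf // => aB.
  have [ O [oO Oa OB]] : exists O, [/\ open O, O a & O `<=` B].
    by move: aB; rewrite nbhsE => -[ O [oO Oa] OB]; exists O.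
  have : nbhs (f a) (f @` (U `&` O)).
    apply: open_nbhs_nbhs; split; first exact/of_/openI.
    by exists a.
  by apply: filterS => _ [b [Ub Ob] <-] /=; rewrite kf //; exact: OB.
Qed.

Section FullGroup.
Variables (X : topologicalType) (G : groupoid X).
Implicit Types (a b c : G) (T S g h : set G) (x y : X).

Lemma full_src g : full_group G g -> src_inj g.
Proof. by move=> [/bisection_src]. Qed.
Lemma full_rng g : full_group G g -> rng_inj g.
Proof. by move=> [/bisection_rng]. Qed.

Lemma germ_in g x : full_group G g -> g (germ g x) /\ gsrc (germ g x) = x.
Proof.
move=> [/bisection_src sg gs _]; have : ((@gsrc X G) @` g) x by rewrite gs.
by move=> [a ga <-]; rewrite germE.
Qed.

Lemma germ_full g a : full_group G g -> g a -> germ g (gsrc a) = a.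
Proof. by move=> /full_src; exact: germE. Qed.

Lemma germ_uniq g a x : full_group G g -> g a -> gsrc a = x -> germ g x = a.
Proof. by move=> Fg ga <-; exact: germ_full. Qed.

Lemma full_groupP g c : full_group G g -> g c <-> germ g (gsrc c) = c.
Proof.
move=> Fg; split; first exact: germ_full.
by move=> <-; have [] := germ_in (gsrc c) Fg.
Qed.

Lemma full_eq g h : full_group G g -> full_group G h ->
  (forall x, germ g x = germ h x) -> g = h.
Proof.
move=> Fg Fh e; apply/seteqP; split=> a.
  by move=> /(full_groupP a Fg) ga; apply/(full_groupP a Fh); rewrite -e.
by move=> /(full_groupP a Fh) ha; apply/(full_groupP a Fg); rewrite e.
Qed.

(** The homeomorphism of the unit space induced by an element of the full group; the
    identity is a dummy value. *)
Definition bact g : bijection X :=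
  xget 1 [set f : bijection X | forall a, g a -> f (gsrc a) = grng a].

Lemma bactE g a : full_group G g -> g a -> bact g (gsrc a) = grng a.
Proof.
move=> Fg; rewrite /bact; case: xgetP => [f _|n]; first exact.
exfalso; have [Bg gs gr] := Fg.
pose f x := grng (germ g x).
have rP x : exists a, g a /\ grng a = x.
  have : ((@grng X G) @` g) x by rewrite gr.
  by move=> [b gb <-]; exists b.
pose k x := gsrc (sval (cid (rP x))).
have fK : cancel f k.
  move=> x; rewrite /k; case: cid => b [gb bx] /=; have [gx xx] := germ_in x Fg.
  by rewrite -[RHS]xx; congr gsrc; apply: (full_rng Fg).
have kK : cancel k f.
  by move=> x; rewrite /k; case: cid => b [gb bx] /=; rewrite /f germ_full.
by apply: (n (Bijection fK kK)) => b gb /=; rewrite /f germ_full.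
Qed.

Lemma grng_germ g x : full_group G g -> grng (germ g x) = bact g x.
Proof. by move=> Fg; have [gx {2}<-] := germ_in x Fg; rewrite bactE. Qed.

Lemma gsrc_germ g x : full_group G g -> gsrc (germ g x) = x.
Proof. by move=> Fg; have [] := germ_in x Fg. Qed.

Lemma bact_uniq g (f : bijection X) : full_group G g ->
  (forall a, g a -> f (gsrc a) = grng a) -> bact g = f.
Proof.
move=> Fg fP; apply: bijP => x; have [gx xx] := germ_in x Fg.
by rewrite -grng_germ // -(fP _ gx) xx.
Qed.

End FullGroup.

Section Etale.
Variables (X : topologicalType) (G : groupoid X).
Hypothesis eG : etale G.
Implicit Types (a b c : G) (T S g h : set G) (x y : X) (U V O : set X).

Lemma gsrc_continuous : continuous (@gsrc X G).
Proof. by have [_ /local_homeo_continuous] := etale_src eG. Qed.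

Lemma grng_continuous : continuous (@grng X G).
Proof. by have [_ /local_homeo_continuous] := etale_rng eG. Qed.

Lemma open_gsrc U : open U -> open [set a : G | U (gsrc a)].
Proof. by move/continuousP: gsrc_continuous => /[apply]. Qed.

Lemma open_grng U : open U -> open [set a : G | U (grng a)].
Proof. by move/continuousP: grng_continuous => /[apply]. Qed.

Lemma open_bisection_at a : exists T, [/\ open T, T a, src_inj T & rng_inj T].
Proof.
have [_ /(_ a)[T [oT Ta _ hT]]] := etale_src eG.
have [_ /(_ a)[S [oS Sa _ hS]]] := etale_rng eG.
exists (T `&` S); split; [exact: openI|by []| |].
- by move=> b c [Tb _] [Tc _]; exact: homeo_on_inj hT _ _.
- by move=> b c [_ Tb] [_ Tc]; exact: homeo_on_inj hS _ _.
Qed.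

Lemma bisectionI T : open T -> src_inj T -> rng_inj T -> bisection T.
Proof.
move=> oT sT rT; split=> //.
- apply: (@homeo_on_open_inj _ _ _ _ (@gunit X G)) => //.
  + exact: gsrc_continuous.
  + by case: (etale_src eG).
- apply: (@homeo_on_open_inj _ _ _ _ (@gunit X G)) => //.
  + exact: grng_continuous.
  + by case: (etale_rng eG).
Qed.

(** Near a unit, an arrow and the unit at its source lie in a common set on which the
    source is injective. *)
Lemma open_unit_space : open (unit_space G).
Proof.
rewrite openE => _ [x _ <-]; rewrite /interior.
have [T [oT Tx sT _]] := open_bisection_at (gunit G x).
have uT : nbhs (gsrc (gunit G x)) [set y | T (gunit G y)].
  by rewrite gsrc_unit; apply: (etale_unit eG); exact: open_nbhs_nbhs.
have n1 : nbhs (gunit G x) [set a : G | T (gunit G (gsrc a))] := gsrc_continuous uT.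
have n2 : nbhs (gunit G x) T by exact: open_nbhs_nbhs.
apply: filterS (filterI n1 n2) => a [/= Tu Ta].
by exists (gsrc a) => //; apply: sT => //; rewrite gsrc_unit.
Qed.

Lemma germ_within T : bisection T -> {within (@gsrc X G) @` T, continuous (germ T)}.
Proof.
move=> BT; have [oT [k [Tk _ ck]] _] := BT.
move: ck; apply: subspace_eq_continuous => y; rewrite inE => -[a Ta <-].
by rewrite /from_subspace /= germE ?Tk ?inE //; exact: bisection_src.
Qed.

Lemma germ_near T a : bisection T -> T a -> germ T x @[x --> gsrc a] --> a.
Proof.
move=> BT Ta; have := germ_within BT; have [oT _ _] := BT.
have [oS _] := etale_src eG.
rewrite (continuous_open_subspace _ (oS _ oT)) => H.
have sa : gsrc a \in (@gsrc X G) @` T by rewrite inE; exists a.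
have := H _ sa; rewrite /continuous_at germE //; exact: bisection_src.
Qed.

Lemma germ_continuous g : full_group G g -> continuous (germ g).
Proof.
move=> Fg x; have [gx xx] := germ_in x Fg; have [Bg _ _] := Fg.
by have := germ_near Bg gx; rewrite xx.
Qed.

Lemma bact_continuous g : full_group G g -> continuous (bact g).
Proof.
move=> Fg; have -> : (bact g : X -> X) = @grng X G \o germ g.
  by apply/funext => x /=; rewrite grng_germ.
by move=> x; apply: continuous_comp; [exact: germ_continuous|exact: grng_continuous].
Qed.

Lemma open_set_inv T : open T -> open (set_inv T).
Proof.
have -> : set_inv T = @ginv X G @^-1` T by apply/seteqP; split=> a /set_invE.
by move/continuousP: (etale_inv eG) => /[apply].
Qed.

Lemma gmul_near a b (A : set G) : gsrc a = grng b -> nbhs (gmul a b) A ->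
  exists U V : set G, [/\ nbhs a U, nbhs b V & forall a' b' : G, U a' -> V b' ->
    gsrc a' = grng b' -> A (gmul a' b')].
Proof.
move=> ab nA; have := etale_mul eG; move=> /subspace_continuousP/(_ (a, b) ab).
move=> /(_ A nA); rewrite /within /=.
move=> [[U V] /= [aU bV] UV]; exists U, V; split=> // a' b' Ua Vb ab'.
exact: (UV (a', b')).
Qed.

(** An arrow [c] near a product [a b] is the product of [c b'^-1] and of [b'], the arrow
    of [S] with the same source as [c]. *)
Lemma open_set_mul T S : bisection T -> bisection S -> open (set_mul T S).
Proof.
move=> BT BS; rewrite openE => _ [a [b [Ta Sb ab ->]]]; rewrite /interior.
have [oT _ _] := BT; have [oS _ _] := BS.
(* [c b'^-1] is near [(a b) b^-1 = a], hence in [T]. *)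
have nT : nbhs (gmul (gmul a b) (ginv b)) T by rewrite gmulK //; exact: open_nbhs_nbhs.
have cc : gsrc (gmul a b) = grng (ginv b) by rewrite gsrc_mul ?grng_inv.
have [U [V [cU bV UV]]] := gmul_near cc nT.
have bV' : nbhs b [set b' | V (ginv b')] := etale_inv eG bV.
have nS : nbhs (gsrc (gmul a b)) [set x | V (ginv (germ S x)) /\ S (germ S x) /\ gsrc (germ S x) = x].
  rewrite gsrc_mul //; apply: filterI.
    exact: (germ_near BS Sb bV').
  have [oM _] := etale_src eG.
  have : nbhs (gsrc b) ((@gsrc X G) @` S).
    by apply: open_nbhs_nbhs; split; [exact: oM|exists b].
  apply: filterS => _ [b' Sb' <-]; rewrite germE //; exact: bisection_src.
have nS' : nbhs (gmul a b) [set c : G | V (ginv (germ S (gsrc c))) /\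
    S (germ S (gsrc c)) /\ gsrc (germ S (gsrc c)) = gsrc c] := gsrc_continuous nS.
apply: filterS (filterI cU nS') => c [Uc [/= V1 [S1 sc]]].
exists (gmul c (ginv (germ S (gsrc c)))), (germ S (gsrc c)); split=> //.
- by apply: UV => //; rewrite grng_inv.
- by rewrite gsrc_mul ?gsrc_inv // grng_inv.
- by rewrite gmulVK.
Qed.

Lemma bisection_mul T S : bisection T -> bisection S -> bisection (set_mul T S).
Proof.
move=> BT BS; apply: bisectionI; first exact: open_set_mul.
- by apply: set_mul_src_inj; exact: bisection_src.
- by apply: set_mul_rng_inj; exact: bisection_rng.
Qed.

Lemma bisection_inv T : bisection T -> bisection (set_inv T).
Proof.
move=> BT; apply: bisectionI; first by apply: open_set_inv; case: BT.
- move=> _ _ [a Ta <-] [b Tb <-]; rewrite !gsrc_inv.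
  by move=> /(bisection_rng BT Ta Tb) ->.
- move=> _ _ [a Ta <-] [b Tb <-]; rewrite !grng_inv.
  by move=> /(bisection_src BT Ta Tb) ->.
Qed.

Lemma bisection_unit : bisection (unit_space G).
Proof.
apply: bisectionI; first exact: open_unit_space.
- by move=> _ _ [x _ <-] [y _ <-]; rewrite !gsrc_unit => ->.
- by move=> _ _ [x _ <-] [y _ <-]; rewrite !grng_unit => ->.
Qed.

Lemma full_unit : full_group G (unit_space G).
Proof.
split; first exact: bisection_unit.
- by rewrite -subTset => x _; exists (gunit G x); [exists x|rewrite gsrc_unit].
- by rewrite -subTset => x _; exists (gunit G x); [exists x|rewrite grng_unit].
Qed.

Lemma full_mul g h : full_group G g -> full_group G h -> full_group G (set_mul g h).
Proof.
move=> Fg Fh; have [Bg sg rg] := Fg; have [Bh sh rh] := Fh.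
split; first exact: bisection_mul.
- rewrite -subTset => x _; have [hx xx] := germ_in x Fh.
  have [gy yy] := germ_in (grng (germ h x)) Fg.
  exists (gmul (germ g (grng (germ h x))) (germ h x)); last by rewrite gsrc_mul.
  by exists (germ g (grng (germ h x))), (germ h x).
- rewrite -subTset => x _; have : ((@grng X G) @` g) x by rewrite rg.
  move=> [a ga <-]; have : ((@grng X G) @` h) (gsrc a) by rewrite rh.
  move=> [b hb ba]; exists (gmul a b); last by rewrite grng_mul.
  by exists a, b.
Qed.

Lemma full_inv g : full_group G g -> full_group G (set_inv g).
Proof.
move=> [Bg sg rg]; split; first exact: bisection_inv.
- rewrite -subTset => x _; have : ((@grng X G) @` g) x by rewrite rg.
  by move=> [a ga <-]; exists (ginv a); [exists a|rewrite gsrc_inv].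
- rewrite -subTset => x _; have : ((@gsrc X G) @` g) x by rewrite sg.
  by move=> [a ga <-]; exists (ginv a); [exists a|rewrite grng_inv].
Qed.

Lemma bact_unit : bact (unit_space G) = 1.
Proof.
apply: bact_uniq; first exact: full_unit.
by move=> _ [x _ <-]; rewrite gsrc_unit grng_unit.
Qed.

Lemma bact_mul g h : full_group G g -> full_group G h ->
  bact (set_mul g h) = bact g * bact h.
Proof.
move=> Fg Fh; apply: bact_uniq; first exact: full_mul.
move=> _ [a [b [ga hb ab ->]]]; rewrite gsrc_mul // grng_mul // bME.
by rewrite (bactE Fh hb) -ab (bactE Fg ga).
Qed.

Lemma bact_inv g : full_group G g -> bact (set_inv g) = (bact g)^-1.
Proof.
move=> Fg; apply: bact_uniq; first exact: full_inv.
by move=> _ [a ga <-]; rewrite gsrc_inv grng_inv -(bactE Fg ga) bK.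
Qed.

Lemma germ_unit x : germ (unit_space G) x = gunit G x.
Proof.
apply: germ_uniq; [exact: full_unit|by exists x|by rewrite gsrc_unit].
Qed.

Lemma germ_mul g h x : full_group G g -> full_group G h ->
  germ (set_mul g h) x = gmul (germ g (bact h x)) (germ h x).
Proof.
move=> Fg Fh; have [hx xx] := germ_in x Fh; have [gy yy] := germ_in (bact h x) Fg.
have e : gsrc (germ g (bact h x)) = grng (germ h x) by rewrite grng_germ.
apply: germ_uniq; first exact: full_mul.
- by exists (germ g (bact h x)), (germ h x).
- by rewrite gsrc_mul.
Qed.

Lemma germ_inv g x : full_group G g ->
  germ (set_inv g) (bact g x) = ginv (germ g x).
Proof.
move=> Fg; have [gx xx] := germ_in x Fg.
apply: germ_uniq; first exact: full_inv; first by exists (germ g x).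
by rewrite gsrc_inv grng_germ.
Qed.

Lemma set_mulV g : full_group G g -> set_mul g (set_inv g) = unit_space G.
Proof.
move=> Fg; have Fg' := full_inv Fg; apply: full_eq; [exact: full_mul|exact: full_unit|].
move=> x; rewrite -(bVK (bact g) x) germ_mul // bact_inv // bK germ_inv // gmulV.
by rewrite germ_unit grng_germ.
Qed.

Lemma set_Vmul g : full_group G g -> set_mul (set_inv g) g = unit_space G.
Proof.
move=> Fg; have Fg' := full_inv Fg; apply: full_eq; [exact: full_mul|exact: full_unit|].
by move=> x; rewrite germ_mul // germ_inv // gVmul germ_unit gsrc_germ.
Qed.

(** It is the preimage of the open unit space under the continuous map [germ g]. *)
Lemma open_trivial_germ g : full_group G g -> open [set x | germ g x = gunit G x].
Proof.
move=> Fg; have -> : [set x | germ g x = gunit G x] = germ g @^-1` unit_space G.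
  apply/seteqP; split=> x /= => [->|[y _ e]]; first by exists x.
  by rewrite -e -(gsrc_germ x Fg) -e gsrc_unit.
by move/continuousP: (germ_continuous Fg); apply; exact: open_unit_space.
Qed.

End Etale.

(** * Effective minimal groupoids as full groups of homeomorphisms *)

Section Effective.
Variables (X : topologicalType) (G : groupoid X).
Hypotheses (hX : cantor_basics X) (eG : etale G) (minG : minimal_groupoid G)
  (effG : effective_groupoid G).
Implicit Types (a b c : G) (T S g h : set G) (x y : X) (U V O : set X) (f : bijection X).

Definition homeo_group : set (bijection X) := [set f | exists2 g, full_group G g & bact g = f].

Lemma homeo_bact g : full_group G g -> homeo_group (bact g).
Proof. by exists g. Qed.

Lemma tau_restrict (f : bijection X) T (U : set X) : (forall a, T a -> f (gsrc a) = grng a) ->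
  (forall x, U x -> exists2 a, T a & gsrc a = x) ->
  tau (T `&` [set a | U (gsrc a)]) = [set xy | U xy.1 /\ xy.2 = f xy.1].
Proof.
move=> Tf UT; apply/seteqP; split=> [_ [a [Ta Ua] <-]|[x y] /= [Ux ->]].
  by split=> //=; rewrite Tf.
have [a Ta ax] := UT x Ux.
by exists a; [split=> //=; rewrite ax|rewrite -Tf // ax].
Qed.

(** Restrictions of the two sets to a neighbourhood of the common source are bisections
    that induce the same map, so they coincide by effectiveness. *)
Lemma germ_determined (f : bijection X) T S a b : open T -> open S ->
  (forall c, T c -> f (gsrc c) = grng c) -> (forall c, S c -> f (gsrc c) = grng c) ->
  T a -> S b -> gsrc a = gsrc b -> a = b.
Proof.
move=> oT oS Tf Sf Ta Sb ab.
have [A [oA Aa sA rA]] := open_bisection_at eG a.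
have [B [oB Bb sB rB]] := open_bisection_at eG b.
have [oM _] := etale_src eG.
pose U := (@gsrc X G @` (T `&` A)) `&` (@gsrc X G @` (S `&` B)).
have oU : open U by apply: openI; apply: oM; exact: openI.
pose T' := T `&` A `&` [set c | U (gsrc c)].
pose S' := S `&` B `&` [set c | U (gsrc c)].
have bT : bisection T'.
  apply: (bisectionI eG); first by apply: openI; [exact: openI|exact: (open_gsrc eG oU)].
  - by move=> c d [[_ Ac] _] [[_ Ad] _]; exact: sA.
  - by move=> c d [[_ Ac] _] [[_ Ad] _]; exact: rA.
have bS : bisection S'.
  apply: (bisectionI eG); first by apply: openI; [exact: openI|exact: (open_gsrc eG oU)].
  - by move=> c d [[_ Ac] _] [[_ Ad] _]; exact: sB.
  - by move=> c d [[_ Ac] _] [[_ Ad] _]; exact: rB.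
have TS : T' = S'.
  apply: effG => //; rewrite (tau_restrict (f := f)); last first.
  - by move=> x [[c Tc cx] _]; exists c.
  - by move=> c [/Tf].
  rewrite (tau_restrict (f := f)) //.
  - by move=> c [/Sf].
  - by move=> x [_ [c Tc cx]]; exists c.
have Ua : U (gsrc a) by split; [exists a|exists b].
have : S' a by rewrite -TS.
by move=> [[_ Ba] _]; exact: sB.
Qed.

(** The largest open set of arrows that induces [f]. *)
Definition arrows_of (f : bijection X) : set G := [set a | f (gsrc a) = grng a]^°.

Lemma arrows_of_max f T : open T -> (forall a, T a -> f (gsrc a) = grng a) ->
  T `<=` arrows_of f.
Proof. by move=> oT Tf; rewrite -open_subsetE // => a /Tf. Qed.

Lemma arrows_ofE f a : arrows_of f a -> f (gsrc a) = grng a.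
Proof. exact: interior_subset. Qed.

Lemma arrows_of_full f : (forall x, exists2 a, arrows_of f a & gsrc a = x) ->
  full_group G (arrows_of f) /\ bact (arrows_of f) = f.
Proof.
move=> fP; have oI : open (arrows_of f) by exact: open_interior.
have sI : src_inj (arrows_of f).
  move=> a b fa fb ab; have fP' := @arrows_ofE f.
  exact: (germ_determined oI oI fP' fP' fa fb ab).
have rI : rng_inj (arrows_of f).
  move=> a b fa fb e; apply: sI => //; apply: (@b_inj _ f).
  by rewrite (arrows_ofE fa) (arrows_ofE fb).
have Ff : full_group G (arrows_of f).
  split; first exact: (bisectionI eG).
  - by rewrite -subTset => x _; have [a fa ax] := fP x; exists a.
  - rewrite -subTset => y _; have [a fa ax] := fP (f^-1 y).
    by exists a => //; rewrite -(arrows_ofE fa) ax bVK.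
by split=> //; apply: bact_uniq => // a /arrows_ofE.
Qed.

Lemma full_arrows_of g : full_group G g -> arrows_of (bact g) = g.
Proof.
move=> Fg; have [[og _ _] _ _] := Fg.
have sg : g `<=` arrows_of (bact g).
  by apply: arrows_of_max => // a; exact: bactE.
have gP x : exists2 a, arrows_of (bact g) a & gsrc a = x.
  by have [gx xx] := germ_in x Fg; exists (germ g x) => //; exact: sg.
have [Fg' _] := arrows_of_full gP.
apply/seteqP; split=> // a ga.
have [gx xx] := germ_in (gsrc a) Fg.
by rewrite -(full_src Fg' (sg _ gx) ga).
Qed.

Lemma bact_inj g h : full_group G g -> full_group G h -> bact g = bact h -> g = h.
Proof. by move=> Fg Fh e; rewrite -(full_arrows_of Fg) e full_arrows_of. Qed.

Lemma near_germ g h x : full_group G g -> full_group G h ->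
  (\forall z \near x, bact g z = bact h z) -> germ g x = germ h x.
Proof.
move=> Fg Fh; rewrite /prop_near1 nbhsE => -[U [oU Ux] UP].
have [[og _ _] _ _] := Fg; have [[oh _ _] _ _] := Fh.
have [gx gxx] := germ_in x Fg; have [hx hxx] := germ_in x Fh.
apply: (@germ_determined (bact g) (g `&` [set a | U (gsrc a)])
  (h `&` [set a | U (gsrc a)])).
- by apply: openI => //; exact: (open_gsrc eG).
- by apply: openI => //; exact: (open_gsrc eG).
- by move=> c [gc _]; exact: bactE.
- by move=> c [hc Uc]; rewrite -(bactE Fh hc); exact: UP.
- by split=> //=; rewrite gxx.
- by split=> //=; rewrite hxx.
- by rewrite gxx hxx.
Qed.

Lemma germ_near_eq g h x : full_group G g -> full_group G h ->
  germ g x = germ h x -> \forall z \near x, bact g z = bact h z.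
Proof.
move=> Fg Fh e; have [[og _ _] _ _] := Fg; have [[oh _ _] _ _] := Fh.
have [gx gxx] := germ_in x Fg; have [hx hxx] := germ_in x Fh.
have [oM _] := etale_src eG.
have : nbhs x (@gsrc X G @` (g `&` h)).
  apply: open_nbhs_nbhs; split; first exact/oM/openI.
  by exists (germ g x) => //; split=> //; rewrite e.
by apply: filterS => _ [a [ga ha] <-]; rewrite !bactE.
Qed.

Lemma near_germ_unit g x : full_group G g ->
  (\forall z \near x, bact g z = z) <-> germ g x = gunit G x.
Proof.
move=> Fg; have Fu := full_unit eG; split=> [gx|gx].
  by rewrite -(germ_unit eG x); apply: near_germ => //; rewrite bact_unit.
have : germ g x = germ (unit_space G) x by rewrite germ_unit.
by move=> /(germ_near_eq Fg Fu); rewrite bact_unit.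
Qed.

Lemma homeo_subgroup : is_subgroup homeo_group.
Proof.
split.
- by exists (unit_space G); [exact: full_unit|exact: bact_unit].
- move=> _ _ [g Fg <-] [h Fh <-]; exists (set_mul g h); first exact: full_mul.
  exact: bact_mul.
- move=> _ [g Fg <-]; exists (set_inv g); first exact: full_inv.
  exact: bact_inv.
Qed.

(** An arrow between distinct points lies in a small bisection with disjoint clopen source
    and range; the element of the full group exchanges these two sets. *)
Lemma arrow_swap a : gsrc a <> grng a -> exists2 g, full_group G g & g a.
Proof.
move=> /eqP sr; have := cantor_hausdorff hX; rewrite open_hausdorff.
move=> /(_ _ _ sr)[[A B] /= [/set_mem As /set_mem Br] [oA oB /eqP AB]].
have [T0 [oT0 T0a sT0 rT0]] := open_bisection_at eG a.
pose T1 := T0 `&` [set c | A (gsrc c)] `&` [set c | B (grng c)].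
have oT1 : open T1.
  by do !apply: openI => //; [exact: (open_gsrc eG)|exact: (open_grng eG)].
have [oM _] := etale_src eG; have [oR _] := etale_rng eG.
have nT1 : nbhs (gsrc a) (@gsrc X G @` T1).
  by apply: open_nbhs_nbhs; split; [exact: oM|exists a].
have [V [cV Va VT]] := cantor_basis hX nT1; have [oV kV] := cV.
pose T := T1 `&` [set c | V (gsrc c)].
have oT : open T by apply: openI => //; exact: (open_gsrc eG).
have bT : bisection T.
  apply: (bisectionI eG) => // c d [[[Tc _] _] _] [[[Td _] _] _]; [exact: sT0|exact: rT0].
have sT := bisection_src bT; have rT := bisection_rng bT.
have Ta : T a by [].
have Vsrc : @gsrc X G @` T = V.
  apply/seteqP; split=> [_ [c [_ Vc] <-] //|x Vx].
  by have [c Tc cx] := VT _ Vx; exists c => //; split=> //=; rewrite cx.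
pose R := @grng X G @` T.
have oRR : open R by exact: oR.
have kR : closed R.
  apply: compact_closed; first exact: cantor_hausdorff.
  have -> : R = (@grng X G \o germ T) @` V.
    apply/seteqP; split=> [_ [c Tc <-]|_ [x Vx <-]].
      by exists (gsrc c); [rewrite -Vsrc; exists c|rewrite /= germE].
    move: Vx; rewrite -Vsrc => -[c Tc <-]; rewrite /= germE //; by exists c.
  apply: continuous_compact; last exact: (compact_clopen hX).
  apply: continuous_in_subspaceT => x; rewrite inE -Vsrc => -[c Tc <-].
  have E : {for gsrc c, continuous (germ T)}.
    by rewrite /prop_for /continuous_at germE //; exact: (germ_near eG bT Tc).
  exact: (continuous_comp E (@grng_continuous _ _ eG _)).
have VR x : V x -> R x -> False.
  move=> Vx [c Tc cx]; have [[[_ _] Bc] _] := Tc.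
  move: Vx; rewrite -Vsrc => -[d [[[_ Ad] _] _] dx].
  have : (A `&` B) x by split; [rewrite -dx|rewrite -cx].
  by rewrite AB.
have Tsrc c : T c -> V (gsrc c) by move=> [].
have Trng c : T c -> R (grng c) by move=> Tc; exists c.
pose back y := xget a [set c | T c /\ grng c = y].
have backE c : T c -> back (grng c) = c.
  move=> Tc; rewrite /back; case: xgetP => [d _ [Td]|/(_ c)[]//]; exact: rT.
pose f x := if `[< V x >] then grng (germ T x) else
  if `[< R x >] then gsrc (back x) else x.
have fs c : T c -> f (gsrc c) = grng c.
  by move=> Tc; rewrite /f asboolT ?germE //; exact: Tsrc.
have fr c : T c -> f (grng c) = gsrc c.
  move=> Tc; rewrite /f asboolF ?asboolT ?backE //; first exact: Trng.
  by move=> /VR; apply; exact: Trng.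
have f0 x : ~ V x -> ~ R x -> f x = x by move=> nV nR; rewrite /f !asboolF.
have fK : cancel f f.
  move=> x; have [Vx|nV] := pselect (V x).
    by move: Vx; rewrite -Vsrc => -[c Tc <-]; rewrite fs // fr.
  have [[c Tc <-]|nR] := pselect (R x); first by rewrite fr // fs.
  by rewrite !f0.
pose F := Bijection fK fK.
have maxF := @arrows_of_max F.
have TF : T `<=` arrows_of F by apply: maxF => // c; exact: fs.
have TF' : set_inv T `<=` arrows_of F.
  apply: maxF; first exact: (open_set_inv eG).
  by move=> _ [c Tc <-]; rewrite gsrc_inv grng_inv; exact: fr.
have UF : unit_space G `&` [set c | (~` (V `|` R)) (gsrc c)] `<=` arrows_of F.
  apply: maxF.
    apply: openI; first exact: open_unit_space.
    by apply: (open_gsrc eG); apply: closed_openC; exact: closedU.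
  move=> _ [[x _ <-]]; rewrite /= gsrc_unit grng_unit => n.
  by apply: f0 => xx; apply: n; [left|right].
have [|FF _] := @arrows_of_full F; last by exists (arrows_of F) => //; exact: TF.
move=> x; have [Vx|nV] := pselect (V x).
  by move: Vx; rewrite -Vsrc => -[c Tc <-]; exists c => //; exact: TF.
have [[c Tc <-]|nR] := pselect (R x).
  exists (ginv c); last by rewrite gsrc_inv.
  by apply: TF'; exists c.
exists (gunit G x); last by rewrite gsrc_unit.
by apply: UF; split; [exists x|rewrite /= gsrc_unit => -[]].
Qed.

Lemma orbit_meets x U : open U -> U !=set0 -> exists a, gsrc a = x /\ U (grng a).
Proof.
move=> oU U0; have [y [Uy [a ax ay]]] := minG x U0 oU.
by exists a; rewrite ay.
Qed.

(** An isotropy arrow is a product of two arrows between distinct points, because the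
    orbit of its source has another point. *)
Lemma arrow_full a : exists2 g, full_group G g & g a.
Proof.
have [sr|] := pselect (gsrc a = grng a); last exact: arrow_swap.
have oC : open (~` [set gsrc a]).
  by apply: closed_openC; apply: (finite_closed hX); exact: finite_set1.
have C0 : ~` [set gsrc a] !=set0.
  apply: contrapT => n; apply: (@cantor_no_isolated _ hX (gsrc a)).
  suff -> : [set gsrc a] = setT by exact: openT.
  rewrite -subTset => x _; apply: contrapT => nx; apply: n; by exists x.
have [d [ds dr]] := orbit_meets (gsrc a) oC C0.
have dsr : gsrc d <> grng d by rewrite ds => e; apply: dr; rewrite -e.
have ad : gsrc a = grng (ginv d) by rewrite grng_inv.
have adr : gsrc (gmul a (ginv d)) <> grng (gmul a (ginv d)).
  rewrite gsrc_mul // grng_mul // gsrc_inv -sr => e; exact: dr.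
have [g Fg ga] := arrow_swap adr; have [h Fh hd] := arrow_swap dsr.
exists (set_mul g h); first exact: full_mul.
exists (gmul a (ginv d)), d; split=> //; first by rewrite gsrc_mul // gsrc_inv.
by rewrite gmulVK.
Qed.

Lemma homeo_full_dynamics : full_dynamics homeo_group.
Proof.
split; first exact: homeo_subgroup.
- by move=> _ [g Fg <-]; exact: bact_continuous.
- move=> f fP; have [|Ff <-] := @arrows_of_full f; last exact: homeo_bact.
  move=> x; have [_ [g Fg <-]] := fP x; rewrite /prop_near1 nbhsE => -[U [oU Ux] UP].
  have [gx xx] := germ_in x Fg; exists (germ g x) => //.
  apply: (@arrows_of_max f (g `&` [set a | U (gsrc a)])).
  + by apply: openI; [case: Fg => [[]]|exact: (open_gsrc eG)].
  + by move=> a [ga Ua]; rewrite UP //; exact: bactE.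
  + by split=> //=; rewrite xx.
- move=> x U oU U0; have [a [ax Ua]] := orbit_meets x oU U0.
  have [g Fg ga] := arrow_full a; exists (bact g); first exact: homeo_bact.
  by rewrite -ax (bactE Fg ga).
Qed.

Let hF := homeo_full_dynamics.

Lemma three_cycle_alt g : three_cycle G g -> alt homeo_group setT (bact g).
Proof.
move=> [Fg g3 [U1 [U2 [U3 [[c1 c2 c3] [d12 d23 d13] [t1 t2 t3] gU]]]]].
have tE U : tau_image g U = translate (bact g) U.
  apply/seteqP; split=> [y [x Ux [a ga [sx ry]]]|y Uy].
    by rewrite /translate /mkset -ry -(bactE Fg ga) bK sx.
  have [gx xx] := germ_in ((bact g)^-1 y) Fg.
  exists ((bact g)^-1 y) => //; exists (germ g ((bact g)^-1 y)) => //.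
  by rewrite xx -(bactE Fg gx) xx bVK.
have f3 : bact g * (bact g * bact g) = 1.
  have Fgg := full_mul eG Fg Fg.
  by rewrite -(bact_unit eG) -g3 !bact_mul.
set f := bact g in f3 tE *; rewrite !tE in t1 t2 t3.
have fF : homeo_group f := homeo_bact Fg.
have disj A B x : A `&` B = set0 -> A x -> B x -> False.
  by move=> AB Ax Bx; have : (A `&` B) x by []; rewrite AB.
have U2f x : U1 x -> U2 (f x) by rewrite -t1 translateE.
have U3f x : U1 x -> U3 (f (f x)) by rewrite -t2 translateE; exact: U2f.
have d : disjoint_translates U1 f (f * f).
  move=> x y Ux Uy; rewrite bME; split=> e.
  - by apply: (disj _ _ x d12) => //; rewrite e; exact: U2f.
  - by apply: (disj _ _ x d13) => //; rewrite e; exact: U3f.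
  - by apply: (disj _ _ (f x) d23); [exact: U2f|rewrite e; exact: U3f].
suff -> : f = cycle3 U1 f (f * f).
  apply: alt_cycle; split=> //; apply: (subM homeo_subgroup) => //.
apply: bijP => x; case: (cycleP U1 f (f * f) x) => [Vx|y Vy ->|y Vy ->|n1 n2 n3].
- by rewrite cycle3B.
- by rewrite cycle3F.
- by rewrite cycle3S //; have := congr1 (fun h : bijection X => h y) f3.
- rewrite cycle30 //; have nU : ~ (U1 `|` U2 `|` U3) x.
    move=> [[//|]|]; first by rewrite -t1.
    by rewrite -t2 -t1 -translateM.
  have gx : g (gunit G x) by apply: gU; exists x.
  by have := bactE Fg gx; rewrite gsrc_unit grng_unit.
Qed.

Lemma cycle_three_cycle g V (f k : bijection X) : full_group G g ->
  cycle_in homeo_group setT V f k -> bact g = cycle3 V f k -> three_cycle G g.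
Proof.
move=> Fg Vc ge; have [cV Ff Fk d _] := Vc; have Fgg := full_mul eG Fg Fg.
have tE U : tau_image g U = translate (bact g) U.
  apply/seteqP; split=> [y [x Ux [a ga [sx ry]]]|y Uy].
    by rewrite /translate /mkset -ry -(bactE Fg ga) bK sx.
  have [gx xx] := germ_in ((bact g)^-1 y) Fg.
  exists ((bact g)^-1 y) => //; exists (germ g ((bact g)^-1 y)) => //.
  by rewrite xx -(bactE Fg gx) xx bVK.
split=> //.
  apply: bact_inj; [exact: full_mul|exact: full_unit|].
  rewrite !bact_mul // bact_unit // ge; apply: bijP => x; rewrite !bME b1E.
  case: (cycleP V f k x) => [Vx|y Vy ->|y Vy ->|n1 n2 n3].
  - by rewrite (cycle3B d Vx) cycle3F // cycle3S.
  - by rewrite (cycle3F d Vy) (cycle3S d Vy) cycle3B.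
  - by rewrite (cycle3S d Vy) (cycle3B d Vy) cycle3F.
  - by rewrite !cycle30.
have disj A B : (forall x, A x -> B x -> False) -> A `&` B = set0 :> set X.
  by move=> AB; rewrite -subset0 => x [/AB].
exists V, (translate f V), (translate k V); split.
- by split=> //; exact: (clopen_translate hF).
- split; apply: disj => x.
  + move=> Vx Tx; have [y Vy e] := translate_image Tx.
    by have [n _ _] := d x y Vx Vy.
  + move=> Tx Tx'; have [y Vy e] := translate_image Tx.
    have [z Vz e'] := translate_image Tx'.
    by have [_ _ n] := d y z Vy Vz; apply: n; rewrite -e.
  + move=> Vx Tx; have [y Vy e] := translate_image Tx.
    by have [_ n _] := d x y Vx Vy.
- have imE (A B : set X) : (forall x, A x -> B (cycle3 V f k x)) ->
     (forall y, B y -> exists2 x, A x & y = cycle3 V f k x) ->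
     translate (cycle3 V f k) A = B.
    move=> AB BA; apply/seteqP; split=> y.
      by move=> Ty; have [x Ax ->] := translate_image Ty; exact: AB.
    by move=> /BA[x Ax ->]; rewrite translateE.
  rewrite !tE ge; split; apply: imE.
  + by move=> x Vx; rewrite cycle3B // translateE.
  + move=> y Ty; have [x Vx ->] := translate_image Ty.
    by exists x => //; rewrite cycle3B.
  + move=> y Ty; have [x Vx ->] := translate_image Ty.
    by rewrite cycle3F // translateE.
  + move=> y Ty; have [x Vx ->] := translate_image Ty.
    by exists (f x); rewrite ?translateE // cycle3F.
  + by move=> y Ty; have [x Vx ->] := translate_image Ty; rewrite cycle3S.
  + by move=> x Vx; exists (k x); rewrite ?translateE // cycle3S.
- move=> _ [x nx <-]; have n1 : ~ V x by move=> Vx; apply: nx; left; left.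
  have n2 : ~ V (f^-1 x) by move=> Vx; apply: nx; left; right.
  have n3 : ~ V (k^-1 x) by move=> Vx; apply: nx; right.
  have := cycle_near_fix hF cV Ff Fk d n1 n2 n3; rewrite -ge => /(near_germ_unit x Fg) <-.
  by have [] := germ_in x Fg.
Qed.

Lemma subgroup_mul (K : set (set G)) g h : subgroup K -> K g -> K h -> K (set_mul g h).
Proof. by move=> [_ _ + _]; exact. Qed.

Lemma alternating_sub : subgroup (alternating_group G).
Proof.
have tF : three_cycle G `<=` full_group G by move=> g [].
have fF : subgroup (full_group G).
  by split=> //; [exact: full_unit|exact: full_mul|exact: full_inv].
split.
- by apply: smallest_sub.
- by move=> K [[_ K1 _ _] _].
- move=> g h Ag Ah K SK; have [[_ _ KM _] _] := SK.
  by apply: KM; [exact: Ag|exact: Ah].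
- move=> g Ag K SK; have [[_ _ _ KV] _] := SK.
  by apply: KV; exact: Ag.
Qed.

(** The abstract 3-cycles with base $V$ and the 3-cycles with permuted sets $U_1 = V$,
    $U_2 = g V$, $U_3 = h V$ are the same elements. *)
Lemma alternatingP g : alternating_group G g <->
  full_group G g /\ alt homeo_group setT (bact g).
Proof.
split.
  apply: (@smallest_sub _ (@subgroup X G) (three_cycle G)
    [set g | full_group G g /\ alt homeo_group setT (bact g)]).
    have sA := alt_subgroup homeo_group setT.
    split=> [h []//||h k [Fh Ah] [Fk Ak]|h [Fh Ah]].
    - by split; [exact: full_unit|rewrite bact_unit //; exact: alt1].
    - by split; [exact: full_mul|rewrite bact_mul //; exact: (subM sA)].
    - by split; [exact: full_inv|rewrite bact_inv //; exact: (subV sA)].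
  by move=> h h3; split; [case: h3|exact: three_cycle_alt].
move=> [Fg Ag]; suff H : forall f, alt homeo_group setT f ->
    forall h, full_group G h -> bact h = f -> alternating_group G h.
  exact: (H _ Ag g Fg erefl).
move=> f; elim=> [h Fh h1|V f1 k a Vc Aa IH h Fh hE].
  have -> : h = unit_space G.
    by apply: bact_inj => //; [exact: full_unit|rewrite bact_unit].
  by case: alternating_sub.
have [u Fu uE] := cycle_full hF Vc.
have [v Fv vE] := alt_full hF Aa.
have -> : h = set_mul u v.
  apply: bact_inj => //; first exact: full_mul.
  by rewrite bact_mul // hE uE vE.
apply: (subgroup_mul alternating_sub); last exact: IH.
have : three_cycle G u by exact: cycle_three_cycle Vc uE.
exact: sub_gen_smallest.
Qed.

End Effective.

(** * The finite set attached to a point of the support *)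

Section Homomorphism.
Variables (X Y : topologicalType) (G : groupoid X) (H : groupoid Y).
Hypotheses (hX : cantor_basics X) (eG : etale G) (minG : minimal_groupoid G)
  (effG : effective_groupoid G) (cY : compact [set: Y]) (eH : etale H).
Variables (K : set (set G)) (rho : set G -> set H).
Hypotheses (SK : subgroup K) (AK : alternating_group G `<=` K)
  (hrho : group_morphism K rho).
Implicit Types (g h a : set G) (x p q : X) (y : Y) (f : bijection X).

Local Notation F := (homeo_group G).
Local Notation A := (alternating_group G).
Let Z := group_supp (rho @` A).
Let hF := homeo_full_dynamics hX eG minG effG.
Let AP g := alternatingP hX eG minG effG g.
Let SA := alternating_sub eG.

Lemma K_full g : K g -> full_group G g. Proof. by case: SK => + _ _ _; exact. Qed.
Lemma K_mul g h : K g -> K h -> K (set_mul g h).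
Proof. by case: SK => _ _ + _; exact. Qed.
Lemma K_inv g : K g -> K (set_inv g). Proof. by case: SK => _ _ _; exact. Qed.
Lemma K_unit : K (unit_space G). Proof. by case: SK. Qed.

Lemma A_mul g h : A g -> A h -> A (set_mul g h).
Proof. by case: SA => _ _ + _; exact. Qed.
Lemma A_inv g : A g -> A (set_inv g). Proof. by case: SA => _ _ _; exact. Qed.
Lemma A_unit : A (unit_space G). Proof. by case: SA. Qed.

Lemma A_bact f : alt F setT f -> exists2 a, A a & bact a = f.
Proof.
move=> Af; have [a Fa aE] := alt_full hF Af; exists a => //.
by apply/AP; split=> //; rewrite aE.
Qed.

Lemma A_conj g a : full_group G g -> A a -> A (set_mul g (set_mul a (set_inv g))).
Proof.
move=> Fg /AP[Fa Aa]; have Fg' := full_inv eG Fg; have Fag := full_mul eG Fa Fg'.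
apply/AP; split; first exact: full_mul.
rewrite !bact_mul // bact_inv // mulgA.
by apply: (altJ_sub hF (homeo_bact Fg) _ Aa).
Qed.

Lemma rho_full g : K g -> full_group H (rho g). Proof. by case: hrho => + _; exact. Qed.

Lemma rho_mul g h : K g -> K h -> rho (set_mul g h) = set_mul (rho g) (rho h).
Proof. by case: hrho => _; exact. Qed.

Lemma rho_unit : rho (unit_space G) = unit_space H.
Proof.
have Fu := rho_full K_unit.
rewrite -(set_mulV eH Fu) -{1}[rho _]set_mul1 -(set_mulV eH Fu) set_mulA.
by rewrite -rho_mul ?set_mul1 //; exact: K_unit.
Qed.

Lemma rho_inv g : K g -> rho (set_inv g) = set_inv (rho g).
Proof.
move=> Kg; have Fg := rho_full Kg; have Fg' := rho_full (K_inv Kg).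
rewrite -[LHS]set_1mul -(set_Vmul eH Fg) -set_mulA -rho_mul ?set_mulV //.
- by rewrite rho_unit set_mul1.
- exact: K_full.
- exact: K_inv.
Qed.

(** The elements of [K], as homeomorphisms of [X], whose image has trivial germ at [y]. *)
Definition stab y : set (bijection X) :=
  [set f | exists g, [/\ K g, bact g = f & germ (rho g) y = gunit H y]].

Lemma stabP y g : K g -> stab y (bact g) <-> germ (rho g) y = gunit H y.
Proof.
move=> Kg; split=> [[h [Kh hg hy]]|gy]; last by exists g.
by rewrite -(bact_inj eG effG (K_full Kh) (K_full Kg) hg).
Qed.

Lemma germ_unit_fix y g : K g -> germ (rho g) y = gunit H y -> bact (rho g) y = y.
Proof. by move=> Kg e; rewrite -grng_germ ?e ?grng_unit //; exact: rho_full. Qed.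

Lemma stab_subgroup y : is_subgroup (stab y).
Proof.
split.
- exists (unit_space G); split; [exact: K_unit|exact: bact_unit|].
  by rewrite rho_unit germ_unit.
- move=> _ _ [g [Kg <- gy]] [h [Kh <- hy]]; exists (set_mul g h).
  have [Fg Fh] := (K_full Kg, K_full Kh); have [Rg Rh] := (rho_full Kg, rho_full Kh).
  split; [exact: K_mul|exact: bact_mul|].
  rewrite rho_mul // germ_mul // germ_unit_fix // gy hy.
  by rewrite unit_mull ?grng_unit.
- move=> _ [g [Kg <- gy]]; exists (set_inv g).
  have Fg := K_full Kg; have Rg := rho_full Kg.
  split; [exact: K_inv|exact: bact_inv|].
  by rewrite rho_inv // -{1}(germ_unit_fix Kg gy) germ_inv // gy ginv_unit.
Qed.

Lemma germ_rho_conj g h y : K g -> K h -> germ (rho h) y = gunit H y ->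
  germ (rho (set_mul g (set_mul h (set_inv g)))) (bact (rho g) y) =
  gunit H (bact (rho g) y).
Proof.
move=> Kg Kh hy; have Kg' := K_inv Kg; have Khg := K_mul Kh Kg'.
have [Rg Rh] := (rho_full Kg, rho_full Kh); have Rg' := rho_full Kg'.
have Rhg := rho_full Khg; have Rv := full_inv eH Rg.
rewrite rho_mul // germ_mul // rho_mul // rho_inv // bact_mul // bact_inv // bME bK.
rewrite (germ_unit_fix Kh hy) germ_mul // bact_inv // bK hy germ_inv //.
rewrite unit_mull ?grng_inv ?gsrc_germ // gmulV.
by rewrite grng_germ.
Qed.

Lemma stab_conj g y f : K g ->
  conj_set (bact g) (stab y) f <-> stab (bact (rho g) y) f.
Proof.
move=> Kg; have Fg := K_full Kg; have Rg := rho_full Kg.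
split=> [[h [Kh hE hy]]|[h [Kh <- hy]]].
  have Kc := K_mul Kg (K_mul Kh (K_inv Kg)).
  exists (set_mul g (set_mul h (set_inv g))); split=> //; last exact: germ_rho_conj.
  have [Fh Fg'] := (K_full Kh, full_inv eG Fg).
  rewrite !bact_mul // ?hE ?bact_inv //; last exact: full_mul.
  by rewrite !mulgA mulgV mul1g mulgK.
have Kg' := K_inv Kg; have Fg' := K_full Kg'; have Fh := K_full Kh.
exists (set_mul (set_inv g) (set_mul h (set_inv (set_inv g)))); split.
- by apply: K_mul => //; apply: K_mul => //; exact: K_inv.
- rewrite !bact_mul // ?bact_inv // ?invgK ?mulgA //; first exact: full_inv.
  by apply: full_mul => //; exact: full_inv.
- have := germ_rho_conj Kg' Kh hy.
  by rewrite rho_inv // bact_inv // bK.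
Qed.

Lemma stab_near y f : stab y f -> \forall z \near y, stab z f.
Proof.
move=> [g [Kg gf gy]]; have : nbhs y [set z | germ (rho g) z = gunit H z].
  by apply: open_nbhs_nbhs; split=> //; exact: (open_trivial_germ eH (rho_full Kg)).
by apply: filterS => z gz; exists g.
Qed.

Lemma Z_moved y : Z y -> forall B, nbhs y B -> exists z a, [/\ B z, A a &
  germ (rho a) z <> gunit H z].
Proof.
move=> Zy B yB; have [z [[_ [a Aa <-] az] Bz]] := Zy B yB.
by exists z, a.
Qed.

Lemma moved_Z a y : A a -> germ (rho a) y <> gunit H y -> Z y.
Proof.
by move=> Aa ay; apply: subset_closure; exists (rho a) => //; exists a.
Qed.

(** The alternating group is normal, so its image is normalised by the image of [K]. *)
Lemma Z_invariant g y : K g -> Z y -> Z (bact (rho g) y).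
Proof.
move=> Kg Zy B yB; have Rg := rho_full Kg.
have yB' : nbhs y [set z | B (bact (rho g) z)] := bact_continuous eH Rg yB.
have [z [a [Bz Aa az]]] := Z_moved Zy yB'.
exists (bact (rho g) z); split=> //.
pose b := set_mul g (set_mul a (set_inv g)).
have Ab : A b by apply: A_conj => //; exact: K_full.
exists (rho b); first by exists b.
have Kb := AK Ab; move=> be; apply: az.
have /(stabP _ Kb) : germ (rho b) (bact (rho g) z) = gunit H (bact (rho g) z) by [].
move=> /(stab_conj z _ Kg); have [Fg Fa] := (K_full Kg, K_full (AK Aa)).
have Fg' := full_inv eG Fg; have Fag := full_mul eG Fa Fg'.
rewrite /conj_set /mkset /b !bact_mul // bact_inv // !mulgA mulVg mul1g mulgVK.
by move/(stabP z (AK Aa)).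
Qed.

Lemma Z_invariantP g y : K g -> Z (bact (rho g) y) <-> Z y.
Proof.
move=> Kg; split; last exact: Z_invariant.
move=> /(Z_invariant (K_inv Kg)); rewrite rho_inv // bact_inv ?bK //.
exact: rho_full.
Qed.

Definition noninjective : Prop := ~ exists2 y, Z y & set_inj K (fun g => germ (rho g) y).

(** Every [stab y] contains a non-trivial element, because the germ map at [y] is not
    injective.  This element also belongs to [stab z] for the [z] near [y], so that finitely
    many elements serve all points of the compact set [Z]. *)
Lemma confining_family : noninjective -> Z !=set0 ->
  exists n (f : 'I_n.+1 -> bijection X), [/\ forall i, F (f i),
    forall i, exists x, f i x <> x & forall y, Z y -> exists i, stab y (f i)].
Proof.
move=> ninj [y0 Zy0].
have [fs [fsP fsZ]] : exists fs : seq (bijection X),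
    (forall f, f \in fs -> F f /\ exists x, f x <> x) /\
    forall y, Z y -> exists2 f, f \in fs & stab y f; last first.
  have [f0 f0s _] := fsZ y0 Zy0.
  case: fs => [//|f1 fs] in fsP fsZ f0s *.
  exists (size fs), (fun i => nth 1 (f1 :: fs) i); split=> [i|i|y Zy].
  - by have [] := fsP _ (mem_nth (s := f1 :: fs) 1 (ltn_ord i)).
  - by have [] := fsP _ (mem_nth (s := f1 :: fs) 1 (ltn_ord i)).
  - have [f ff fy] := fsZ y Zy.
    have lt_f : (index f (f1 :: fs) < (size fs).+1)%N by rewrite -index_mem in ff.
    by exists (Ordinal lt_f); rewrite /= nth_index.
have cZ : compact Z.
  rewrite -[Z]setTI; apply: compact_closedI => //; exact: closed_closure.
apply: (@compact_union_induction Y Z (fun B => exists fs : seq (bijection X),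
    (forall f, f \in fs -> F f /\ exists x, f x <> x) /\
    forall y, B y -> exists2 f, f \in fs & stab y f)) => //.
- by exists [::]; split.
- by move=> B C BC [fs [fs1 fs2]]; exists fs; split=> // y /BC; exact: fs2.
- move=> B C [fs [fs1 fs2]] [fs' [fs1' fs2']]; exists (fs ++ fs'); split.
    by move=> f; rewrite mem_cat => /orP[/fs1|/fs1'].
  move=> y [/fs2[f ff fy]|/fs2'[f ff fy]]; exists f => //; rewrite mem_cat ff ?orbT //.
move=> y Zy; have [g [h [Kg Kh gh ghy]]] : exists g h,
    [/\ K g, K h, g <> h & germ (rho g) y = germ (rho h) y].
  apply: contrapT => n; apply: ninj; exists y => // g h /set_mem Kg /set_mem Kh e.
  by apply: contrapT => gh; apply: n; exists g, h.
have [Fg Fh] := (K_full Kg, K_full Kh); have [Rg Rh] := (rho_full Kg, rho_full Kh).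
have Kh' := K_inv Kh; have Fh' := K_full Kh'; have Rh' := full_inv eH Rh.
pose k := set_mul (set_inv h) g; have Kk : K k by exact: K_mul.
have ky : germ (rho k) y = gunit H y.
  rewrite rho_mul // rho_inv // germ_mul //.
  have -> : bact (rho g) y = bact (rho h) y by rewrite -!grng_germ // ghy.
  by rewrite germ_inv // ghy gVmul gsrc_germ.
have yU := stab_near ((stabP y Kk).2 ky).
exists [set z | stab z (bact k)] => //.
exists [:: bact k]; split=> [f|z zk]; last by exists (bact k); rewrite ?inE.
rewrite inE => /eqP ->; split; first exact/homeo_bact/K_full.
apply: contrapT => n; apply: gh; apply: (bact_inj eG effG) => //.
have k1 : bact k = 1.
  by apply: bijP => x; apply: contrapT => kx; apply: n; exists x.
by move: k1; rewrite bact_mul // bact_inv // => /mulg1_eq; rewrite invgK => ->.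
Qed.

Definition attached_set y : set X := bad_points F (stab y).
Local Notation Q := attached_set.

Lemma Q_equivariant g y x : K g -> Q (bact (rho g) y) (bact g x) <-> Q y x.
Proof.
move=> Kg; have Fg := homeo_bact (K_full Kg).
suff sE : stab (bact (rho g) y) = conj_set (bact g) (stab y).
  by rewrite /attached_set sE; exact: bad_points_conj.
by apply/seteqP; split=> f /(stab_conj y f Kg).
Qed.

(** The conclusion of [confined_subgroups] for the groups [stab y]. *)
Definition controlled r : Prop := forall y, Z y -> exists s : seq X,
  [/\ uniq s, (size s <= r)%N, forall x, Q y x <-> x \in s,
    alt F (~` Q y) `<=` stab y &
    forall f, alt F setT f ->
      (forall q, q \in s -> \forall z \near q, f z = z) -> stab y f].

Variable r : nat.
Hypothesis finQ : controlled r.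

Lemma Q_trivial y a : Z y -> A a -> (forall q, Q y q -> germ a q = gunit G q) ->
  germ (rho a) y = gunit H y.
Proof.
move=> Zy Aa aQ; have [s [_ _ sQ _ sP]] := finQ Zy; have [Fa Aa'] := (AP a).1 Aa.
apply/(stabP y (AK Aa)); apply: sP => // q /sQ/aQ qa.
exact/(near_germ_unit eG effG q Fa).
Qed.

Lemma Q_alt y (W : set X) f : Z y -> (forall x, W x -> ~ Q y x) -> alt F W f -> stab y f.
Proof.
move=> Zy WQ Wf; have [s [_ _ _ sA _]] := finQ Zy; apply: sA; exact: altS Wf.
Qed.

(** An element of [stab y] fixes [y], so this is [Q_equivariant]. *)
Lemma Q_preserved y g q : K g -> bact (rho g) y = y -> Q y (bact g q) <-> Q y q.
Proof. by move=> Kg gy; rewrite -{1}gy Q_equivariant. Qed.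

(** The group [stab y] contains [alt F W], hence [stab z] contains, for [z] near [y], the
    finitely many elements of [alt_no_small_invariant], which preserve [Q z]. *)
Lemma upper_semicontinuity y (W : set X) : Z y -> clopen W ->
  (forall x, W x -> ~ Q y x) ->
  \forall z \near y, Z z -> forall x, W x -> ~ Q z x.
Proof.
move=> Zy cW WQ.
have [ss [ssW ssP]] := alt_no_small_invariant r hX hF cW.
have n : \forall z \near y, forall i : 'I_(size ss), stab z (nth 1 ss i).
  apply: filter_forall => i; apply: stab_near.
  by apply: (Q_alt Zy WQ); apply: ssW; exact: mem_nth.
apply: filterS n => z zs Zz x Wx Qx.
have [s [us sr sQ _ _]] := finQ Zz.
apply: (ssP s sr _ x _ Wx); last exact/sQ.
move=> f p fs ps; have lt_f : (index f ss < size ss)%N by rewrite index_mem.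
have := zs (Ordinal lt_f); rewrite /= nth_index // => -[g [Kg <- gz]].
by apply/sQ/(Q_preserved _ Kg); [exact: germ_unit_fix|exact/sQ].
Qed.

(** Otherwise all [Q z] for [z] near [y] would be empty, and the whole alternating group
    would have trivial germs at these [z]. *)
Lemma Q_nonempty y : Z y -> Q y !=set0.
Proof.
move=> Zy; apply: contrapT => n.
have nQ x : [set: X] x -> ~ Q y x by move=> _ Qx; apply: n; exists x.
have U := upper_semicontinuity Zy (@clopenT X) nQ.
have [z [a [Uz Aa az]]] := Z_moved Zy U.
have Zz := moved_Z Aa az; apply: az; apply/(stabP z (AK Aa)).
by apply: (Q_alt (W := setT) Zz (Uz Zz)); have [] := (AP a).1 Aa.
Qed.

(** An element supported in [W] that moves [q] out of [Q y] does not preserve [Q y]. *)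
Lemma mover y q (W : set X) : Z y -> Q y q -> clopen W -> W q ->
  exists a, [/\ A a, alt F W (bact a) & bact (rho a) y <> y].
Proof.
move=> Zy Qq cW Wq; have [s [_ _ sQ _ _]] := finQ Zy; have [oW _] := cW.
have oS : open (~` [set` s]).
  by apply: closed_openC; apply: (finite_closed hX); exact: finite_seq.
have W0 : W !=set0 by exists q.
have [x Wx xs] := open_minus_finite hX s oW W0.
have WS0 : (W `&` ~` [set` s]) !=set0 by exists x; split=> //; exact/negP.
have [//|f [Wf fs _ _]] := @move_into _ _ hX hF W (~` [set` s]) q [::] oW Wq oS WS0.
have [|a Aa aE] := A_bact (f := f); first exact: altS Wf.
exists a; split=> //; first by rewrite aE.
move=> ay; apply: fs; rewrite -aE; apply/sQ/(Q_preserved _ (AK Aa)) => //.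
Qed.

Lemma near_moved (g : set H) y : full_group H g -> bact g y <> y -> \forall z \near y, bact g z <> z.
Proof.
move=> Fg /eqP gy; have := etale_hausdorff eH; rewrite open_hausdorff.
move=> /(_ _ _ gy)[[B C] /= [/set_mem Bg /set_mem Cy] [oB oC /eqP BC]].
have n1 : nbhs y [set z | B (bact g z)].
  by apply: (bact_continuous eH Fg); exact: open_nbhs_nbhs.
have n2 : nbhs y C by exact: open_nbhs_nbhs.
apply: filterS (filterI n1 n2) => z [/= Bz Cz] e.
have : (B `&` C) z by split=> //; rewrite -e.
by rewrite BC.
Qed.

(** Some element of the alternating group moves [y], hence also the points near [y]. *)
Lemma Z_open : open Z.
Proof.
rewrite openE => y Zy; have [q Qq] := Q_nonempty Zy.
have [a [Aa _ ay]] := mover Zy Qq (@clopenT X) I.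
apply: filterS (near_moved (rho_full (AK Aa)) ay) => z az.
by apply: (moved_Z Aa) => /(germ_unit_fix (AK Aa)).
Qed.

Lemma Z_clopen : clopen Z.
Proof. by split; [exact: Z_open|exact: closed_closure]. Qed.

(** An element supported in [U] that moves [y] also moves the [z] near [y]; it would have
    trivial germ at [z] if [Q z] did not meet [U]. *)
Lemma lower_semicontinuity y q (U : set X) : Z y -> Q y q -> nbhs q U ->
  \forall z \near y, Z z -> exists2 p, Q z p & U p.
Proof.
move=> Zy Qq qU; have [W [cW Wq WU]] := cantor_basis hX qU.
have [a [Aa Wa ay]] := mover Zy Qq cW Wq.
apply: filterS (near_moved (rho_full (AK Aa)) ay) => z az Zz.
apply: contrapT => n; apply: az; apply: (germ_unit_fix (AK Aa)).
apply/(stabP z (AK Aa)); apply: (Q_alt Zz _ Wa) => x Wx Qx.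
by apply: n; exists x => //; exact: WU.
Qed.

End Homomorphism.

(** * The topology of spaces of finite subsets *)

Section Boxes.
Variables (I : finType) (T : topologicalType).
Local Notation box_space := (prod_topology (fun _ : I => T)).

Lemma nbhs_prod_box (f : box_space) (A : set box_space) : nbhs f A ->
  exists N : I -> set T, (forall i, open (N i) /\ N i (f i)) /\
    forall g : box_space, (forall i, N i (g i)) -> A g.
Proof.
move=> fA; pose D : set (I -> set T) := [set N | forall i, open (N i) /\ N i (f i)].
pose B (N : I -> set T) : set box_space := [set g | forall i, N i (g i)].
have FF : Filter (filter_from D B).
  apply: filter_from_filter.
    by exists (fun=> setT) => i; split=> //; exact: openT.
  move=> N M DN DM; exists (fun i => N i `&` M i).
    move=> i; have [oN Ni] := DN i; have [oM Mi] := DM i.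
    by split; [exact: openI|split].
  by move=> g NM; split=> i; have [] := NM i.
have cf : filter_from D B --> f.
  apply/cvg_sup => i U [V] [[W] oW <-] Wf WU.
  exists (fun j => if j == i then W else setT).
    move=> j /=; case: eqP => [->|_]; first by split.
    by split=> //; exact: openT.
  by move=> g /(_ i); rewrite eqxx => Wg; exact: WU.
by have [N DN NA] := cf A fA; exists N; split=> // g Ng; exact: NA.
Qed.

Lemma nbhs_box (f : box_space) (N : I -> set T) :
  (forall i, nbhs (f i) (N i)) -> nbhs f [set g : box_space | forall i, N i (g i)].
Proof.
move=> fN.
apply: (@filter_forall _ I (fun i => [set g : box_space | N i (g i)]) (nbhs f)) => i.
exact: (@proj_continuous I (fun=> T) i f _ (fN i)).
Qed.

End Boxes.

Section FiniteSubsetsTopology.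
Variables (r : nat) (T : topologicalType) (P : set (set T)).
Local Notation FS := (finite_subsets r P).
Local Notation tuples := (set_type (@small_tuple r T P)).

Lemma members_inj (R R' : FS) : members R = members R' -> R = R'.
Proof. exact: val_inj. Qed.

Lemma members_small (R : FS) : small_subset r P (members R).
Proof. exact: set_mem (valP (R : set_type (small_subset r P))). Qed.

Definition fs_of (f : tuples) : FS := subset_of_tuple f.

Lemma members_fs_of (f : tuples) : members (fs_of f) = range (val f).
Proof. by []. Qed.

Lemma fs_ofP (R : FS) : exists f : tuples, fs_of f = R.
Proof.
exists (tuple_of_subset (R : subset_type r P)); exact: tuple_of_subsetK.
Qed.

Lemma pi_fs_of (f : tuples) : \pi_FS%qT f = fs_of f.
Proof. by rewrite /fs_of unlock. Qed.

(** The quotient topology is that of the tuples, which is the subspace topology of a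
    product. *)
Lemma fs_openP (O : set FS) : open O <->
  forall f : tuples, O (fs_of f) -> exists N : 'I_r -> set T,
    (forall i, open (N i) /\ N i (val f i)) /\
    forall g : tuples, (forall i, N i (val g i)) -> O (fs_of g).
Proof.
have E : open O <-> open [set f : tuples | O (fs_of f)].
  suff -> : [set f : tuples | O (fs_of f)] = (\pi_FS%qT) @^-1` O by [].
  by apply/seteqP; split=> f /=; rewrite pi_fs_of.
rewrite E; split=> [[B oB BE] f Of|H].
  have nB : nbhs (val f) B.
    apply: open_nbhs_nbhs; split=> //.
    by have : [set f : tuples | O (fs_of f)] f by []; rewrite -BE.
  have [N [N1 N2]] := nbhs_prod_box nB.
  exists N; split=> // g Ng; have : (set_val @^-1` B) g by exact: N2.
  by rewrite BE.
rewrite openE => f Of; have [N [N1 N2]] := H f Of; rewrite /interior.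
have nN : nbhs (val f) [set g | forall i, N i (g i)].
  by apply: nbhs_box => i; apply: open_nbhs_nbhs; have [] := N1 i.
have n2 : nbhs f ((set_val : tuples -> _) @^-1` [set g | forall i, N i (g i)]).
  exact: (@initial_continuous _ _ (set_val : tuples -> _) f _ nN).
by apply: filterS n2 => g Ng; exact: N2.
Qed.

End FiniteSubsetsTopology.

Section FiniteSubsetsMaps.
Variables (r : nat) (S T : topologicalType) (P : set (set S)) (R : set (set T)).

Lemma fs_map_continuous (phi : S -> T)
    (m : finite_subsets r P -> finite_subsets r R) : continuous phi ->
  (forall Q, members (m Q) = phi @` members Q) -> continuous m.
Proof.
move=> cphi mE; apply/continuousP => O /fs_openP oO; apply/fs_openP => f /= Of.
have small (f' : set_type (@small_tuple r S P)) :
    @small_tuple r T R (fun i => phi (val f' i)).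
  have [M0 _ RM] := members_small (m (fs_of f')).
  have e : range (fun i => phi (val f' i)) = members (m (fs_of f')).
    by rewrite mE members_fs_of image_comp.
  by split; rewrite e.
pose t f' : set_type (@small_tuple r T R) := SigSub (mem_set (small f')).
have tE f' : fs_of (t f') = m (fs_of f').
  by apply: members_inj; rewrite mE !members_fs_of image_comp.
have [|N [N1 N2]] := oO (t f); first by rewrite tE.
exists (fun i => phi @^-1` N i); split.
  move=> i; have [oN Ni] := N1 i; split=> //.
  by move/continuousP: cphi; exact.
by move=> g Ng; rewrite /= -tE; exact: N2.
Qed.

End FiniteSubsetsMaps.

Section FiniteSubsetsOpen.
Variables (r : nat) (T : topologicalType) (P : set (set T)).

Lemma open_fs_sub (U : set T) : open U ->
  open [set R : finite_subsets r P | members R `<=` U].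
Proof.
move=> oU; apply/fs_openP => f fU; exists (fun=> U); split.
  by move=> i; split=> //; apply: fU; exists i.
by move=> g gU _ [i _ <-]; exact: gU.
Qed.

Lemma open_fs_meet (U : set T) : open U ->
  open [set R : finite_subsets r P | exists2 x, members R x & U x].
Proof.
move=> oU; apply/fs_openP => f [_ [i _ <-] Ui].
exists (fun j => if j == i then U else setT); split.
  by move=> j; case: eqP => [->|_]; split=> //; exact: openT.
move=> g /(_ i); rewrite eqxx => Ug.
by exists (val g i) => //; exists i.
Qed.

End FiniteSubsetsOpen.

(** Any tuple whose entries lie in the [D j] and meet all of them is a perturbation of a
    tuple of points of [s] that enumerates [R]; there are finitely many such tuples. *)
Lemma fs_nbhd (X : topologicalType) r (O : set (finite_subsets r [set: set X]))
    (s : seq X) (R : finite_subsets r [set: set X]) : cantor_basics X ->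
  open O -> O R -> uniq s -> (forall x, members R x <-> x \in s) ->
  exists D : 'I_(size s) -> set X,
    [/\ forall j, clopen (D j), forall j, D j (tnth (in_tuple s) j) &
      forall R' : finite_subsets r [set: set X],
        (forall x, members R' x -> exists j, D j x) ->
        (forall j, exists2 x, members R' x & D j x) -> O R'].
Proof.
move=> hX /fs_openP oO OR us sR.
pose t := tnth (in_tuple s).
have R0 : members R !=set0 by have [] := members_small R.
have small (f : {ffun 'I_r -> 'I_(size s)}) : members R `<=` range (fun i => t (f i)) ->
    @small_tuple r X [set: set X] (fun i => t (f i)).
  by move=> Rf; split=> //; have [x Rx] := R0; exists x; exact: Rf.
have /choice[N NP] : forall f : {ffun 'I_r -> 'I_(size s)}, exists N : 'I_r -> set X,
    (forall i, open (N i) /\ N i (t (f i))) /\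
    (members R `<=` range (fun i => t (f i)) ->
     forall g : set_type (@small_tuple r X [set: set X]),
       (forall i, N i (val g i)) -> O (fs_of g)).
  move=> f; have [Rf|nRf] := pselect (members R `<=` range (fun i => t (f i))); last first.
    by exists (fun=> setT); split=> // i; split=> //; exact: openT.
  pose g : set_type (@small_tuple r X [set: set X]) := SigSub (mem_set (small f Rf)).
  have gR : fs_of g = R.
    apply: members_inj; apply/seteqP; split=> // _ [i _ <-].
    by apply/sR; exact: mem_tnth.
  have [|N [N1 N2]] := oO g; first by rewrite gR.
  by exists N; split.
have tI i j : t i = t j -> i = j.
  by move=> /eqP; rewrite /t !(tnth_nth (t i)) nth_uniq // => /eqP/val_inj.
have [j|//|D [cD Dt DN DI]] := @separate_points _ hX _ t
    (fun j => [set x | forall f : {ffun 'I_r -> 'I_(size s)},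
      forall i, f i = j -> N f i x]).
  apply: filter_forall => f; apply: filter_forall => i.
  have [fj|fj] := eqVneq (f i) j; last first.
    by apply: filterE => x e; move: fj; rewrite e eqxx.
  have [/(_ i)[oN Ni] _] := NP f.
  have n : nbhs (t j) (N f i) by apply: open_nbhs_nbhs; rewrite -fj.
  by apply: filterS n => x Nx _.
exists D; split=> // R' cov hit; have [g gR'] := fs_ofP R'.
have /choice[k kP] : forall i, exists j, D j (val g i).
  by move=> i; apply: cov; rewrite -gR'; exists i.
pose f := [ffun i => k i].
have Rf : members R `<=` range (fun i => t (f i)).
  move=> x /sR xs; have lt_x : (index x s < size s)%N by rewrite index_mem.
  have [x' + Dx'] := hit (Ordinal lt_x); rewrite -gR' => -[i _ gi].
  exists i => //; rewrite ffunE (DI (k i) (Ordinal lt_x) x') //; last by rewrite -gi.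
  by rewrite /t (tnth_nth x) /= nth_index.
rewrite -gR'; have [_ /(_ Rf)] := NP f; apply => i.
by apply: (DN (k i)); rewrite // ffunE.
Qed.

(** * Restrictions and symmetric powers *)

Section MultisectionInAlternating.
Variables (X : topologicalType) (G : groupoid X).
Hypotheses (hX : cantor_basics X) (eG : etale G) (minG : minimal_groupoid G)
  (effG : effective_groupoid G).
Local Notation F := (homeo_group G).
Local Notation A := (alternating_group G).

Lemma finite_uniq_seq (T : choiceType) (M : set T) : finite_set M ->
  exists s : seq T, uniq s /\ forall x, M x <-> x \in s.
Proof.
move=> /finite_seqP[s ->]; exists (undup s); split; first exact: undup_uniq.
by move=> x; rewrite mem_undup.
Qed.

(** The arrows of the multisection are germs with distinct sources and distinct targets,
    and [alt_prescribed] applies. *)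
Lemma multisection_alternating (M : set G) : finite_set M -> multisection M ->
  exists2 a, A a & M `<=` a.
Proof.
move=> /finite_uniq_seq[s [us sM]] mM.
pose c (j : 'I_(size s)) : G := tnth (in_tuple s) j.
have cM j : M (c j) by apply/sM; exact: mem_tnth.
have cI i j : c i = c j -> i = j.
  by move=> /eqP; rewrite /c !(tnth_nth (c i)) nth_uniq // => /eqP/val_inj.
have /choice[g gP] : forall j, exists g, full_group G g /\ g (c j).
  by move=> j; have [g Fg gc] := arrow_full hX eG minG effG (c j); exists g.
have hF := homeo_full_dynamics hX eG minG effG.
have [|||i j e|i j e|f Af fP] := @alt_prescribed _ _ hX hF setT _ openT
    (fun j => gsrc (c j)) (fun j => bact (g j)) => //.
- by move=> j; apply: homeo_bact; have [] := gP j.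
- apply: cI; apply: contrapT => ne.
  by have [] := mM _ _ (cM i) (cM j) ne.
- apply: cI; apply: contrapT => ne; have [_] := mM _ _ (cM i) (cM j) ne; apply.
  by have [Fi gi] := gP i; have [Fj gj] := gP j; move: e; rewrite !bactE.
have [a Aa aE] := A_bact hX eG minG effG Af.
have [Fa _] := (alternatingP hX eG minG effG a).1 Aa.
exists a => // b /sM bs; have lt_b : (index b s < size s)%N by rewrite index_mem.
have -> : b = c (Ordinal lt_b) by rewrite /c (tnth_nth b) /= nth_index.
move: (Ordinal lt_b) => j {b bs lt_b}; have [Fj gj] := gP j.
have e : germ a (gsrc (c j)) = germ (g j) (gsrc (c j)).
  by apply: (near_germ eG effG) => //; rewrite aE; exact: fP.
by rewrite (full_groupP _ Fa) e germ_full.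
Qed.

End MultisectionInAlternating.

Section RestrictionTopology.
Variables (Y : topologicalType) (H : groupoid Y) (Z : set Y).
Hypotheses (eH : etale H) (cZ : clopen Z).
Local Notation HZ := (restriction H Z).
Implicit Types (b c : HZ).

Lemma restr_src_val b : val (gsrc b) = gsrc (val b). Proof. by []. Qed.
Lemma restr_rng_val b : val (grng b) = grng (val b). Proof. by []. Qed.
Lemma restr_in b : Z (gsrc (val b)) /\ Z (grng (val b)).
Proof. exact: (set_mem (valP b)). Qed.

Lemma restr_of (a : H) : Z (gsrc a) -> Z (grng a) -> exists b : HZ, val b = a.
Proof.
move=> Zs Zr; have Ra : restr_arrow Z a by [].
by exists (SigSub (mem_set Ra)).
Qed.

Lemma open_restr_arrow : open (restr_arrow (H := H) Z).
Proof.
by apply: openI; [exact: (open_gsrc eH cZ.1)|exact: (open_grng eH cZ.1)].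
Qed.

Lemma restr_openP (T : set HZ) : open T <->
  exists2 B : set H, open B & forall b, T b <-> B (val b).
Proof.
split=> [[B oB BE]|[B oB BE]].
  by exists B => // b; rewrite -BE.
by exists B => //; apply/seteqP; split=> b /BE.
Qed.

Lemma restr_src_continuous : continuous (@gsrc _ HZ).
Proof.
apply/continuousP => U [V oV VE].
exists [set a : H | V (gsrc a)]; first exact: (open_gsrc eH).
by rewrite -VE.
Qed.

Lemma restr_rng_continuous : continuous (@grng _ HZ).
Proof.
apply/continuousP => U [V oV VE].
exists [set a : H | V (grng a)]; first exact: (open_grng eH).
by rewrite -VE.
Qed.

Lemma restr_src_open : open_map (@gsrc _ HZ).
Proof.
move=> T /restr_openP[B oB BE]; have [oM _] := etale_src eH.
exists (@gsrc Y H @` (B `&` restr_arrow (H := H) Z)).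
  by apply: oM; apply: openI => //; exact: open_restr_arrow.
apply/seteqP; split=> [z [a [Ba [Zs Zr]] az]|_ [b /BE Bb <-]].
  have [b bE] := restr_of Zs Zr; exists b; first by apply/BE; rewrite bE.
  by apply: val_inj; rewrite restr_src_val bE.
by exists (val b) => //; split=> //; exact: restr_in.
Qed.

Lemma restr_rng_open : open_map (@grng _ HZ).
Proof.
move=> T /restr_openP[B oB BE]; have [oM _] := etale_rng eH.
exists (@grng Y H @` (B `&` restr_arrow (H := H) Z)).
  by apply: oM; apply: openI => //; exact: open_restr_arrow.
apply/seteqP; split=> [z [a [Ba [Zs Zr]] az]|_ [b /BE Bb <-]].
  have [b bE] := restr_of Zs Zr; exists b; first by apply/BE; rewrite bE.
  by apply: val_inj; rewrite restr_rng_val bE.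
by exists (val b) => //; split=> //; exact: restr_in.
Qed.

Lemma restr_bisectionI (T : set HZ) : open T -> src_inj T -> rng_inj T -> bisection T.
Proof.
move=> oT sT rT; split=> //.
- apply: (@homeo_on_open_inj _ _ _ _ (@gunit _ HZ)) => //.
  + exact: restr_src_continuous.
  + exact: restr_src_open.
- apply: (@homeo_on_open_inj _ _ _ _ (@gunit _ HZ)) => //.
  + exact: restr_rng_continuous.
  + exact: restr_rng_open.
Qed.

Lemma restr_mul_val b c : gsrc b = grng c -> val (gmul b c) = gmul (val b) (val c).
Proof. exact: val_restr_mul. Qed.

End RestrictionTopology.

Section SymmetricTopology.
Variables (X : topologicalType) (G : groupoid X) (r : nat).
Hypotheses (eG : etale G).
Local Notation Gr := (symmetric_groupoid G r).
Local Notation Xr := (symmetric_power r X).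
Implicit Types (a g : set G) (R : Gr) (P : Xr) (T : set Gr).

Definition arrows R : set G := members (R : sym_arrow G r).

Lemma arrows_inj R R' : arrows R = arrows R' -> R = R'.
Proof. exact: members_inj. Qed.

Lemma members_src R : members (gsrc R : Xr) = @gsrc X G @` arrows R.
Proof. by []. Qed.

Lemma members_rng R : members (grng R : Xr) = @grng X G @` arrows R.
Proof. by []. Qed.

Lemma arrows_unit P : arrows (gunit Gr P) = @gunit X G @` members P.
Proof. by []. Qed.

Lemma arrows_mul R R' : gsrc R = grng R' ->
  arrows (gmul R R') = set_mul (arrows R) (arrows R').
Proof. exact: members_sym_mul. Qed.

Lemma arrows_multisection R : multisection (arrows R).
Proof. by have [] := members_small (R : sym_arrow G r). Qed.

Lemma members_finite (Q : Xr) : finite_set (members Q).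
Proof.
have [_ Qr _] := members_small Q; apply: card_le_finite Qr _; exact: finite_II.
Qed.

Lemma arrows_finite R : finite_set (arrows R).
Proof.
have [_ Rr _] := members_small (R : sym_arrow G r).
by apply: card_le_finite Rr _; exact: finite_II.
Qed.

Lemma section_small a P : full_group G a ->
  small_subset r (multisection (G := G)) (germ a @` members P).
Proof.
move=> Fa; have [P0 Pr _] := members_small P; split; first exact: image_nonempty.
  exact: card_le_trans (card_image_le _ _) Pr.
move=> _ _ [x _ <-] [y _ <-] ne; rewrite !gsrc_germ // !grng_germ //.
by split=> [e|/(@b_inj _ _ _ _) e]; apply: ne; rewrite e.
Qed.

Definition sec a (Fa : full_group G a) P : Gr := SigSub (mem_set (section_small P Fa)).

Lemma arrows_sec a (Fa : full_group G a) P : arrows (sec Fa P) = germ a @` members P.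
Proof. by []. Qed.

Lemma sec_continuous a (Fa : full_group G a) : continuous (sec Fa).
Proof.
apply: (@fs_map_continuous r X G _ _ (germ a)) => //.
exact: (germ_continuous eG).
Qed.

Lemma sym_src_continuous : continuous (@gsrc _ Gr).
Proof.
apply: (@fs_map_continuous r G X _ _ (@gsrc X G)) => //.
exact: (gsrc_continuous eG).
Qed.

Lemma sym_rng_continuous : continuous (@grng _ Gr).
Proof.
apply: (@fs_map_continuous r G X _ _ (@grng X G)) => //.
exact: (grng_continuous eG).
Qed.

Lemma sec_src a (Fa : full_group G a) R : arrows R `<=` a -> sec Fa (gsrc R) = R.
Proof.
move=> Ra; apply: arrows_inj; rewrite arrows_sec members_src image_comp.
rewrite -[RHS]image_id; apply: eq_imagel => c Rc /=.
by rewrite germ_full //; exact: Ra.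
Qed.

Lemma src_sec a (Fa : full_group G a) P : gsrc (sec Fa P) = P.
Proof.
apply: members_inj; rewrite members_src arrows_sec image_comp.
by rewrite -[RHS]image_id; apply: eq_imagel => x _ /=; rewrite gsrc_germ.
Qed.

Lemma open_sym_elt a : full_group G a -> open (sym_elt r a).
Proof. by move=> [[oa _ _] _ _]; exact: open_fs_sub. Qed.

Lemma sym_eltP a R : sym_elt r a R <-> arrows R `<=` a.
Proof. by []. Qed.

Lemma sub_sym_elt_bisection a T : full_group G a -> open T -> T `<=` sym_elt r a ->
  bisection T.
Proof.
move=> Fa oT Ta; split=> //.
- exists (sec Fa); split.
  + by move=> R; rewrite inE => /Ta; exact: sec_src.
  + exact/continuous_subspaceT/sym_src_continuous.
  + exact/continuous_subspaceT/sec_continuous.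
- have Fa' := full_inv eG Fa.
  exists (fun P => sec Fa (grng (sec Fa' P))); split.
  + move=> R; rewrite inE => /Ta Ra; rewrite -[RHS](sec_src Fa Ra); congr sec.
    apply: members_inj; rewrite members_rng members_src arrows_sec members_rng.
    rewrite !image_comp; apply: eq_imagel => c Rc /=.
    have ac := Ra _ Rc; rewrite -(bactE Fa ac) germ_inv // germ_full // grng_inv.
    by [].
  + exact/continuous_subspaceT/sym_rng_continuous.
  + apply: continuous_subspaceT => P; apply: continuous_comp; last exact: sec_continuous.
    apply: continuous_comp; [exact: sec_continuous|exact: sym_rng_continuous].
Qed.

(** The idempotent of the pseudogroup that corresponds to the open set [O]. *)
Definition unit_over (O : set Xr) : set Gr := @gunit _ Gr @` O.

Lemma unit_overE O R : unit_over O R <-> arrows R `<=` unit_space G /\ O (gsrc R).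
Proof.
split=> [[P OP <-]|[Ru OR]].
  split; first by rewrite arrows_unit => _ [x _ <-]; exists x.
  by rewrite gsrc_unit.
exists (gsrc R) => //; apply: arrows_inj; rewrite arrows_unit members_src image_comp.
rewrite -[RHS]image_id; apply: eq_imagel => c /Ru[x _ <-] /=.
by rewrite gsrc_unit.
Qed.

Lemma open_unit_over O : open O -> open (unit_over O).
Proof.
move=> oO; have -> : unit_over O =
    [set R | arrows R `<=` unit_space G] `&` (@gsrc _ Gr @^-1` O).
  by apply/seteqP; split=> R /unit_overE.
apply: openI; first exact/open_fs_sub/open_unit_space.
by move/continuousP: sym_src_continuous; exact.
Qed.

Lemma unit_over_bisection O : open O -> bisection (unit_over O).
Proof.
move=> oO; apply: (sub_sym_elt_bisection (full_unit eG)).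
  exact: open_unit_over.
by move=> R /unit_overE[].
Qed.

Lemma sym_elt_bisection a : full_group G a -> bisection (sym_elt r a).
Proof. by move=> Fa; apply: (sub_sym_elt_bisection Fa) => //; exact: open_sym_elt. Qed.

End SymmetricTopology.

(** * The morphism defined on the symmetric power *)

Lemma set_invK (X : topologicalType) (G : groupoid X) (T : set G) :
  set_inv (set_inv T) = T.
Proof. by apply/seteqP; split=> a; rewrite !set_invE ginvK. Qed.

Section Extension.
Variables (X Y : topologicalType) (G : groupoid X) (H : groupoid Y).
Hypotheses (hX : cantor_basics X) (eG : etale G) (minG : minimal_groupoid G)
  (effG : effective_groupoid G) (eH : etale H).
Variables (K : set (set G)) (rho : set G -> set H).
Hypotheses (SK : subgroup K) (AK : alternating_group G `<=` K)
  (hrho : group_morphism K rho).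
Variable r : nat.
Local Notation F := (homeo_group G).
Local Notation A := (alternating_group G).
Let Z := group_supp (rho @` A).
Local Notation stab := (stab K rho).
Local Notation Q := (attached_set K rho).
Hypothesis finQ : controlled K rho r.
Implicit Types (a b g h : set G) (x p q : X) (y z : Y) (f : bijection X).
Local Notation HZ := (restriction H Z).
Local Notation Gr := (symmetric_groupoid G r).
Local Notation Xr := (symmetric_power r X).
Implicit Types (R : Gr) (T S : set Gr) (al be : HZ).

Let cZ : clopen Z := Z_clopen hX eG minG effG eH SK AK hrho finQ.
Let Kfull := K_full SK.
Let rfull := rho_full hrho.
Let Afull a : A a -> full_group G a := fun Aa => K_full SK (AK Aa).
Let Amul a b : A a -> A b -> A (set_mul a b) := @A_mul _ _ eG a b.
Let Ainv a : A a -> A (set_inv a) := @A_inv _ _ eG a.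
Let Arho a : A a -> full_group H (rho a) := fun Aa => rho_full hrho (AK Aa).
Let AM a b : A a -> A b -> rho (set_mul a b) = set_mul (rho a) (rho b).
Proof. by move=> Aa Ab; apply: (rho_mul hrho); exact: AK. Qed.
Let AV a : A a -> rho (set_inv a) = set_inv (rho a).
Proof. by move=> Aa; apply: (rho_inv eG eH SK hrho); exact: AK. Qed.
Let QE a y x : K a -> Q (bact (rho a) y) (bact a x) <-> Q y x.
Proof. by move=> Ka; apply: (Q_equivariant hX eG minG effG eH SK hrho). Qed.
Let ZE a y : K a -> Z (bact (rho a) y) <-> Z y.
Proof. by move=> Ka; apply: (Z_invariantP hX eG minG effG eH SK AK hrho). Qed.
Let Qtriv y a : Z y -> A a -> (forall q, Q y q -> germ a q = gunit G q) ->
  germ (rho a) y = gunit H y.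
Proof. by move=> Zy Aa; exact: (Q_trivial hX eG minG effG SK AK finQ). Qed.

Lemma Q_small y : Z y -> small_subset r [set: set X] (Q y).
Proof.
move=> Zy; have [s [us sr sQ _ _]] := finQ Zy; split=> //.
  exact: (Q_nonempty hX eG minG effG eH SK AK hrho finQ).
have [x0 _] := Q_nonempty hX eG minG effG eH SK AK hrho finQ Zy.
have -> : Q y = nth x0 s @` `I_(size s).
  apply/seteqP; split=> [x /sQ xs|_ [k ks <-]]; last exact/sQ/mem_nth.
  by exists (index x s); rewrite /= ?index_mem ?nth_index.
apply: card_le_trans (card_image_le _ _) _.
by rewrite card_le_II.
Qed.

Lemma Q_point y : Z y -> exists P : Xr, members P = Q y.
Proof. by move=> Zy; exists (SigSub (mem_set (Q_small Zy))). Qed.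

Lemma Q_finite y : Z y -> finite_set (Q y).
Proof.
move=> Zy; have [P <-] := Q_point Zy; exact: members_finite.
Qed.

(** The two semicontinuities: [Q z] is covered by, and meets all of, small neighbourhoods
    of the points of [Q y]. *)
Lemma Q_continuous y (O : set Xr) (P : Xr) : Z y -> open O -> O P -> members P = Q y ->
  \forall z \near y, Z z -> forall P' : Xr, members P' = Q z -> O P'.
Proof.
move=> Zy oO OP PQ; have [s [us sr sQ _ _]] := finQ Zy.
have [|D [cD Ds DO]] := fs_nbhd hX oO OP us; first by move=> x; rewrite PQ.
pose D' := \big[setU/set0]_(j < size s) D j.
have cD' : clopen D'.
  apply: (big_ind (@clopen X)); first exact: clopen0.
    by move=> ? ?; exact: clopenU.
  by move=> j _.
have D'P x : D' x <-> exists j, D j x.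
  rewrite /D'; split=> [|[j Dj]]; last by rewrite (bigD1 j) //=; left.
  by elim/big_ind: _ => [//|B C IB IC [/IB|/IC]//|j _ Dj]; exists j.
have cW : clopen (~` D').
  by case: cD' => oD kD; split; [exact: closed_openC|exact: open_closedC].
have WQ x : (~` D') x -> ~ Q y x.
  move=> nD /sQ xs; apply: nD; apply/D'P.
  have lt_x : (index x s < size s)%N by rewrite index_mem.
  exists (Ordinal lt_x); have := Ds (Ordinal lt_x).
  by rewrite (tnth_nth x) /= nth_index.
have up := upper_semicontinuity hX eG minG effG eH SK hrho finQ Zy cW WQ.
have lo : \forall z \near y, forall j, Z z -> exists2 p, Q z p & D j p.
  apply: filter_forall => j.
  apply: (lower_semicontinuity hX eG minG effG eH SK AK hrho finQ (q := tnth (in_tuple s) j)) => //.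
    by apply/sQ; exact: mem_tnth.
  by apply: open_nbhs_nbhs; split=> //; case: (cD j).
apply: filterS (filterI up lo) => z [zu zl] Zz P' P'Q; apply: DO.
  move=> x; rewrite P'Q => Qx; apply/D'P; apply: contrapT => nD.
  exact: (zu Zz x nD).
by move=> j; rewrite P'Q; exact: zl.
Qed.

(** By [Q_trivial] for [b^-1 a]. *)
Lemma rho_germ_eq y a b : Z y -> A a -> A b ->
  (forall q, Q y q -> germ a q = germ b q) -> germ (rho a) y = germ (rho b) y.
Proof.
move=> Zy Aa Ab ab; have [Fa Fb] := (Afull Aa, Afull Ab).
have [Ra Rb] := (Arho Aa, Arho Ab); have Ab' := Ainv Ab; have Fb' := full_inv eG Fb.
have Rb' := full_inv eH Rb.
have bab q : Q y q -> bact a q = bact b q by move=> Qq; rewrite -!grng_germ // ab.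
have e : germ (rho (set_mul (set_inv b) a)) y = gunit H y.
  apply: Qtriv => //; first exact: Amul.
  move=> q Qq; rewrite germ_mul // bab // germ_inv // ab // gVmul.
  by rewrite gsrc_germ.
rewrite AM // AV // germ_mul // in e.
have yy : bact (rho b) y = bact (rho a) y.
  have := congr1 (@grng Y H) e; rewrite grng_unit grng_mul; last first.
    by rewrite gsrc_germ // grng_germ.
  by rewrite grng_germ // bact_inv // => E; rewrite -{1}E bVK.
rewrite -yy germ_inv // in e.
have c : gsrc (germ (rho b) y) = gsrc (germ (rho b) y) by [].
have ca : gsrc (ginv (germ (rho b) y)) = grng (germ (rho a) y).
  by rewrite gsrc_inv !grng_germ.
have := congr1 (gmul (germ (rho b) y)) e.
rewrite gmulA ?grng_inv // gmulV unit_mull; last by rewrite !grng_germ.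
by rewrite unit_mulr // gsrc_germ.
Qed.

(** An arrow of the symmetric power with source [Q y] is the set of germs at [Q y] of some
    [a] of the alternating group, and it is sent to the germ of [rho a] at [y].  By
    [rho_germ_eq] the choice of [a] does not matter. *)
Definition rhot T : set HZ := [set al | exists a R, [/\ A a, T R,
  arrows R = germ a @` Q (gsrc (val al)) & val al = germ (rho a) (gsrc (val al))]].

Let ZP al : Z (gsrc (val al)). Proof. by have [] := restr_in al. Qed.

Lemma arrows_germ_src a (Q1 : set X) : full_group G a ->
  @gsrc X G @` (germ a @` Q1) = Q1.
Proof.
move=> Fa; rewrite image_comp -[RHS]image_id; apply: eq_imagel => x _ /=.
by rewrite gsrc_germ.
Qed.

Lemma arrows_germ_rng a y : A a -> @grng X G @` (germ a @` Q y) = Q (bact (rho a) y).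
Proof.
move=> Aa; have Fa := Afull Aa; rewrite image_comp; apply/seteqP; split.
  by move=> _ [q Qq <-] /=; rewrite grng_germ //; apply/(QE _ _ (AK Aa)).
move=> p; rewrite -(bVK (bact a) p) => /(QE _ _ (AK Aa)) Qq.
by exists ((bact a)^-1 p) => //=; rewrite grng_germ.
Qed.

Lemma germ_image_eq a b (Q1 : set X) : full_group G a -> full_group G b ->
  germ a @` Q1 = germ b @` Q1 -> forall q, Q1 q -> germ a q = germ b q.
Proof.
move=> Fa Fb e q Qq; have : (germ a @` Q1) (germ a q) by exists q.
rewrite e => -[q' Qq' e']; have := congr1 (@gsrc X G) e'; rewrite !gsrc_germ // => qq.
by rewrite -e' qq.
Qed.

Lemma Q_of_arrows R a y : full_group G a -> arrows R = germ a @` Q y ->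
  members (gsrc R : Xr) = Q y.
Proof. by move=> Fa RE; rewrite members_src RE arrows_germ_src. Qed.

Lemma arrows_alternating R y : members (gsrc R : Xr) = Q y ->
  exists2 a, A a & arrows R = germ a @` Q y.
Proof.
move=> RQ; have [a Aa Ra] := multisection_alternating hX eG minG effG
  (arrows_finite R) (@arrows_multisection _ _ _ R).
exists a => //; rewrite -RQ members_src image_comp -[LHS]image_id.
apply: eq_imagel => c Rc /=; have ac := Ra _ Rc.
by rewrite (germ_full (Afull Aa) ac).
Qed.

(** If [a] represents an arrow at [y], then it represents the arrows at the points near
    [y], by continuity of [Q], and [rho a] is open. *)
Lemma rhot_open T : open T -> open (rhot T).
Proof.
move=> oT; rewrite openE => al Tal.
suff [B [oB Bal BT]] : exists B : set H, [/\ open B, B (val al) &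
    forall be, B (val be) -> rhot T be].
  have n : nbhs al [set be : HZ | B (val be)].
    by apply: open_nbhs_nbhs; split=> //; apply/restr_openP; exists B.
  by rewrite /interior; apply: filterS n => be; exact: BT.
have [a [R [Aa TR RE alE]]] := Tal; have Fa := Afull Aa.
set y := gsrc (val al) in RE alE.
have Zy : Z y := @ZP al.
have [P PQ] := Q_point Zy.
pose O : set Xr := [set P' | T (sec Fa P')].
have oO : open O by have /continuousP := @sec_continuous X G r eG a Fa; apply.
have OP : O P.
  rewrite /O /mkset (_ : sec Fa P = R) //; apply: arrows_inj.
  by rewrite arrows_sec PQ RE.
have := Q_continuous Zy oO OP PQ; rewrite /prop_near1 nbhsE => -[U [oU Uy] UP].
exists (rho a `&` [set c | U (gsrc c)]); split.
- apply: openI; last exact: (open_gsrc eH).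
  by have [[]] := Arho Aa.
- split; last by [].
  by rewrite alE; have [] := germ_in y (Arho Aa).
- move=> be [rb Ub]; have Zb := @ZP be; have [P' P'Q] := Q_point Zb.
  exists a, (sec Fa P'); split=> //.
  + by apply: (UP _ Ub).
  + by rewrite arrows_sec P'Q.
  + by rewrite germ_full //; exact: Arho.
Qed.

Lemma rhot_src_inj T : src_inj T -> src_inj (rhot T).
Proof.
move=> sT al be [a [R [Aa TR RE alE]]] [b [S [Ab TS SE beE]]] /(congr1 val).
rewrite !restr_src_val => e; rewrite -e in SE beE.
have RS : R = S.
  apply: sT => //; apply: members_inj.
  by rewrite (Q_of_arrows (Afull Aa) RE) (Q_of_arrows (Afull Ab) SE).
apply: val_inj; rewrite alE beE; apply: rho_germ_eq => //.
by apply: germ_image_eq; [exact: Afull|exact: Afull|rewrite -RE -SE RS].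
Qed.

Lemma rhot_rng_inj T : rng_inj T -> rng_inj (rhot T).
Proof.
move=> rT al be [a [R [Aa TR RE alE]]] [b [S [Ab TS SE beE]]] /(congr1 val).
rewrite !restr_rng_val; set y := gsrc (val al) in RE alE.
set z := gsrc (val be) in SE beE; rewrite alE beE !grng_germ; [|exact: Arho..].
move=> e; have RS : R = S.
  apply: rT => //; apply: members_inj.
  by rewrite !members_rng RE SE !arrows_germ_rng // e.
have Qyz : Q z = Q y.
  by rewrite -(Q_of_arrows (Afull Aa) RE) -(Q_of_arrows (Afull Ab) SE) RS.
rewrite Qyz in SE; have ab : germ (rho a) y = germ (rho b) y.
  apply: rho_germ_eq => //; first exact: ZP.
  by apply: germ_image_eq; [exact: Afull|exact: Afull|rewrite -RE -SE RS].
have yz : y = z.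
  apply: (@b_inj _ (bact (rho b))); rewrite -e -grng_germ; last exact: Arho.
  by rewrite -ab grng_germ //; exact: Arho.
by apply: val_inj; rewrite alE beE ab yz.
Qed.

Lemma rhot_bisection T : bisection T -> bisection (rhot T).
Proof.
move=> bT; have [oT _ _] := bT; apply: (restr_bisectionI eH cZ).
- exact: rhot_open.
- exact/rhot_src_inj/bisection_src.
- exact/rhot_rng_inj/bisection_rng.
Qed.

Lemma germ_image_mul a b y : A a -> A b ->
  set_mul (germ a @` Q (bact (rho b) y)) (germ b @` Q y) = germ (set_mul a b) @` Q y.
Proof.
move=> Aa Ab; have [Fa Fb] := (Afull Aa, Afull Ab).
apply/seteqP; split=> [_ [_ [_ [[p Qp <-] [q Qq <-] e ->]]]|_ [q Qq <-]].
  exists q => //; rewrite germ_mul //; congr (gmul (germ a _) _).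
  by move: e; rewrite gsrc_germ // grng_germ.
rewrite germ_mul //; exists (germ a (bact b q)), (germ b q); split=> //.
- by exists (bact b q) => //; apply/(QE _ _ (AK Ab)).
- by rewrite gsrc_germ // grng_germ.
Qed.

Lemma restr_germ a y : Z y -> A a -> exists al : HZ, val al = germ (rho a) y.
Proof.
move=> Zy Aa; have Ra := Arho Aa.
have Zs : Z (gsrc (germ (rho a) y)) by rewrite gsrc_germ.
have Zr : Z (grng (germ (rho a) y)) by rewrite grng_germ //; apply/(ZE _ (AK Aa)).
exact: (restr_of Zs Zr).
Qed.

Lemma rhot_mul T S : rhot (set_mul T S) = set_mul (rhot T) (rhot S).
Proof.
apply/seteqP; split=> al.
  move=> [a [R [Aa [R1 [R2 [TR1 SR2 e12 ->]]] RE alE]]].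
  set y := gsrc (val al) in RE alE; have Zy : Z y := @ZP al; have Fa := Afull Aa.
  have R2Q : members (gsrc R2 : Xr) = Q y.
    by rewrite -(Q_of_arrows Fa RE) gsrc_mul.
  have [b Ab R2E] := arrows_alternating R2Q; have [Fb Rb] := (Afull Ab, Arho Ab).
  have R1Q : members (gsrc R1 : Xr) = Q (bact (rho b) y).
    by rewrite e12 members_rng R2E arrows_germ_rng.
  have [c Ac R1E] := arrows_alternating R1Q; have [Fc Rc] := (Afull Ac, Arho Ac).
  have Zby : Z (bact (rho b) y) by apply/(ZE _ (AK Ab)).
  have [be beE] := restr_germ Zy Ab; have [ga gaE] := restr_germ Zby Ac.
  have comp : gsrc ga = grng be.
    by apply: val_inj; rewrite restr_src_val restr_rng_val gaE beE gsrc_germ // grng_germ.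
  exists ga, be; split=> //.
  - by exists c, R1; rewrite gaE gsrc_germ.
  - by exists b, R2; rewrite beE gsrc_germ.
  - apply: val_inj; rewrite restr_mul_val // alE gaE beE.
    rewrite -germ_mul // -AM //; apply: rho_germ_eq => //; first exact: Amul.
    apply: germ_image_eq => //; first exact: full_mul.
    by rewrite -RE arrows_mul // R1E R2E germ_image_mul.
move=> [ga [be [[c [R1 [Ac TR1 R1E gaE]]] [b [R2 [Ab SR2 R2E beE]]] comp ->]]].
have [Fc Fb] := (Afull Ac, Afull Ab); have [Rc Rb] := (Arho Ac, Arho Ab).
set y := gsrc (val be) in R2E beE; have Zy : Z y := @ZP be.
have gy : gsrc (val ga) = bact (rho b) y.
  by have := congr1 val comp; rewrite restr_src_val restr_rng_val beE grng_germ.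
rewrite gy in R1E gaE.
have e12 : gsrc R1 = grng R2.
  apply: members_inj; rewrite (Q_of_arrows Fc R1E) members_rng R2E.
  by rewrite arrows_germ_rng.
have vE : val (gmul ga be) = germ (rho (set_mul c b)) y.
  by rewrite restr_mul_val // gaE beE AM // germ_mul.
have Acb := Amul Ac Ab; have Rcb := Arho Acb.
exists (set_mul c b), (gmul R1 R2); rewrite vE gsrc_germ //; split=> //.
- by exists R1, R2.
- by rewrite arrows_mul // R1E R2E germ_image_mul.
Qed.

Lemma rhot_bigcup (E : set (set Gr)) :
  rhot (\bigcup_(T in E) T) = \bigcup_(T in E) rhot T.
Proof.
apply/seteqP; split=> [al [a [R [Aa [T ET TR] RE alE]]]|al [T ET [a [R [Aa TR RE alE]]]]].
  by exists T => //; exists a, R.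
by exists a, R; split=> //; exists T.
Qed.

Lemma rhot0 : rhot set0 = set0.
Proof. by rewrite -subset0 => al [a [R []]]. Qed.

Lemma rhot_unit : rhot (unit_space Gr) = unit_space HZ.
Proof.
apply/seteqP; split=> [al [a [R [Aa [P _ RP] RE alE]]]|_ [w _ <-]].
  have Fa := Afull Aa; set y := gsrc (val al) in RE alE; have Zy : Z y := @ZP al.
  have aQ q : Q y q -> germ a q = gunit G q.
    move=> Qq; have : arrows R (germ a q) by rewrite RE; exists q.
    rewrite -RP arrows_unit => -[x _ xe].
    by have := congr1 (@gsrc X G) xe; rewrite gsrc_unit gsrc_germ // -xe => ->.
  exists (gsrc al) => //; apply: val_inj; rewrite alE (Qtriv Zy Aa aQ).
  by [].
have Zw : Z (val w) := set_mem (valP w); have [P PQ] := Q_point Zw.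
exists (unit_space G), (gunit Gr P); split.
- exact: A_unit.
- by exists P.
- rewrite arrows_unit PQ (_ : gsrc _ = val w); last exact: (gsrc_unit H).
  by apply: eq_imagel => x _; rewrite germ_unit.
- rewrite (rho_unit eH SK hrho) germ_unit //.
  by rewrite (_ : gsrc _ = val w) //; exact: (gsrc_unit H).
Qed.

Lemma rhot_morphism : continuous_morphism rhot.
Proof.
split; [exact: rhot_bisection|by move=> T S _ _; exact: rhot_mul| |exact: rhot0|exact: rhot_unit].
by move=> E _ _; exact: rhot_bigcup.
Qed.

(** The value of the extension on the group, extended by units outside of [Z]. *)
Definition rt g : set H := ext_unit (rhot (sym_elt r g)).

(** An element [g] of [K] need not lie in the alternating group, but it has the same germs
    at [Q y] as some [a] there; this computes [rt g] at [y]. *)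
Lemma matching g y : K g -> Z y ->
  exists2 a, A a & forall q, Q y q -> germ a q = germ g q.
Proof.
move=> Kg Zy; have Fg := Kfull Kg; have [P PQ] := Q_point Zy.
have [|a Aa gE] := @arrows_alternating (sec Fg P) y.
  by rewrite src_sec.
exists a => // q Qq; apply/esym/(germ_image_eq Fg (Afull Aa) _ Qq).
by rewrite -gE arrows_sec PQ.
Qed.

Lemma rt_on_Z g a y : full_group G g -> Z y -> A a ->
  (forall q, Q y q -> germ a q = germ g q) -> rt g (germ (rho a) y).
Proof.
move=> Fg Zy Aa ag; left; have [al alE] := restr_germ Zy Aa; exists al => //.
have [P PQ] := Q_point Zy; have Fa := Afull Aa.
exists a, (sec Fa P); rewrite alE gsrc_germ; last exact: Arho.
split=> //; last by rewrite arrows_sec PQ.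
apply/sym_eltP; rewrite arrows_sec PQ => _ [q Qq <-]; rewrite ag //.
by have [] := germ_in q Fg.
Qed.

Lemma rt_off_Z g y : ~ Z y -> rt g (gunit H y).
Proof. by move=> nZ; right; exists y. Qed.

Lemma rt_inv g c : full_group G g -> rt g c ->
  (Z (gsrc c) /\ exists2 a, A a /\ (forall q, Q (gsrc c) q -> germ a q = germ g q) &
     c = germ (rho a) (gsrc c)) \/ (~ Z (gsrc c) /\ c = gunit H (gsrc c)).
Proof.
move=> Fg [[al [a [R [Aa Rg RE alE]]] <-]|[z nz <-]]; last by right; rewrite gsrc_unit.
left; split; first exact: ZP.
exists a => //; split=> // q Qq; have Ra : arrows R (germ a q) by rewrite RE; exists q.
have := Rg _ Ra; move=> /(germ_full Fg) <-.
by rewrite gsrc_germ //; exact: Afull.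
Qed.

Lemma rt_src_inj g : K g -> src_inj (rt g).
Proof.
move=> Kg; have Fg := Kfull Kg.
move=> c d /(rt_inv Fg)[[Zc [a [Aa aQ] cE]]|[nZc cE]]
  /(rt_inv Fg)[[Zd [b [Ab bQ] dE]]|[nZd dE]] e.
- rewrite -e in bQ dE; rewrite cE dE; apply: rho_germ_eq => // q Qq.
  by rewrite aQ // bQ.
- by case: nZd; rewrite -e.
- by case: nZc; rewrite e.
- by rewrite cE dE e.
Qed.

Lemma rt_germ g a y : K g -> Z y -> A a ->
  (forall q, Q y q -> germ a q = germ g q) -> germ (rt g) y = germ (rho a) y.
Proof.
move=> Kg Zy Aa ag; have := rt_on_Z (Kfull Kg) Zy Aa ag.
move=> /(germE (rt_src_inj Kg)); rewrite gsrc_germ //; exact: Arho.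
Qed.

Lemma rt_germ0 g y : K g -> ~ Z y -> germ (rt g) y = gunit H y.
Proof.
move=> Kg nZ; have := @rt_off_Z g y nZ.
by move=> /(germE (rt_src_inj Kg)); rewrite gsrc_unit.
Qed.

Lemma rt_full g : K g -> full_group H (rt g).
Proof.
move=> Kg; have Fg := Kfull Kg.
have so : open (rt g).
  apply: openU.
    have := rhot_open (open_sym_elt r Fg) => /restr_openP[B oB BE].
    have -> : [set val x | x in rhot (sym_elt r g)] = B `&` restr_arrow (H := H) Z.
      apply/seteqP; split=> [_ [al /BE Bal <-]|c [Bc [Zs Zr]]].
        by split=> //; exact: restr_in.
      by have [al alE] := restr_of Zs Zr; exists al => //; apply/BE; rewrite alE.
    by apply: openI => //; exact: (open_restr_arrow eH cZ).
  have -> : gunit H @` (~` Z) = unit_space H `&` [set c | (~` Z) (gsrc c)].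
    apply/seteqP; split=> [_ [z nz <-]|_ [[z _ <-]]]; rewrite /= gsrc_unit.
      by split=> //; exists z.
    by exists z.
  apply: openI; first exact: open_unit_space.
  by apply: (open_gsrc eH); apply: closed_openC; case: cZ.
have rI : rng_inj (rt g).
  move=> c d /(rt_inv Fg)[[Zc [a [Aa aQ] cE]]|[nZc cE]]
    /(rt_inv Fg)[[Zd [b [Ab bQ] dE]]|[nZd dE]] e.
  - have [Ra Rb] := (Arho Aa, Arho Ab).
    set y := gsrc c in Zc aQ cE; set z := gsrc d in Zd bQ dE.
    rewrite cE dE !grng_germ // in e.
    have Qyz q : Q y q -> Q z q.
      move=> Qq; have := (QE y q (AK Aa)).2 Qq; rewrite e.
      have -> : bact a q = bact g q.
        by rewrite -!grng_germ ?aQ //; exact: Afull.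
      move=> Qg; pose q' := (bact b)^-1 (bact g q).
      have Qq' : Q z q' by apply/(QE _ _ (AK Ab)); rewrite bVK.
      suff -> : q = q' by [].
      apply: (@b_inj _ (bact g)); rewrite -[RHS]grng_germ // -bQ // grng_germ ?bVK //.
      exact: Afull.
    have ab : germ (rho a) y = germ (rho b) y.
      by apply: rho_germ_eq => // q Qq; rewrite aQ // bQ //; exact: Qyz.
    have yz : y = z by apply: (@b_inj _ (bact (rho b))); rewrite -e -!grng_germ ?ab.
    by rewrite cE dE ab yz.
  - exfalso; apply: nZd; move: e; rewrite cE dE grng_unit grng_germ; last exact: Arho.
    by move=> <-; rewrite gsrc_unit; apply/(ZE _ (AK Aa)).
  - exfalso; apply: nZc; move: e; rewrite cE dE grng_unit grng_germ; last exact: Arho.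
    by move=> ->; rewrite gsrc_unit; apply/(ZE _ (AK Ab)).
  - by move: e; rewrite cE dE !grng_unit => ->.
split; first exact: (bisectionI eH so (rt_src_inj Kg) rI).
- rewrite -subTset => y _; have [Zy|nZ] := pselect (Z y).
    have [a Aa aQ] := matching Kg Zy; exists (germ (rho a) y); first exact: rt_on_Z.
    by rewrite gsrc_germ //; exact: Arho.
  by exists (gunit H y); [exact: rt_off_Z|rewrite gsrc_unit].
- rewrite -subTset => w _; have [Zw|nZ] := pselect (Z w); last first.
    by exists (gunit H w); [exact: rt_off_Z|rewrite grng_unit].
  have Kg' := K_inv SK Kg; have [a Aa aQ] := matching Kg' Zw.
  have Ra := Arho Aa; have Fa := Afull Aa; have Aa' := Ainv Aa.
  have wE : bact (rho (set_inv a)) (bact (rho a) w) = w.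
    by rewrite AV // bact_inv // bK.
  have Zy : Z (bact (rho a) w) by apply/(ZE _ (AK Aa)).
  exists (germ (rho (set_inv a)) (bact (rho a) w)).
    apply: rt_on_Z => // p; rewrite -(bVK (bact a) p) => /(QE _ _ (AK Aa)).
    move: ((bact a)^-1 p) => q Qq; rewrite germ_inv // aQ //.
    have -> : bact a q = bact (set_inv g) q.
      by rewrite -!grng_germ ?aQ //; exact: full_inv.
    by rewrite -germ_inv // ?set_invK //; exact: full_inv.
  by rewrite grng_germ ?wE //; exact: Arho.
Qed.

Lemma rt_alternating a : A a -> rt a = rho a.
Proof.
move=> Aa; have Ka := AK Aa; apply: full_eq; [exact: rt_full|exact: Arho|] => y.
have [Zy|nZ] := pselect (Z y); first exact: rt_germ.
rewrite rt_germ0 //; apply/esym; apply: contrapT => ay; apply: nZ.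
exact: (moved_Z Aa ay).
Qed.

Lemma rt_mul g h : K g -> K h -> rt (set_mul g h) = set_mul (rt g) (rt h).
Proof.
move=> Kg Kh; have Kgh := K_mul SK Kg Kh.
have [Rg Rh] := (rt_full Kg, rt_full Kh); have [Fg Fh] := (Kfull Kg, Kfull Kh).
apply: full_eq; [exact: rt_full|exact: full_mul|] => y; rewrite germ_mul //.
have [Zy|nZ] := pselect (Z y); last first.
  have yE : bact (rt h) y = y by rewrite -grng_germ // rt_germ0 // grng_unit.
  by rewrite !rt_germ0 ?yE // unit_mull ?grng_unit // rt_germ0 // grng_unit.
have [a Aa ah] := matching Kh Zy; have [Fa Ra] := (Afull Aa, Arho Aa).
have yE : bact (rt h) y = bact (rho a) y.
  by rewrite -grng_germ // (rt_germ Kh Zy Aa ah) grng_germ.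
have Zay : Z (bact (rho a) y) by apply/(ZE _ (AK Aa)).
have [b Ab bg] := matching Kg Zay; have [Fb Rb] := (Afull Ab, Arho Ab).
rewrite yE (rt_germ Kh Zy Aa ah) (rt_germ Kg Zay Ab bg) -germ_mul // -AM //.
apply: rt_germ => //; first exact: Amul.
move=> q Qq; rewrite !germ_mul // ah //.
have abq : bact a q = bact h q by rewrite -!grng_germ // ah.
by rewrite abq bg // -abq; apply/(QE _ _ (AK Aa)).
Qed.

Lemma rt_Z g y : K g -> Z (bact (rt g) y) <-> Z y.
Proof.
move=> Kg; have Rg := rt_full Kg; have [Zy|nZ] := pselect (Z y); last first.
  have -> // : bact (rt g) y = y by rewrite -grng_germ // rt_germ0 // grng_unit.
have [a Aa ag] := matching Kg Zy; have Ra := Arho Aa.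
have -> : bact (rt g) y = bact (rho a) y.
  by rewrite -grng_germ // (rt_germ Kg Zy Aa ag) grng_germ.
exact: (ZE _ (AK Aa)).
Qed.

(** The factor that measures how far [rho] is from its extension. *)
Definition psi0 g : set H := set_mul (set_inv (rt g)) (rho g).

Lemma psi0_full g : K g -> full_group H (psi0 g).
Proof.
move=> Kg; apply: full_mul => //; last exact: rfull.
by apply: full_inv => //; exact: rt_full.
Qed.

Lemma rho_psi0 g : K g -> rho g = set_mul (rt g) (psi0 g).
Proof.
by move=> Kg; rewrite /psi0 set_mulA set_mulV ?set_1mul //; exact: rt_full.
Qed.

Lemma psi0_alternating a : A a -> psi0 a = unit_space H.
Proof. by move=> Aa; rewrite /psi0 rt_alternating // set_Vmul //; exact: Arho. Qed.

(** Conjugation by [rt g] and by [rho g] agree on [rho a]: both give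
    [rho (g a g^-1)]. *)
Lemma psi0_comm_alternating g a : K g -> A a ->
  set_mul (psi0 g) (rho a) = set_mul (rho a) (psi0 g).
Proof.
move=> Kg Aa; have Ka := AK Aa; have Fg := Kfull Kg; have Rg := rt_full Kg.
pose b := set_mul g (set_mul a (set_inv g)).
have Ab : A b by exact: (A_conj hX eG minG effG).
have Kb := AK Ab.
have bg : set_mul b g = set_mul g a.
  by rewrite /b -!set_mulA set_Vmul // set_mul1.
have e1 : set_mul (rho g) (rho a) = set_mul (rho b) (rho g).
  by rewrite -!(rho_mul hrho) // bg.
have e2 : set_mul (rt g) (rho a) = set_mul (rho b) (rt g).
  by rewrite -(rt_alternating Aa) -(rt_alternating Ab) -!rt_mul // bg.
have e3 : set_mul (set_inv (rt g)) (rho b) = set_mul (rho a) (set_inv (rt g)).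
  rewrite -[rho b](set_mul1) -(set_mulV eH Rg) [set_mul (rho b) _]set_mulA -e2.
  by rewrite !set_mulA set_Vmul // set_1mul.
by rewrite /psi0 -set_mulA e1 set_mulA e3 -set_mulA.
Qed.

Lemma psi0_stab g a y : K g -> A a ->
  germ (rho a) (bact (psi0 g) y) = gunit H (bact (psi0 g) y) <->
  germ (rho a) y = gunit H y.
Proof.
move=> Kg Aa; have Rc := psi0_full Kg; have Ra := Arho Aa; set c := psi0 g in Rc *.
have e : gmul (germ c (bact (rho a) y)) (germ (rho a) y) =
    gmul (germ (rho a) (bact c y)) (germ c y).
  by rewrite -!germ_mul // psi0_comm_alternating.
have s1 : gsrc (germ c (bact (rho a) y)) = grng (germ (rho a) y).
  by rewrite gsrc_germ // grng_germ.
have s2 : gsrc (germ (rho a) (bact c y)) = grng (germ c y).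
  by rewrite gsrc_germ // grng_germ.
split=> [u|u].
  have ay : bact (rho a) y = y.
    apply: (@b_inj _ (bact c)); have := congr1 (@grng Y H) e.
    by rewrite !grng_mul // !grng_germ // -[in RHS]grng_germ // u grng_unit.
  rewrite u ay unit_mull ?grng_germ // in e.
  have ca : gsrc (germ c y) = grng (germ (rho a) y) by rewrite grng_germ // ay gsrc_germ.
  by have := congr1 (gmul (ginv (germ c y))) e; rewrite gmulKl // gVmul gsrc_germ.
have ay : bact (rho a) y = y by rewrite -grng_germ // u grng_unit.
rewrite u ay unit_mulr ?gsrc_germ // in e.
have := congr1 (fun d => gmul d (ginv (germ c y))) e; rewrite gmulK // gmulV grng_germ //.
Qed.

(** An element that centralises the image of the alternating group preserves the
    stabilizers, hence the finite sets attached to points. *)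
Lemma psi0_Q g y : K g -> Q (bact (psi0 g) y) = Q y.
Proof.
move=> Kg; have sE (f : bijection X) (W : set X) : alt F W f ->
    stab (bact (psi0 g) y) f <-> stab y f.
  move=> Wf; have [a Aa <-] := A_bact hX eG minG effG (altS (@subsetT _ W) Wf).
  have Ka := AK Aa; have sP z := stabP eG effG rho SK z Ka.
  by split=> /sP u; apply/sP/(psi0_stab _ Kg Aa).
apply/seteqP; split=> x nx [W [cW Wx AW]]; apply: nx; exists W; split=> // f Wf;
  by apply/(sE _ _ Wf)/AW.
Qed.

Lemma psi0_Z g y : K g -> Z (bact (psi0 g) y) <-> Z y.
Proof.
move=> Kg; have Rg := rt_full Kg; have Rv := full_inv eH Rg; have Fr := rfull Kg.
rewrite -(ZE y Kg) -(rt_Z (bact (psi0 g) y) Kg) /psi0 bact_mul // bact_inv //.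
by rewrite bME bVK.
Qed.

(** As [psi0 g] preserves [Q y], one [a] computes the germs of [rt h] both at [y] and at
    its image, so that [psi0_comm_alternating] suffices. *)
Lemma psi0_comm g h : K g -> K h -> set_mul (psi0 g) (rt h) = set_mul (rt h) (psi0 g).
Proof.
move=> Kg Kh; have [Rc Rh] := (psi0_full Kg, rt_full Kh).
apply: full_eq; [exact: full_mul|exact: full_mul|] => y.
rewrite (germ_mul eH _ Rc Rh) (germ_mul eH _ Rh Rc).
have [Zy|nZ] := pselect (Z y); last first.
  have nZ' : ~ Z (bact (psi0 g) y) by move=> /(psi0_Z _ Kg).
  have yE : bact (rt h) y = y by rewrite -grng_germ // rt_germ0 // grng_unit.
  rewrite (rt_germ0 Kh nZ) (rt_germ0 Kh nZ') yE.
  by rewrite unit_mulr ?gsrc_germ // unit_mull // grng_germ.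
have [a Aa ah] := matching Kh Zy; have Ra := Arho Aa.
have Zc : Z (bact (psi0 g) y) by apply/(psi0_Z _ Kg).
rewrite (rt_germ Kh Zy Aa ah) (rt_germ (a := a) Kh Zc) //; last first.
  by move=> q; rewrite psi0_Q //; exact: ah.
have -> : bact (rt h) y = bact (rho a) y.
  by rewrite -!grng_germ // (rt_germ Kh Zy Aa ah).
by rewrite -!germ_mul // psi0_comm_alternating.
Qed.

(** [rho] and [rt] are multiplicative and [psi0 g] commutes with [rt h]. *)
Lemma psi0_mul g h : K g -> K h -> psi0 (set_mul g h) = set_mul (psi0 g) (psi0 h).
Proof.
move=> Kg Kh; have [Rg Rh] := (rt_full Kg, rt_full Kh); have Kgh := K_mul SK Kg Kh.
have Rgh := rt_full Kgh; have [Pg Ph] := (psi0_full Kg, psi0_full Kh).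
have e : set_mul (rt (set_mul g h)) (psi0 (set_mul g h)) =
    set_mul (rt (set_mul g h)) (set_mul (psi0 g) (psi0 h)).
  rewrite -rho_psi0 // (rho_mul hrho) // (rho_psi0 Kg) (rho_psi0 Kh) rt_mul //.
  have swap B1 B2 B3 B4 : set_mul B2 B3 = set_mul B3 B2 :> set H ->
      set_mul (set_mul B1 B2) (set_mul B3 B4) = set_mul (set_mul B1 B3) (set_mul B2 B4).
    by move=> c; rewrite -set_mulA [set_mul B2 _]set_mulA c -!set_mulA.
  by apply: swap; exact: psi0_comm.
have := congr1 (set_mul (set_inv (rt (set_mul g h)))) e.
by rewrite !(set_mulA (set_inv _)) set_Vmul // !set_1mul.
Qed.

End Extension.

Lemma factor_quotient (X Y : topologicalType) (G : groupoid X) (H : groupoid Y)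
    (K : set (set G)) (phi : set G -> set H) :
  cantor_basics X -> etale G -> minimal_groupoid G -> effective_groupoid G ->
  subgroup K -> alternating_group G `<=` K ->
  (forall g, K g -> full_group H (phi g)) ->
  (forall g h, K g -> K h -> phi (set_mul g h) = set_mul (phi g) (phi h)) ->
  (forall a, alternating_group G a -> phi a = unit_space H) ->
  exists psi : set (set G) -> set H,
    quotient_morphism K (alternating_group G) psi /\
    forall g, K g -> psi (left_coset (alternating_group G) g) = phi g.
Proof.
move=> hX eG minG effG SK AK phiF phiM phiA; set A := alternating_group G.
have Kfull := K_full SK.
pose psi C := phi (xget (unit_space G) [set g | K g /\ left_coset A g = C]).
have psiE g : K g -> psi (left_coset A g) = phi g.
  move=> Kg; rewrite /psi; case: xgetP => [h _ [Kh hg]|/(_ g)[]//].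
  have : left_coset A g h.
    rewrite -hg; exists (unit_space G); first exact: A_unit.
    exact: set_mul1.
  by move=> [a Aa <-]; rewrite phiM ?(phiA a Aa) ?set_mul1 //; exact: AK.
exists psi; split=> //; split=> [_ [g Kg <-]|_ _ [g Kg <-] [h Kh <-]].
  by rewrite psiE //; exact: phiF.
have Kgh := K_mul SK Kg Kh; rewrite !psiE // -phiM // -psiE //; congr psi.
have [Fg Fh] := (Kfull _ Kg, Kfull _ Kh).
apply/seteqP; split=> T.
  move=> [_ [_ [[a Aa <-] [b Ab <-] ->]]].
  exists (set_mul (set_mul (set_inv h) (set_mul a h)) b).
    apply: A_mul => //; have := A_conj hX eG minG effG (full_inv eG Fh) Aa.
    by rewrite set_invK.
  rewrite -!set_mulA; congr (set_mul g _); rewrite !set_mulA.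
  by rewrite set_mulV // set_1mul.
move=> [a Aa <-]; exists g, (set_mul h a); split.
- by exists (unit_space G); [exact: A_unit|exact: set_mul1].
- by exists a.
- by rewrite set_mulA.
Qed.

(** * Rigidity of continuous morphisms *)

Section Idempotents.
Variables (X : topologicalType) (G : groupoid X).
Implicit Types (E T : set G).

Lemma units_idempotent E : E `<=` unit_space G -> bis_idempotent E.
Proof.
move=> Eu; apply/seteqP; split=> [_ [a [b [Ea Eb ab ->]]]|a Ea].
  have [x _ xa] := Eu _ Ea; rewrite -xa gsrc_unit in ab.
  by rewrite -xa unit_mull.
exists a, a; have [x _ xa] := Eu _ Ea; rewrite -xa in Ea *.
by split=> //; rewrite ?gsrc_unit ?grng_unit // unit_mull ?grng_unit.
Qed.

(** If $c = a b$ in $E$ with $a, b$ in $E$, then $b = c$ by comparison of sources and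
    $a = c$ by comparison of ranges. *)
Lemma idempotent_units E : bisection E -> bis_idempotent E -> E `<=` unit_space G.
Proof.
move=> BE EE c Ec; have [sE rE] := (bisection_src BE, bisection_rng BE).
have : set_mul E E c by rewrite EE.
move=> [a [b [Ea Eb ab cE]]].
have bc : b = c by apply: sE => //; rewrite cE gsrc_mul.
have ac : a = c by apply: rE => //; rewrite cE grng_mul.
rewrite bc ac in ab cE; exists (gsrc c) => //.
by rewrite -gVmul {2}cE gmulKl.
Qed.

Lemma set_mul_units E T : E `<=` unit_space G -> T `<=` unit_space G ->
  set_mul E T `<=` unit_space G.
Proof.
move=> Eu Tu _ [a [b [/Eu[x _ <-] Tb ab ->]]].
by rewrite unit_mull; [exact: Tu|rewrite -ab gsrc_unit].
Qed.

Lemma set_inv_units E : E `<=` unit_space G -> set_inv E `<=` unit_space G.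
Proof. by move=> Eu _ [a /Eu[x _ <-] <-]; exists x => //; rewrite ginv_unit. Qed.

Lemma units_compatible (F : set (set G)) : (forall E, F E -> E `<=` unit_space G) ->
  compatible F.
Proof.
move=> Fu E T /Fu Eu /Fu Tu; split; apply: units_idempotent; apply: set_mul_units => //;
  exact: set_inv_units.
Qed.

Lemma sub_compatible T (F : set (set G)) : src_inj T -> rng_inj T ->
  (forall E, F E -> E `<=` T) -> compatible F.
Proof.
move=> sT rT FT E S /FT ET /FT ST; split; apply: units_idempotent.
- move=> _ [a [_ [Ea [b Sb <-] ab ->]]]; rewrite grng_inv in ab.
  have -> : a = b by apply: sT => //; [exact: ET|exact: ST].
  by rewrite gmulV; exists (grng b).
- move=> _ [_ [b [[a Ea <-] Sb ab ->]]]; rewrite gsrc_inv in ab.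
  have -> : a = b by apply: rT => //; [exact: ET|exact: ST].
  by rewrite gVmul; exists (gsrc b).
Qed.

End Idempotents.

Section Morphism.
Variables (X Y : topologicalType) (G : groupoid X) (H : groupoid Y).
Hypotheses (hX : cantor_basics X) (eG : etale G) (minG : minimal_groupoid G)
  (effG : effective_groupoid G) (eH : etale H).
Variables (K : set (set G)) (rho : set G -> set H).
Hypotheses (SK : subgroup K) (AK : alternating_group G `<=` K)
  (hrho : group_morphism K rho).
Variable r : nat.
Local Notation F := (homeo_group G).
Local Notation A := (alternating_group G).
Let Z := group_supp (rho @` A).
Local Notation HZ := (restriction H Z).
Local Notation Gr := (symmetric_groupoid G r).
Local Notation Xr := (symmetric_power r X).
Variable Phi : set Gr -> set HZ.
Hypotheses (hPhi : continuous_morphism Phi)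
  (extPhi : forall a, A a -> ext_unit (Phi (sym_elt r a)) = rho a).
Implicit Types (a b g h : set G) (x p q : X) (y z : Y) (f : bijection X).
Implicit Types (R : Gr) (T S : set Gr) (al be : HZ) (O : set Xr) (P : Xr).

Let Afull a : A a -> full_group G a := fun Aa => K_full SK (AK Aa).
Let Arho a : A a -> full_group H (rho a) := fun Aa => rho_full hrho (AK Aa).

Lemma Phi_bisection T : bisection T -> bisection (Phi T).
Proof. by case: hPhi => + _ _ _ _; exact. Qed.

Lemma Phi_mul T S : bisection T -> bisection S ->
  Phi (set_mul T S) = set_mul (Phi T) (Phi S).
Proof. by case: hPhi => _ + _ _ _; exact. Qed.

Lemma Phi_bigcup (FF : set (set Gr)) : FF `<=` bisection (G := Gr) -> compatible FF ->
  Phi (\bigcup_(T in FF) T) = \bigcup_(T in FF) Phi T.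
Proof. by case: hPhi => _ _ + _ _; exact. Qed.

Lemma Phi_units O : open O -> Phi (unit_over O) `<=` unit_space HZ.
Proof.
move=> oO; have BO := unit_over_bisection eG oO.
apply: idempotent_units; first exact: Phi_bisection.
rewrite /bis_idempotent -Phi_mul //; congr Phi; apply: units_idempotent.
by move=> _ [P _ <-]; exists P.
Qed.

(** The open subset of [Z] that corresponds to the idempotent [Phi (unit_over O)]. *)
Definition pull O : set Y := [set z | exists2 al, Phi (unit_over O) al & gsrc (val al) = z].

Lemma pull_Z O z : pull O z -> Z z.
Proof. by move=> [al _ <-]; have [] := restr_in al. Qed.

Lemma pullP O z (w : set_type Z) : open O -> val w = z -> pull O z ->
  Phi (unit_over O) (gunit HZ w).
Proof.
move=> oO wz [al Oal alz]; have [v _ vE] := Phi_units oO Oal.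
suff -> : w = v by rewrite vE.
apply: val_inj; rewrite wz -alz -vE.
by rewrite (_ : gsrc _ = val v) //; exact: (gsrc_unit H).
Qed.

Lemma pullT z : Z z -> pull setT z.
Proof.
move=> Zz; pose w : set_type Z := SigSub (mem_set Zz).
exists (gunit HZ w); last exact: (gsrc_unit H).
have -> : unit_over [set: Xr] = unit_space Gr by [].
by case: hPhi => _ _ _ _ ->; exists w.
Qed.

Lemma pull0 z : ~ pull set0 z.
Proof.
move=> [al]; have -> : unit_over (set0 : set Xr) = set0 :> set Gr by exact: image_set0.
by case: hPhi => _ _ _ -> _.
Qed.

Lemma pull_bigcup (OO : set (set Xr)) z : (forall O, OO O -> open O) ->
  pull (\bigcup_(O in OO) O) z -> exists2 O, OO O & pull O z.
Proof.
move=> oOO [al]; pose FF : set (set Gr) := [set unit_over O | O in OO].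
have -> : unit_over (\bigcup_(O in OO) O) = \bigcup_(T in FF) T.
  apply/seteqP; split=> [_ [P [ O OOO OP] <-]|R [_ [ O OOO <-] [P OP <-]]].
    by exists (unit_over O); [exists O|exists P].
  by exists P => //; exists O.
rewrite Phi_bigcup.
- by move=> [_ [ O OOO <-] Oal] alz; exists O => //; exists al.
- by move=> _ [ O OOO <-]; apply: (unit_over_bisection eG); exact: oOO.
- by apply: units_compatible => _ [ O OOO <-] _ [P _ <-]; exists P.
Qed.

Lemma pullS O O' z : open O -> open O' -> O `<=` O' -> pull O z -> pull O' z.
Proof.
move=> oO oO' OO' [al Oal alz]; exists al => //.
pose FF : set (set Gr) := [set unit_over O'' | O'' in [set O; O']].
have -> : unit_over O' = \bigcup_(T in FF) T.
  apply/seteqP; split=> [R OR|R [_ [_ [->|->] <-]] //].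
    by exists (unit_over O') => //; exists O' => //; right.
  by move=> [P OP <-]; exists P => //; exact: OO'.
rewrite Phi_bigcup.
- by exists (unit_over O) => //; exists O => //; left.
- by move=> _ [_ [->|->] <-]; exact: (unit_over_bisection eG).
- by apply: units_compatible => _ [ O'' _ <-] _ [P _ <-]; exists P.
Qed.

Lemma pullI O O' z : open O -> open O' -> pull O z -> pull O' z -> pull (O `&` O') z.
Proof.
move=> oO oO' Oz Oz'; pose w : set_type Z := SigSub (mem_set (pull_Z Oz)).
have Ow := pullP (w := w) oO erefl Oz; have Ow' := pullP (w := w) oO' erefl Oz'.
exists (gunit HZ w); last exact: (gsrc_unit H).
suff -> : unit_over (O `&` O') = set_mul (unit_over O) (unit_over O') :> set Gr.
  rewrite Phi_mul; [|exact: unit_over_bisection..].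
  by exists (gunit HZ w), (gunit HZ w); rewrite gsrc_unit grng_unit unit_mull ?grng_unit.
apply/seteqP; split=> [_ [P [OP OP'] <-]|_ [_ [_ [[P OP <-] [P' OP' <-] e ->]]]].
  exists (gunit Gr P), (gunit Gr P).
  by rewrite gsrc_unit grng_unit unit_mull ?grng_unit //; split=> //; exists P.
rewrite gsrc_unit grng_unit in e; rewrite -e unit_mull ?grng_unit //; exists P => //.
by rewrite -e in OP'.
Qed.

Lemma Phi_elt a z : A a -> Z z ->
  exists2 al, Phi (sym_elt r a) al & val al = germ (rho a) z.
Proof.
move=> Aa Zz; have Ra := Arho Aa; have [az zz] := germ_in z Ra.
move: az; rewrite -(extPhi Aa) => -[//|[v nv vE]]; case: nv.
by rewrite -(gsrc_unit H v) vE (extPhi Aa) zz.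
Qed.

Lemma Phi_eltP a al : A a -> Phi (sym_elt r a) al <-> val al = germ (rho a) (gsrc (val al)).
Proof.
move=> Aa; have Ra := Arho Aa; split=> [aal|alE].
  have ra : rho a (val al) by rewrite -(extPhi Aa); left; exists al.
  by rewrite germ_full.
have [Zs _] := restr_in al.
have [be abe beE] := Phi_elt Aa Zs.
by rewrite (_ : al = be) //; apply: val_inj; rewrite alE beE.
Qed.

Lemma Phi_elt_over a O al : A a -> open O ->
  Phi (set_mul (sym_elt r a) (unit_over O)) al <->
  val al = germ (rho a) (gsrc (val al)) /\ pull O (gsrc (val al)).
Proof.
move=> Aa oO; have Fa := Afull Aa.
rewrite Phi_mul; [|exact: (sym_elt_bisection r eG)|exact: (unit_over_bisection eG)].
split=> [[be [u [abe uO e ->]]]|[alE Oal]].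
  have [w _ wu] := Phi_units oO uO; rewrite -wu grng_unit in e; rewrite -wu unit_mulr //.
  move/(Phi_eltP _ Aa): abe => beE; split=> //; exists u => //.
  by rewrite -(restr_src_val be) e -wu; exact: (gsrc_unit H).
have [Zs _] := restr_in al.
pose w : set_type Z := SigSub (mem_set Zs).
exists al, (gunit HZ w); split.
- exact/(Phi_eltP _ Aa).
- exact: (pullP (w := w) oO erefl Oal).
- by rewrite grng_unit; apply: val_inj.
- by rewrite unit_mulr //; apply: val_inj.
Qed.

(** [Phi] maps the restriction of [a] to [O], which is also its corestriction to [O'], to
    the restriction of [rho a] to [pull O], whose range lies in [pull O']. *)
Lemma pull_image a O O' z : A a -> open O -> open O' ->
  (forall P P', members P' = bact a @` members P -> O P -> O' P') ->
  pull O z -> pull O' (bact (rho a) z).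
Proof.
move=> Aa oO oO' OO' Oz; have [Fa Ra] := (Afull Aa, Arho Aa).
have Zz := pull_Z Oz; have [al aal alE] := Phi_elt Aa Zz.
have : Phi (set_mul (sym_elt r a) (unit_over O)) al.
  by apply/(Phi_elt_over _ Aa oO); rewrite alE gsrc_germ.
have aOE R : set_mul (sym_elt r a) (unit_over O) R <-> arrows R `<=` a /\ O (gsrc R).
  split=> [[R' [_ [aR [P OP <-] RP ->]]]|[aR OR]].
    by rewrite grng_unit in RP; rewrite unit_mulr // RP.
  exists R, (gunit Gr (gsrc R)); split=> //; rewrite ?grng_unit //; last by rewrite unit_mulr.
  by exists (gsrc R).
have OaO R : set_mul (sym_elt r a) (unit_over O) R -> O' (grng R).
  move=> /aOE[aR OR]; apply: OO' OR.
  rewrite members_rng members_src image_comp.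
  by apply: eq_imagel => c Rc /=; rewrite (bactE Fa) //; exact: aR.
have BaO : bisection (set_mul (sym_elt r a) (unit_over O)).
  apply: (sub_sym_elt_bisection eG Fa); last by move=> R /aOE[].
  have -> : set_mul (sym_elt r a) (unit_over O) = sym_elt r a `&` (@gsrc _ Gr @^-1` O).
    by apply/seteqP; split=> R /aOE.
  apply: openI; first exact: open_sym_elt.
  by move/continuousP: (sym_src_continuous (r := r) eG); exact.
have -> : set_mul (sym_elt r a) (unit_over O) =
    set_mul (unit_over O') (set_mul (sym_elt r a) (unit_over O)).
  apply/seteqP; split=> R; last by move=> [_ [R' [[P OP <-] aR' e ->]]]; rewrite unit_mull -?e ?gsrc_unit.
  move=> aR; exists (gunit Gr (grng R)), R; split=> //; rewrite ?gsrc_unit ?unit_mull //.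
  by exists (grng R) => //; exact: OaO.
rewrite Phi_mul //; last exact: unit_over_bisection.
move=> [u [be [uO' _ ube alu]]]; have [w _ wu] := Phi_units oO' uO'.
exists u => //; rewrite -grng_germ // -alE alu -wu unit_mull; last by rewrite -ube -wu gsrc_unit.
by rewrite -restr_rng_val -ube -wu.
Qed.

(** Over the set of the points of the symmetric power whose members have trivial germs for
    [a], the element [a] agrees with the unit, and so do its image and the unit of [H]. *)
Lemma pull_trivial a z : A a -> pull [set P | members P `<=` [set x | germ a x = gunit G x]] z ->
  germ (rho a) z = gunit H z.
Proof.
move=> Aa; set O := [set P | _] => Oz; have [Fa Ra] := (Afull Aa, Arho Aa).
have oO : open O by apply: open_fs_sub; exact: open_trivial_germ.
have Zz := pull_Z Oz; have [al aal alE] := Phi_elt Aa Zz.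
have : Phi (set_mul (sym_elt r a) (unit_over O)) al.
  by apply/(Phi_elt_over _ Aa oO); rewrite alE gsrc_germ.
have -> : set_mul (sym_elt r a) (unit_over O) = unit_over O.
  apply/seteqP; split=> [_ [R [_ [aR [P OP <-] RP ->]]]|_ [P OP <-]].
    rewrite grng_unit in RP; rewrite unit_mulr //; apply/unit_overE; split; last by rewrite RP.
    move=> c Rc; exists (gsrc c) => //; rewrite -OP; first by rewrite germ_full //; exact: aR.
    by rewrite -RP members_src; exists c.
  exists (gunit Gr P), (gunit Gr P).
  rewrite gsrc_unit grng_unit unit_mull ?grng_unit //; split=> //; last by exists P.
  rewrite sym_eltP arrows_unit => _ [x Px <-]; rewrite -(OP _ Px).
  by have [] := germ_in x Fa.
move=> /(Phi_units oO)[w _ wal]; rewrite -alE -wal.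
suff <- : val w = z by [].
by rewrite -(gsrc_germ z Ra) -alE -wal; exact/esym/(gsrc_unit H).
Qed.



Lemma disjoint_clopens n : [set: X] !=set0 -> exists D : 'I_n -> set X,
  [/\ forall j, clopen (D j), forall j, D j !=set0 & forall i j x, D i x -> D j x -> i = j].
Proof.
move=> X0; have [s [us sn]] : exists s : seq X, uniq s /\ size s = n.
  elim: n => [|n [s [us sn]]]; first by exists [::].
  have [x _ xs] := open_minus_finite hX s openT X0.
  by exists (x :: s); rewrite /= xs us sn.
case: n / sn; have [||D [cD Ds _ DI]] :=
    @separate_points _ hX 'I_(size s) (tnth (in_tuple s)) (fun=> setT).
- by move=> j; exact: filterT.
- move=> i j /eqP; have x := tnth (in_tuple s) i.
  by rewrite !(tnth_nth x) nth_uniq // => /eqP/val_inj.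
- by exists D; split=> // j; exists (tnth (in_tuple s) j).
Qed.

Lemma alt_nontrivial (W : set X) : clopen W -> W !=set0 ->
  exists2 a, A a & alt F W (bact a) /\ bact a <> 1.
Proof.
move=> [oW cW] [p Wp]; have hF := homeo_full_dynamics hX eG minG effG.
have oO : open (~` [set p]).
  by apply: closed_openC; apply: (finite_closed hX); exact: finite_set1.
have [x Wx xp] := open_minus_finite hX [:: p] oW (ex_intro _ p Wp).
rewrite inE in xp.
have WO0 : (W `&` ~` [set p]) !=set0 by exists x; split=> //; exact/eqP.
have [//|f [Wf fp _ _]] := @move_into _ _ hX hF W (~` [set p]) p [::] oW Wp oO WO0.
have [|a Aa aE] := A_bact hX eG minG effG (f := f); first exact: altS Wf.
by exists a => //; rewrite aE; split=> // f1; apply: fp; rewrite f1.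
Qed.

Lemma alt_germ_outside a (W : set X) x : A a -> closed W -> alt F W (bact a) -> ~ W x ->
  germ a x = gunit G x.
Proof.
move=> Aa cW Wa nW; apply/(near_germ_unit eG effG x (Afull Aa)).
have : nbhs x (~` W) by apply: open_nbhs_nbhs; split=> //; exact: closed_openC.
by apply: filterS => z nz; exact: alt_fix Wa nz.
Qed.

(** Take [r + 1] non-trivial elements of the alternating group with disjoint supports.  A
    set of at most [r] points misses one of the supports, so the open sets of
    [pull_trivial] for these elements cover the symmetric power.  One of the elements
    then has an image with trivial germ at [z]. *)
Lemma injective_germs_absurd z : Z z -> ~ set_inj K (fun g => germ (rho g) z).
Proof.
move=> Zz injz; have X0 : [set: X] !=set0.
  apply: contrapT => n; apply: (@pull0 z).
  suff <- : [set: Xr] = set0 by exact: pullT.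
  rewrite -subset0 => P _; have [[x _] _ _] := members_small P.
  by apply: n; exists x.
have [D [cD D0 DI]] := disjoint_clopens r.+1 X0.
have /choice[a aP] : forall j, exists a, [/\ A a, alt F (D j) (bact a) & bact a <> 1].
  by move=> j; have [a Aa [Da a1]] := alt_nontrivial (cD j) (D0 j); exists a.
pose O j : set Xr := [set P | members P `<=` [set x | germ (a j) x = gunit G x]].
have oO j : open (O j).
  apply: open_fs_sub; apply: open_trivial_germ => //.
  by have [Aa _ _] := aP j; exact: Afull.
have cover : [set: Xr] = \bigcup_(O' in range O) O'.
  apply/esym; rewrite -subTset => P _; apply: contrapT => n.
  have /choice[x xP] : forall j, exists x, members P x /\ D j x.
    move=> j; apply: contrapT => nx; apply: n; exists (O j); first by exists j.
    move=> x Px; have [Aa Da _] := aP j; apply: (alt_germ_outside Aa _ Da); first by case: (cD j).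
    by move=> Dx; apply: nx; exists x.
  have [_ Pr _] := members_small P.
  have : (`I_r.+1 #<= `I_r)%card.
    apply: card_le_trans Pr; pose f k := x (inord k).
    have fP : f @` `I_r.+1 `<=` members P by move=> _ [k _ <-]; have [] := xP (inord k).
    apply/card_subP; exists (f @` `I_r.+1) => //; apply: inj_card_eq => k l.
    rewrite !inE /= => kr lr e; have [_ Dk] := xP (inord k); have [_ Dl] := xP (inord l).
    have := DI _ _ _ Dk; rewrite -/(f k) e => /(_ _ Dl) /(congr1 val).
    by rewrite /= !inordK.
  by rewrite card_le_II ltnn.
have := pullT Zz; rewrite cover => /pull_bigcup[_ [j _ <-]|_ [j _ <-] Oz]; first exact: oO.
have [Aa _ a1] := aP j; apply: a1; rewrite -(bact_unit eG); congr bact.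
apply: injz; rewrite ?inE; [exact: AK|exact: (K_unit SK)|].
by rewrite (rho_unit eH SK hrho) germ_unit //; exact: (pull_trivial Aa Oz).
Qed.



Local Notation stab := (stab K rho).
Local Notation Q := (attached_set K rho).
Hypothesis finQ : controlled K rho r.

Lemma open_complement (M : set X) : finite_set M -> open (~` M).
Proof. by move=> fM; apply: closed_openC; exact: (finite_closed hX). Qed.

(** Some [a], trivial near [Q z], moves [q] away from [P].  Its image fixes [z], but [a]
    maps a neighbourhood of [P] to a set disjoint from it. *)
Lemma pull_away_new z q P : Z z -> members P q -> ~ Q z q ->
  exists O, [/\ open O, O P & ~ pull O z].
Proof.
move=> Zz Pq nQ; have hF := homeo_full_dynamics hX eG minG effG.
have Qf := Q_finite hX eG minG effG eH SK AK hrho finQ Zz.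
have [s [_ sP]] : exists s : seq X, uniq s /\ forall x, ((Q z `|` members P) `\ q) x <-> x \in s.
  apply: finite_uniq_seq; apply: finite_setD; rewrite finite_setU; split=> //.
  exact: members_finite.
have qs : q \notin s by apply/negP => /sP[_ /=]; exact.
have X0 : ([set: X] `&` ~` [set q]) !=set0.
  have [|x _ xq] := open_minus_finite hX [:: q] (@openT X); first by exists q.
  by exists x; split=> //= e; rewrite e inE eqxx in xq.
have [f [Af fq fs fid]] := move_into hX hF openT I (open_complement (finite_set1 q)) X0 qs.
have [a Aa aE] := A_bact hX eG minG effG Af; have [Fa Ra] := (Afull Aa, Arho Aa).
have naq : (~` members P) (bact a q).
  move=> Pa; rewrite aE in Pa; move/negP: fs; apply; apply/sP; split=> //; right.
  exact: Pa.
have [V [cV Vq VP]] : exists V, [/\ clopen V, V (bact a q) & V `<=` ~` members P].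
  apply: (cantor_basis hX); apply: open_nbhs_nbhs; split=> //.
  by apply: open_complement; exact: members_finite.
pose N : set X := [set x | V (bact a x)].
have oN : open N by have /continuousP := bact_continuous eG Fa; apply; case: cV.
pose meet (U : set X) : set Xr := [set P' | exists2 x, members P' x & U x].
have oV : open (meet V) by apply: open_fs_meet; case: cV.
pose O : set Xr := meet N `&` [set P' | members P' `<=` ~` V].
have oO : open O.
  apply: openI; first exact: open_fs_meet.
  by apply: open_fs_sub; apply: closed_openC; case: cV.
exists O; split=> //; first by split; [exists q|move=> x Px Vx; exact: VP Vx Px].
move=> Oz; have az : bact (rho a) z = z.
  rewrite -grng_germ // (Q_trivial hX eG minG effG SK AK finQ Zz Aa) ?grng_unit // => p Qp.
  apply/(near_germ_unit eG effG p Fa); rewrite aE; apply: fid; apply/sP; split; first by left.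
  by move=> pq; apply: nQ; rewrite -pq.
have : pull (meet V) (bact (rho a) z).
  apply: (pull_image Aa oO oV _ Oz) => P1 P2 P12 [[x Px Nx] _].
  by exists (bact a x) => //; rewrite P12; exists x.
rewrite az => /(pullI oO oV Oz).
suff -> : O `&` meet V = set0 by exact: pull0.
by rewrite -subset0 => P1 [[_ P1V] [x /P1V]].
Qed.

(** Some [a], trivial near [P], moves [q] out of [Q z].  Its image moves [z], in contrast
    with [pull_trivial] near [P]. *)
Lemma pull_away_missing z q P : Z z -> ~ members P q -> Q z q ->
  exists O, [/\ open O, O P & ~ pull O z].
Proof.
move=> Zz nP Qq; have [W [cW Wq WP]] : exists V, [/\ clopen V, V q & V `<=` ~` members P].
  apply: (cantor_basis hX); apply: open_nbhs_nbhs; split=> //.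
  by apply: open_complement; exact: members_finite.
have [a [Aa Wa az]] := mover hX eG minG effG eH SK AK hrho finQ Zz Qq cW Wq.
exists [set P' | members P' `<=` [set x | germ a x = gunit G x]]; split.
- by apply: open_fs_sub; apply: (open_trivial_germ eG); exact: Afull.
- move=> x Px; apply: (alt_germ_outside Aa _ Wa); first by case: cW.
  by move=> Wx; exact: WP Wx Px.
- move=> /(pull_trivial Aa) u; apply: az.
  by rewrite -grng_germ ?u ?grng_unit //; exact: Arho.
Qed.

(** The finite set [Q z] is the only point of the symmetric power all of whose
    neighbourhoods pull back to neighbourhoods of [z]; as pulling back preserves unions,
    this determines it. *)
Lemma pullE O z P : Z z -> open O -> members P = Q z -> pull O z <-> O P.
Proof.
move=> Zz oO PQ; pose OO : set (set Xr) := [set O' | open O' /\ ~ pull O' z].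
have away P' : P' <> P -> exists2 O', OO O' & O' P'.
  move=> ne; have [n|/contrapT PQ'] := pselect (~ members P' `<=` Q z).
    have [q [Pq nQ]] : exists q, members P' q /\ ~ Q z q.
      by apply: contrapT => nq; apply: n => q Pq; apply: contrapT => nQ; apply: nq; exists q.
    by have [ O' [oO' OP' nz]] := pull_away_new Zz Pq nQ; exists O'.
  have [q [Qq nP]] : exists q, Q z q /\ ~ members P' q.
    apply: contrapT => nq; apply: ne; apply: members_inj; rewrite PQ; apply/seteqP; split=> //.
    by move=> q Qq; apply: contrapT => nP; apply: nq; exists q.
  by have [ O' [oO' OP' nz]] := pull_away_missing Zz nP Qq; exists O'.
have nOO : ~ pull (\bigcup_(O' in OO) O') z.
  by move=> /pull_bigcup[ O' []//|O' [_ nz] /nz].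
split=> [Oz|OP].
  apply: contrapT => nP; apply: nOO; apply: (pullS oO _ _ Oz).
    by apply: bigcup_open => O' [].
  by move=> P' OP'; have [|O' OOO' O'P'] := away P'; [move=> e; apply: nP; rewrite -e|exists O'].
have := pullT Zz; rewrite (_ : setT = \bigcup_(O' in OO `|` [set O]) O').
  move=> /pull_bigcup[ O' [[]//|->//]|O' [[_ nz] /nz//|->//]].
apply/esym; rewrite -subTset => P' _; have [->|/away[ O' OOO' O'P']] := pselect (P' = P).
  by exists O => //; right.
by exists O' => //; left.
Qed.

(** [T] is the union of its restrictions to the elements [a] of the alternating group, and
    each of them is the product of [a] and of an idempotent, on which [pullE] gives the
    value of [Phi]. *)
Lemma morphism_determined T : bisection T -> Phi T = rhot K (rho := rho) (r := r) T.
Proof.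
move=> BT; have [oT _ _] := BT.
pose part a := T `&` sym_elt r a.
have partE a (Aa : A a) : part a =
    set_mul (sym_elt r a) (unit_over [set P | T (sec (r := r) (Afull Aa) P)]).
  apply/seteqP; split=> [R [TR aR]|_ [R [_ [aR [P TP <-] RP ->]]]].
    exists R, (gunit Gr (gsrc R)); rewrite grng_unit unit_mulr //; split=> //.
    by exists (gsrc R) => //; rewrite /mkset sec_src.
  rewrite grng_unit in RP; rewrite unit_mulr //; split=> //.
  by rewrite -(sec_src (Afull Aa) aR) RP.
have opart a (Aa : A a) : open [set P | T (sec (r := r) (Afull Aa) P)].
  by have /continuousP := @sec_continuous X G r eG a (Afull Aa); apply.
have TE : T = \bigcup_(S in part @` A) S.
  apply/seteqP; split=> [R TR|_ [_ [a _ <-]] []//].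
  have [a Aa Ra] := multisection_alternating hX eG minG effG
    (arrows_finite R) (@arrows_multisection _ _ _ R).
  by exists (part a) => //; exists a.
rewrite {1}TE Phi_bigcup; last 2 first.
- move=> _ [a Aa <-]; apply: (sub_sym_elt_bisection eG (Afull Aa)); last by move=> R [].
  by apply: openI => //; apply: open_sym_elt => //; exact: Afull.
- apply: (sub_compatible (bisection_src BT) (bisection_rng BT)) => _ [a _ <-] R [].
  by [].
apply/seteqP; split=> al.
  move=> [_ [a Aa <-]]; rewrite (partE a Aa) => /(Phi_elt_over _ Aa (opart a Aa))[alE Oal].
  have Zz := pull_Z Oal; have [P PQ] := Q_point hX eG minG effG eH SK AK hrho finQ Zz.
  exists a, (sec (r := r) (Afull Aa) P); split=> //; last by rewrite arrows_sec PQ.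
  exact/(pullE Zz (opart a Aa) PQ).
move=> [a [R [Aa TR RE alE]]]; exists (part a); first by exists a.
rewrite (partE a Aa); apply/(Phi_elt_over _ Aa (opart a Aa)); split=> //.
have Zz := (restr_in al).1; have RQ := Q_of_arrows (Afull Aa) RE.
apply/(pullE Zz (opart a Aa) RQ); rewrite /mkset sec_src //.
by rewrite RE => _ [q _ <-]; have [] := germ_in q (Afull Aa).
Qed.

End Morphism.

(** * The alternative *)

Lemma cantor_basics_homeomorphic (X T : topologicalType) :
  homeomorphic X T -> cantor_basics T -> cantor_basics X.
Proof.
move=> [f [g [cf cg fK gK]]] hT; split.
- have -> : [set: X] = g @` [set: T].
    by apply/esym; rewrite -subTset => x _; exists (f x).
  apply: continuous_compact; last exact: cantor_compact.
  exact: continuous_subspaceT.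
- move=> x y xy; apply: (can_inj fK); apply: (cantor_hausdorff hT) => B C fB fC.
  by have [z [Bz Cz]] := xy _ _ (cf x _ fB) (cf y _ fC); exists (f z).
- move=> x U xU; have gU : nbhs (f x) (g @^-1` U) by apply: cg; rewrite fK.
  have [D [cD Dx DU]] := cantor_basis hT gU.
  exists (f @^-1` D); split=> //; first exact: preimage_clopen.
  by move=> z /DU; rewrite /= fK.
- move=> x ox; apply: (cantor_no_isolated hT (x := f x)).
  have -> : [set f x] = g @^-1` [set x].
    apply/seteqP; split=> [_ ->|t /= <-]; first by rewrite /= fK.
    by rewrite gK.
  by move/continuousP: cg; apply.
Qed.

Section Alternatives.
Variables (X Y : topologicalType) (G : groupoid X) (H : groupoid Y).
Hypotheses (hX : cantor_basics X) (eG : etale G) (minG : minimal_groupoid G)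
  (effG : effective_groupoid G) (cY : compact [set: Y]) (eH : etale H).
Variables (K : set (set G)) (rho : set G -> set H).
Hypotheses (SK : subgroup K) (AK : alternating_group G `<=` K)
  (hrho : group_morphism K rho).
Local Notation A := (alternating_group G).
Let Z := group_supp (rho @` A).

Lemma trivial_case : Z = set0 ->
  exists rhobar : set (set G) -> set H, quotient_morphism K A rhobar /\
    forall g, K g -> rho g = rhobar (left_coset A g).
Proof.
move=> Z0; have [||a Aa|psi [qpsi psiE]] :=
    factor_quotient (phi := rho) hX eG minG effG SK AK.
- exact: rho_full.
- exact: rho_mul.
- apply: (full_eq (G := H)); [exact: (rho_full hrho (AK Aa))|exact: full_unit|] => y.
  rewrite germ_unit //; apply: contrapT => ay.
  by have : Z y := moved_Z Aa ay; rewrite Z0.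
by exists psi; split=> // g Kg; rewrite psiE.
Qed.

(** The groups [stab y] form a family that is invariant under conjugation, and
    [confining_family] makes it uniformly confined. *)
Lemma confined_controlled : noninjective K rho -> Z !=set0 -> exists r, controlled K rho r.
Proof.
move=> ninj Z0; have [n [f [Ff fm fZ]]] := confining_family eG effG cY eH SK hrho ninj Z0.
have [|||||N NP] := @confined_subgroups X (homeo_group G) [set stab K rho y | y in Z] n f hX
  (homeo_full_dynamics hX eG minG effG) => //.
- by move=> _ [y _ <-]; exact: (stab_subgroup eG eH SK hrho).
- move=> _ a [y Zy <-] Aa; have [b Ab <-] := A_bact hX eG minG effG Aa.
  exists (bact (rho b) y).
    exact: (Z_invariant hX eG minG effG eH SK AK hrho (AK Ab) Zy).
  by apply/seteqP; split=> k /(stab_conj eG eH SK hrho y k (AK Ab)).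
- by move=> _ [y Zy <-]; exact: fZ.
by exists N => y Zy; apply: NP; exists y.
Qed.

End Alternatives.

Theorem theorem7p1 (X Y : topologicalType) (G : groupoid X) (H : groupoid Y)
    (X_cantor : homeomorphic X cantor_space)
    (G_etale : etale G) (G_minimal : minimal_groupoid G)
    (G_effective : effective_groupoid G)
    (Y_compact : compact [set: Y]) (H_etale : etale H)
    (K : set (set G)) (K_subgroup : subgroup K)
    (K_sub : alternating_group G `<=` K)
    (rho : set G -> set H) (rho_morphism : group_morphism K rho) :
  let A := alternating_group G in
  let Z := group_supp (rho @` A) in
  exactly_one
    (Z = set0 /\
     exists rhobar : set (set G) -> set H,
       quotient_morphism K A rhobar /\
       forall g, K g -> rho g = rhobar (left_coset A g))
    (exists2 y, Z y & set_inj K (fun g => germ (rho g) y))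
    ([/\ Z !=set0, clopen Z &
      exists2 r : nat, (0 < r)%N &
      exists rhot : set (symmetric_groupoid G r) -> set (restriction H Z),
        [/\ continuous_morphism rhot,
          forall g, A g -> ext_unit (rhot (sym_elt r g)) = rho g,
          forall rhot' : set (symmetric_groupoid G r) -> set (restriction H Z),
            continuous_morphism rhot' ->
            (forall g, A g -> ext_unit (rhot' (sym_elt r g)) = rho g) ->
            forall T, bisection T -> rhot' T = rhot T &
          exists psi : set (set G) -> set H,
            [/\ quotient_morphism K A psi,
              forall C g, coset_group K A C -> K g ->
                set_mul (psi C) (ext_unit (rhot (sym_elt r g))) =
                set_mul (ext_unit (rhot (sym_elt r g))) (psi C) &
              forall g, K g ->
                rho g = set_mul (ext_unit (rhot (sym_elt r g)))
                          (psi (left_coset A g))]]]).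
Proof.
have hX := cantor_basics_homeomorphic X_cantor (cantor_like_basics cantor_like_cantor_space).
move=> A Z; have [Z0|/eqP/set0P Z0] := pselect (Z = set0).
  constructor 1; split.
  - by split=> //; exact: (trivial_case hX G_etale G_minimal G_effective H_etale K_subgroup K_sub rho_morphism).
  - by move=> [y]; rewrite Z0.
  - by move=> [[y]]; rewrite Z0.
have n1 : ~ (Z = set0 /\ exists rhobar : set (set G) -> set H,
    quotient_morphism K A rhobar /\ forall g, K g -> rho g = rhobar (left_coset A g)).
  by move=> [e]; case: Z0 => y; rewrite e.
have [inj|ninj] := pselect (exists2 y, Z y & set_inj K (fun g => germ (rho g) y)).
  constructor 2; split=> // -[_ _ [r _ [rhot [mor ext _ _]]]]; case: inj => y Zy.
  exact: (injective_germs_absurd hX G_etale G_minimal G_effective H_etale K_subgroup K_sub rho_morphism mor ext Zy).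
constructor 3; split=> //.
have [N finN] := confined_controlled hX G_etale G_minimal G_effective Y_compact
  H_etale K_subgroup K_sub rho_morphism ninj Z0.
have finQ : controlled K rho N.+1.
  move=> y /finN[s [us sN sQ sA sP]].
  by exists s; split=> //; exact: leq_trans sN _.
split=> //.
  exact: (Z_clopen hX G_etale G_minimal G_effective H_etale K_subgroup K_sub
    rho_morphism finQ).
exists N.+1 => //; exists (@rhot _ _ _ _ K rho N.+1); split.
- exact: (rhot_morphism hX G_etale G_minimal G_effective H_etale K_subgroup K_sub
    rho_morphism finQ).
- move=> g; exact: (rt_alternating hX G_etale G_minimal G_effective H_etale K_subgroup
    K_sub rho_morphism finQ).
- move=> Phi hPhi extPhi T.
  exact: (morphism_determined hX G_etale G_minimal G_effective H_etale K_subgroup K_sub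
    rho_morphism hPhi extPhi finQ).
have [|||psi [qpsi psiE]] := factor_quotient (phi := psi0 K rho N.+1) (H := H) hX
    G_etale G_minimal G_effective K_subgroup K_sub.
- move=> g; exact: (psi0_full hX G_etale G_minimal G_effective H_etale K_subgroup K_sub
    rho_morphism finQ).
- move=> g h; exact: (psi0_mul hX G_etale G_minimal G_effective H_etale K_subgroup K_sub
    rho_morphism finQ).
- move=> a; exact: (psi0_alternating hX G_etale G_minimal G_effective H_etale K_subgroup
    K_sub rho_morphism finQ).
exists psi; split=> // [_ g [h Kh <-] Kg|g Kg]; rewrite psiE //.
- exact: (psi0_comm hX G_etale G_minimal G_effective H_etale K_subgroup K_sub
    rho_morphism finQ).
- exact: (rho_psi0 hX G_etale G_minimal G_effective H_etale K_subgroup K_sub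
    rho_morphism finQ).
Qed.
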